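(* Let $f$ be a real entire function of order less than $2$ all of whose zeros are real and distinct (simple), satisfying $f''-2af'+bf=0$, and let $\Delta(x)=b(x)-a^2(x)$. (i) If $a(x)$ and $b(x)$ are differentiable in a vicinity of a zero $x_i$ of $f$, then $$\Delta(x_i)-2a'(x_i)\ge 0.$$ (ii) If $a(x)$ and $b(x)$ are two times differentiable in a vicinity of a zero $x_i$ of $f$, then for $x=x_i$ (all of $a,b$ and their derivatives being evaluated at $x_i$), $$\min_{\lambda}\Big\{(b^2-8a^2a'-4ba'+4a'^2+4ab'-4aa'')\lambda^4-4(ab-4aa'+b'-a'')\lambda^3+2(2a^2+b-2a')\lambda^2-4a\lambda+1\Big\}\ge 0,$$ where $\lambda$ ranges over the real numbers.
   Context: The class of functions considered, denoted $\mathcal{L}\text{-}\mathcal{P}(I)$ in the paper, consists of the real entire functions of order less than $2$ with only distinct real zeros; by Hadamard's factorization theorem these are either polynomials or have a canonical product representation $f(x)=c\,x^m e^{\beta x}\prod_{i=1}^{\infty}\left(1-\frac{x}{x_i}\right)e^{x/x_i}$ with $c,\beta,x_i$ real, $m=0$ or $1$, and $\sum x_i^{-2}<\infty$. The function $f$ is not identically zero. The functions $a,b$ are real-valued functions of a real variable (possibly undefined at some points), and the equation $f''-2af'+bf=0$ holds at all real points where $a,b$ are defined. *)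

(* Defs.v *)
(* Standard library reals and Coquelicot. *)
From Stdlib Require Import Reals.
From Coquelicot Require Import Coquelicot.
Open Scope R_scope.

Definition entire (f : C -> C) : Prop :=
  forall z : C, ex_derive (K := C_AbsRing) (V := C_NormedModule) f z.

Definition real_entire (f : C -> C) : Prop :=
  entire f /\ forall x : R, Im (f (RtoC x)) = 0.

(* The order of growth: the infimum of the exponents k > 0 such that
   M(r) = max_{|z| = r} |f z| satisfies M(r) < exp (r ^ k) for all large r.
   It is p_infty when there is no such k. *)
Definition growth_exponent (f : C -> C) (k : R) : Prop :=
  0 < k /\
  exists r0 : R, 0 < r0 /\
    forall z : C, r0 < Cmod z -> Cmod (f z) < exp (Rpower (Cmod z) k).

Definition growth_order (f : C -> C) : Rbar := Glb_Rbar (growth_exponent f).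

Definition only_real_simple_zeros (f : C -> C) : Prop :=
  forall z : C, f z = RtoC 0 ->
    Im z = 0 /\
    ~ is_derive (K := C_AbsRing) (V := C_NormedModule) f z (RtoC 0).

Definition restr_R (f : C -> C) : R -> R := fun x => Re (f (RtoC x)).

(* A partial function of a real variable is a pair of a domain Da : R -> Prop
   and a total function a : R -> R whose values outside Da are irrelevant. *)
Definition satisfies_ode (f : R -> R)
    (Da : R -> Prop) (a : R -> R) (Db : R -> Prop) (b : R -> R) : Prop :=
  forall x : R, Da x -> Db x ->
    Derive_n f 2 x - 2 * a x * Derive f x + b x * f x = 0.

(* The neighbourhood is required to lie in the domain, so that Derive a and
   Derive_n a 2 near x depend only on the values of a on Da. *)
Definition differentiable_near (Da : R -> Prop) (a : R -> R) (x : R) : Prop :=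
  locally x (fun y => Da y /\ ex_derive a y).

Definition twice_differentiable_near
    (Da : R -> Prop) (a : R -> R) (x : R) : Prop :=
  locally x (fun y => Da y /\ ex_derive a y /\ ex_derive_n a 2 y).

Definition is_minimum (P : R -> R) (m : R) : Prop :=
  (exists l : R, P l = m) /\ forall l : R, m <= P l.

Definition Delta_fn (a b : R -> R) (x : R) : R := b x - a x ^ 2.

Definition quartic (a b : R -> R) (x : R) (lam : R) : R :=
  let a0 := a x in let a1 := Derive a x in let a2 := Derive_n a 2 x in
  let b0 := b x in let b1 := Derive b x in
  (b0 ^ 2 - 8 * a0 ^ 2 * a1 - 4 * b0 * a1 + 4 * a1 ^ 2
     + 4 * a0 * b1 - 4 * a0 * a2) * lam ^ 4
  - 4 * (a0 * b0 - 4 * a0 * a1 + b1 - a2) * lam ^ 3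
  + 2 * (2 * a0 ^ 2 + b0 - 2 * a1) * lam ^ 2
  - 4 * a0 * lam + 1.

(* Main.v *)
Require Import Defs.
From Stdlib Require Import Reals.
From Coquelicot Require Import Coquelicot.
From Stdlib Require Import Lra List Classical ClassicalEpsilon.
Open Scope R_scope.

(** Let [h z = f (xi + z) / z].  At the zero [xi] the differential equation and
    its derivatives express the derivatives of [f] of order two to four
    through [a], [b] and their derivatives ([ode_derivative],
    [ode_second_derivative]).  In terms of [h] this says that the logarithm of
    [h] has first derivative [a] at 0, that its second derivative is [- S2]
    with [S2 = (Delta - 2 a') / 3], and that the third one, [2 S3], is a
    polynomial in the same data.  If [a_k] are the zeros of [h], then [S2] and
    [- S3] are the sums of the [1 / a_k^2] and of the [1 / a_k^3].  The [a_k]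
    are real, whence

      [0 <= S2]  and  [|S3| <= S2^(3/2)].

    The first inequality is part (i).  For part (ii), put [mu = 1 - a lam]; the
    quartic is

      [mu^4 + 6 mu^2 lam^2 S2 + 9 lam^4 S2^2 + 16 mu lam^3 S3],

    and by the second inequality it is nonnegative
    ([power_sum_quartic_nonneg]).  A nonnegative polynomial of degree at most
    four attains its minimum ([quartic_minimum]).

    The inequalities for [S2] and [S3] ([real_zeros_jet_inequalities]) do not
    require Hadamard's factorization, nor the convergence of the sums.  On a
    disc of radius [rho] there are finitely many zeros.  Replacing each factor
    [z - a_k] by its reflection [(rho^2 - a_k z) / rho] produces a function [g]
    without zeros in the disc and with [|g| = |h| <= exp (eps rho^2)] on its
    boundary, [eps] being arbitrarily small because the order is less than 2
    ([jet_bound_zeros]).  The Borel-Caratheodory estimate ([log_jet_bound])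
    bounds the Taylor coefficients of order [n = 2, 3] of [log g] by a multiple
    of [(eps rho^2 - ln |h 0|) / rho^n].  Hence, up to a small error, [S2] and
    [- S3] equal

      [W = sum (1 / a_k^2 - a_k^2 / rho^4)]  and
      [V = sum (1 / a_k^3 - a_k^3 / rho^6)]

    over [|a_k| < rho].  Each term of [W] is nonnegative, and
    [|V| <= W (sqrt W + 2 / rho)]; it remains to let [rho] tend to infinity.

    The function theory behind this starts from differentiability alone.
    Goursat's theorem gives a primitive ([goursat], [entire_primitive]),
    Cauchy's formula on circles for functions with continuous derivative gives
    the higher derivatives ([entire_derivative]), and division by a linear
    factor at a zero is an integral of the derivative along a segment
    ([entire_division]).  For the Borel-Caratheodory estimate no logarithm is
    constructed: the circular means of [ln |g|] against cosines are computed
    by differentiating them in the radius, which brings in circular means of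
    [g' / g]. *)

(** * Complex differentiability and continuity *)

Notation is_Cderive := (is_derive (K := C_AbsRing) (V := C_NormedModule)).
Notation is_curve_derive :=
  (is_derive (K := R_AbsRing) (V := C_R_NormedModule)).

Lemma Cmod_le_sum (z : C) : Cmod z <= Rabs (Re z) + Rabs (Im z).
Proof.
  destruct z as [x y]; unfold Cmod, Re, Im; simpl fst; simpl snd.
  rewrite <- (sqrt_pow2 (Rabs x + Rabs y))
    by (generalize (Rabs_pos x) (Rabs_pos y); lra).
  apply sqrt_le_1_alt.
  rewrite <- (pow2_abs x), <- (pow2_abs y).
  generalize (Rabs_pos x) (Rabs_pos y); nra.
Qed.

Lemma im_le_Cmod (z : C) : Rabs (Im z) <= Cmod z.
Proof. eapply Rle_trans; [apply Rmax_r | apply (Rmax_Cmod z)]. Qed.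

Lemma ball_Cmod (z w : C) (e : posreal) :
  Cmod (w - z) < e -> ball (M := C_UniformSpace) z e w.
Proof. intros H; apply C_NormedModule_mixin_compat1; exact H. Qed.

Lemma Cmod_ball (z w : C) (e : posreal) :
  ball (M := C_UniformSpace) z e w -> Cmod (w - z) < 2 * e.
Proof.
  intros [H1 H2].
  change (Rabs (Re w - Re z) < e) in H1.
  change (Rabs (Im w - Im z) < e) in H2.
  eapply Rle_lt_trans; [apply Cmod_le_sum|].
  replace (Re (w - z)) with (Re w - Re z) by reflexivity.
  replace (Im (w - z)) with (Im w - Im z) by reflexivity.
  lra.
Qed.

Lemma locally_Cmod (z : C) (P : C -> Prop) :
  locally (T := C_UniformSpace) z P <->
  exists d, 0 < d /\ forall w, Cmod (w - z) < d -> P w.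
Proof.
  split.
  - intros [e He]. exists e; split; [apply cond_pos|].
    intros w Hw. apply He, ball_Cmod, Hw.
  - intros [d [Hd H]].
    assert (Hd2 : 0 < d / 2) by lra.
    exists (mkposreal _ Hd2). intros w Hw. apply H.
    apply Cmod_ball in Hw. simpl in Hw. lra.
Qed.

Lemma continuous_Cmod {T : UniformSpace} (f : T -> C) (x : T) :
  continuous (U := C_UniformSpace) f x <->
  forall e, 0 < e -> locally x (fun y => Cmod (f y - f x) < e).
Proof.
  split.
  - intros H e He. apply (H (fun w => Cmod (w - f x) < e)).
    apply locally_Cmod. exists e; auto.
  - intros H P HP. apply locally_Cmod in HP. destruct HP as [d [Hd HP]].
    unfold filtermap. eapply filter_imp; [| apply (H d Hd)].
    intros y Hy. apply HP, Hy.
Qed.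

(** [is_derive] quantifies over all limit points of a filter; over a normed
    ring there is only one. *)
Lemma is_derive_domin {K : AbsRing} {V : NormedModule K} (f : K -> V) (x : K) (l : V) :
  is_derive f x l <->
  forall e : posreal, locally x (fun y =>
    norm (minus (minus (f y) (f x)) (scal (minus y x) l)) <= e * norm (minus y x)).
Proof.
  split.
  - intros [_ H]. apply (H x). intros P HP. exact HP.
  - intros H. split; [apply is_linear_scal_l|]. intros y Hy.
    assert (E : x = y)
      by (apply (is_filter_lim_locally_unique (V := AbsRing_NormedModule K)); exact Hy).
    subst y. exact H.
Qed.

(** [C] carries two normed structures over itself, as a module and as a ring,
    with different balls; this elementary form of differentiability serves for
    both. *)
Definition Cderive_eps (f : C -> C) (z l : C) : Prop :=
  forall e, 0 < e -> exists d, 0 < d /\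
    forall w, Cmod (w - z) < d ->
      Cmod (f w - f z - (w - z) * l) <= e * Cmod (w - z).

Lemma is_Cderive_eps (f : C -> C) (z l : C) :
  is_Cderive f z l <-> Cderive_eps f z l.
Proof.
  rewrite is_derive_domin. split.
  - intros H e He. destruct (H (mkposreal e He)) as [d Hd].
    exists d; split; [apply cond_pos|]. intros w Hw. apply (Hd w). exact Hw.
  - intros H e. destruct (H e (cond_pos e)) as [d [Hd Hw]].
    exists (mkposreal d Hd). intros w Hb. apply (Hw w). exact Hb.
Qed.

Lemma is_Cderive_ring (f : C -> C) (z l : C) :
  is_Cderive f z l <->
  is_derive (K := C_AbsRing) (V := AbsRing_NormedModule C_AbsRing) f z l.
Proof.
  rewrite is_Cderive_eps, is_derive_domin. split.
  - intros H e. destruct (H e (cond_pos e)) as [d [Hd Hw]].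
    exists (mkposreal d Hd). intros w Hb. apply (Hw w). exact Hb.
  - intros H e He. destruct (H (mkposreal e He)) as [d Hd].
    exists d; split; [apply cond_pos|]. intros w Hw. apply (Hd w). exact Hw.
Qed.

Lemma is_Cderive_plus (f g : C -> C) (z a b : C) :
  is_Cderive f z a -> is_Cderive g z b ->
  is_Cderive (fun w => f w + g w)%C z (a + b)%C.
Proof. intros Hf Hg. apply (is_derive_plus f g z a b Hf Hg). Qed.

Lemma is_Cderive_minus (f g : C -> C) (z a b : C) :
  is_Cderive f z a -> is_Cderive g z b ->
  is_Cderive (fun w => f w - g w)%C z (a - b)%C.
Proof. intros Hf Hg. apply (is_derive_minus f g z a b Hf Hg). Qed.

Lemma is_Cderive_mult (f g : C -> C) (z a b : C) :
  is_Cderive f z a -> is_Cderive g z b ->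
  is_Cderive (fun w => f w * g w)%C z (a * g z + f z * b)%C.
Proof.
  rewrite !is_Cderive_ring. intros Hf Hg.
  apply (is_derive_mult f g z a b Hf Hg). intros n m; apply Cmult_comm.
Qed.

Lemma is_Cderive_comp (f g : C -> C) (z a b : C) :
  is_Cderive f (g z) a -> is_Cderive g z b ->
  is_Cderive (fun w => f (g w)) z (b * a)%C.
Proof.
  intros Hf Hg. rewrite is_Cderive_ring in Hg.
  apply (is_derive_comp f g z a b Hf Hg).
Qed.

Lemma is_Cderive_const (c z : C) : is_Cderive (fun _ => c) z (RtoC 0).
Proof. apply (is_derive_const (K := C_AbsRing) (V := C_NormedModule) c z). Qed.

Lemma is_Cderive_id (z : C) : is_Cderive (fun w => w) z (RtoC 1).
Proof. rewrite is_Cderive_ring. apply (is_derive_id (K := C_AbsRing) z). Qed.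

Lemma is_Cderive_eq (f : C -> C) (z l l' : C) :
  is_Cderive f z l -> l = l' -> is_Cderive f z l'.
Proof. now intros H <-. Qed.

Lemma is_Cderive_continuous_pt (f : C -> C) (z l : C) :
  is_Cderive f z l ->
  continuous (T := C_UniformSpace) (U := C_UniformSpace) f z.
Proof.
  intros H. rewrite is_Cderive_eps in H. apply continuous_Cmod. intros e He.
  destruct (H 1 Rlt_0_1) as [d [Hd Hw]].
  assert (Hl := Cmod_ge_0 l).
  apply locally_Cmod. exists (Rmin d (e / (2 + Cmod l))). split.
  { apply Rmin_pos; [lra | apply Rdiv_lt_0_compat; lra]. }
  intros w Hwz.
  assert (H1 : Cmod (w - z) < d) by (eapply Rlt_le_trans; [exact Hwz | apply Rmin_l]).
  assert (H2 : Cmod (w - z) < e / (2 + Cmod l))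
    by (eapply Rlt_le_trans; [exact Hwz | apply Rmin_r]).
  specialize (Hw w H1).
  replace (f w - f z)%C with ((f w - f z - (w - z) * l) + (w - z) * l)%C by ring.
  eapply Rle_lt_trans; [apply Cmod_triangle|]. rewrite Cmod_mult.
  assert (H3 : Cmod (w - z) * (2 + Cmod l) < e).
  { apply (Rmult_lt_compat_r (2 + Cmod l)) in H2; [|lra].
    replace (e / (2 + Cmod l) * (2 + Cmod l)) with e in H2 by (field; lra). lra. }
  generalize (Cmod_ge_0 (w - z)); nra.
Qed.

Section Continuity.
Context {T : UniformSpace}.
Implicit Types u v : T -> C.

Lemma continuous_C_pair (p q : T -> R) (x : T) :
  continuous p x -> continuous q x ->
  continuous (U := C_UniformSpace) (fun t => (p t, q t) : C) x.
Proof.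
  intros Hp Hq. apply continuous_Cmod. intros e He.
  assert (He2 : 0 < e / 2) by lra.
  assert (H1 := Hp _ (locally_ball (p x) (mkposreal _ He2))).
  assert (H2 := Hq _ (locally_ball (q x) (mkposreal _ He2))).
  unfold filtermap in H1, H2.
  eapply filter_imp; [| apply (filter_and _ _ H1 H2)].
  intros y [Hy1 Hy2].
  change (Rabs (p y - p x) < e / 2) in Hy1.
  change (Rabs (q y - q x) < e / 2) in Hy2.
  eapply Rle_lt_trans; [apply Cmod_le_sum|]. simpl. unfold Rminus in *. lra.
Qed.

Lemma continuous_Re u (x : T) :
  continuous (U := C_UniformSpace) u x -> continuous (fun t => Re (u t)) x.
Proof.
  intros H. apply (continuous_comp u (fun z : C => fst z) x H).
  apply (continuous_fst (U := R_UniformSpace) (V := R_UniformSpace)).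
Qed.

Lemma continuous_Im u (x : T) :
  continuous (U := C_UniformSpace) u x -> continuous (fun t => Im (u t)) x.
Proof.
  intros H. apply (continuous_comp u (fun z : C => snd z) x H).
  apply (continuous_snd (U := R_UniformSpace) (V := R_UniformSpace)).
Qed.

Lemma continuous_C_plus u v (x : T) :
  continuous (U := C_UniformSpace) u x -> continuous (U := C_UniformSpace) v x ->
  continuous (U := C_UniformSpace) (fun t => u t + v t)%C x.
Proof. intros Hu Hv. apply (continuous_plus (V := C_R_NormedModule) u v x Hu Hv). Qed.

Lemma continuous_C_minus u v (x : T) :
  continuous (U := C_UniformSpace) u x -> continuous (U := C_UniformSpace) v x ->
  continuous (U := C_UniformSpace) (fun t => u t - v t)%C x.
Proof. intros Hu Hv. apply (continuous_minus (V := C_R_NormedModule) u v x Hu Hv). Qed.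

Lemma continuous_C_mult u v (x : T) :
  continuous (U := C_UniformSpace) u x -> continuous (U := C_UniformSpace) v x ->
  continuous (U := C_UniformSpace) (fun t => u t * v t)%C x.
Proof.
  intros Hu Hv. unfold Cmult.
  assert (Hu1 := continuous_Re u x Hu). assert (Hu2 := continuous_Im u x Hu).
  assert (Hv1 := continuous_Re v x Hv). assert (Hv2 := continuous_Im v x Hv).
  apply continuous_C_pair.
  - apply (continuous_minus (V := R_NormedModule)
             (fun t => Re (u t) * Re (v t)) (fun t => Im (u t) * Im (v t)));
      apply (continuous_mult (K := R_AbsRing)); assumption.
  - apply (continuous_plus (V := R_NormedModule)
             (fun t => Re (u t) * Im (v t)) (fun t => Im (u t) * Re (v t)));
      apply (continuous_mult (K := R_AbsRing)); assumption.
Qed.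

Lemma continuous_C_const (c : C) (x : T) :
  continuous (U := C_UniformSpace) (fun _ => c) x.
Proof. apply (continuous_const (V := C_UniformSpace)). Qed.

Lemma continuous_C_pow u (x : T) (n : nat) :
  continuous (U := C_UniformSpace) u x ->
  continuous (U := C_UniformSpace) (fun t => u t ^ n)%C x.
Proof.
  intros Hu. induction n as [|n IH]; simpl.
  - apply continuous_C_const.
  - now apply continuous_C_mult.
Qed.

Lemma continuous_Cconj u (x : T) :
  continuous (U := C_UniformSpace) u x ->
  continuous (U := C_UniformSpace) (fun t => Cconj (u t)) x.
Proof.
  intros Hu. unfold Cconj. apply continuous_C_pair.
  - now apply continuous_Re.
  - apply (continuous_opp (V := R_NormedModule) (fun t => Im (u t))).
    now apply continuous_Im.
Qed.

Lemma continuous_RtoC (p : T -> R) (x : T) :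
  continuous p x -> continuous (U := C_UniformSpace) (fun t => RtoC (p t)) x.
Proof.
  intros Hp. unfold RtoC. apply continuous_C_pair; [assumption|].
  apply continuous_const.
Qed.
End Continuity.

Lemma is_Cderive_inv (f : C -> C) (z a : C) :
  is_Cderive f z a -> f z <> RtoC 0 ->
  is_Cderive (fun w => / f w)%C z (- a / (f z * f z))%C.
Proof.
  intros Hf Hz.
  apply (is_Cderive_eq _ _ (a * (- / (f z * f z)))%C); [|field; auto].
  apply (is_Cderive_comp (fun y => / y)%C f z); [|exact Hf].
  set (p := f z) in *. clearbody p. clear Hf f.
  apply is_Cderive_eps. intros e He.
  assert (Hp : 0 < Cmod p) by now apply Cmod_gt_0.
  set (m := Cmod p) in *.
  exists (Rmin (m / 2) (e * m ^ 3 / 2)). split.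
  { apply Rmin_pos; [lra|]. generalize (pow_lt m 3 Hp); nra. }
  intros w Hw.
  assert (H1 : Cmod (w - p) < m / 2) by (eapply Rlt_le_trans; [exact Hw | apply Rmin_l]).
  assert (H2 : Cmod (w - p) < e * m ^ 3 / 2)
    by (eapply Rlt_le_trans; [exact Hw | apply Rmin_r]).
  assert (Hwm : m / 2 < Cmod w).
  { assert (m <= Cmod w + Cmod (w - p)); [|lra].
    unfold m. replace p with (w + - (w - p))%C at 1 by ring.
    eapply Rle_trans; [apply Cmod_triangle|]. rewrite Cmod_opp. lra. }
  assert (Hw0 : w <> RtoC 0) by (apply Cmod_gt_0; lra).
  replace (/ w - / p - (w - p) * - / (p * p))%C
    with ((w - p) * (w - p) / (w * p * p))%C by (field; auto).
  rewrite Cmod_div by (repeat apply Cmult_neq_0; auto).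
  rewrite !Cmod_mult. fold m.
  assert (Hk : 0 < Cmod w * m * m) by (apply Rmult_lt_0_compat; nra).
  apply (Rmult_le_reg_r (Cmod w * m * m)); [exact Hk|].
  unfold Rdiv. rewrite Rmult_assoc, Rinv_l, Rmult_1_r by lra.
  assert (Cmod (w - p) <= e * (Cmod w * m * m)).
  { assert (m ^ 3 / 2 <= Cmod w * m * m); [|nra].
    replace (m ^ 3 / 2) with (m / 2 * m * m) by field.
    apply Rmult_le_compat_r; [lra|]. apply Rmult_le_compat_r; lra. }
  generalize (Cmod_ge_0 (w - p)); nra.
Qed.

Lemma is_Cderive_div (f g : C -> C) (z a b : C) :
  is_Cderive f z a -> is_Cderive g z b -> g z <> RtoC 0 ->
  is_Cderive (fun w => f w / g w)%C z ((a * g z - f z * b) / (g z * g z))%C.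
Proof.
  intros Hf Hg Hz. unfold Cdiv at 1.
  eapply is_Cderive_eq;
    [apply (is_Cderive_mult f (fun w => / g w)%C); [exact Hf | apply is_Cderive_inv; eauto] |].
  field; auto.
Qed.

Lemma norm_C_R (z : C) : norm (K := R_AbsRing) (V := C_R_NormedModule) z = Cmod z.
Proof.
  destruct z as [x y]. unfold Cmod. simpl.
  change (prod_norm (K := R_AbsRing) (U := R_NormedModule) (V := R_NormedModule) (x, y)
          = sqrt (x * (x * 1) + y * (y * 1))).
  unfold prod_norm. simpl. unfold norm; simpl. unfold abs; simpl.
  f_equal. generalize (pow2_abs x) (pow2_abs y); simpl; intros; lra.
Qed.

Lemma is_curve_derive_eps (g : R -> C) (t : R) (l : C) :
  is_curve_derive g t l <->
  forall e, 0 < e -> locally t (fun s =>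
    Cmod (g s - g t - RtoC (s - t) * l)%C <= e * Rabs (s - t)).
Proof.
  assert (E : forall s, norm (K := R_AbsRing) (V := C_R_NormedModule)
      (minus (minus (g s) (g t)) (scal (minus s t) l))
      = Cmod (g s - g t - RtoC (s - t) * l)%C)
    by (intros s; rewrite <- scal_R_Cmult; apply norm_C_R).
  rewrite is_derive_domin. split.
  - intros H e He. eapply filter_imp; [|exact (H (mkposreal e He))].
    intros s Hs. eapply Rle_trans; [apply Req_le, eq_sym, E | exact Hs].
  - intros H e. eapply filter_imp; [|exact (H e (cond_pos e))].
    intros s Hs. eapply Rle_trans; [apply Req_le, E | exact Hs].
Qed.

Lemma is_derive_eps (p : R -> R) (t l : R) :
  is_derive p t l <->
  forall e, 0 < e -> locally t (fun s =>
    Rabs (p s - p t - (s - t) * l) <= e * Rabs (s - t)).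
Proof.
  rewrite is_derive_domin. split.
  - intros H e He. exact (H (mkposreal e He)).
  - intros H e. exact (H e (cond_pos e)).
Qed.

Lemma is_curve_derive_pair (p q : R -> R) (t a b : R) :
  is_derive p t a -> is_derive q t b ->
  is_curve_derive (fun s => (p s, q s) : C) t (a, b).
Proof.
  rewrite !is_derive_eps, is_curve_derive_eps. intros Hp Hq e He.
  assert (He2 : 0 < e / 2) by lra.
  eapply filter_imp; [| apply (filter_and _ _ (Hp _ He2) (Hq _ He2))].
  intros s [H1 H2]. eapply Rle_trans; [apply Cmod_le_sum|].
  replace (Re ((p s, q s) - (p t, q t) - RtoC (s - t) * (a, b))%C)
    with (p s - p t - (s - t) * a) by (simpl; ring).
  replace (Im ((p s, q s) - (p t, q t) - RtoC (s - t) * (a, b))%C)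
    with (q s - q t - (s - t) * b) by (simpl; ring).
  lra.
Qed.

Lemma is_curve_derive_eq (g : R -> C) (t : R) (l l' : C) :
  is_curve_derive g t l -> l = l' -> is_curve_derive g t l'.
Proof. now intros H <-. Qed.

Lemma is_Cderive_curve (f : C -> C) (g : R -> C) (t : R) (a b : C) :
  is_Cderive f (g t) a -> is_curve_derive g t b ->
  is_curve_derive (fun s => f (g s)) t (b * a)%C.
Proof.
  intros Hf Hg.
  assert (Hgc : continuous (U := C_UniformSpace) g t)
    by (apply (ex_derive_continuous (K := R_AbsRing) (V := C_R_NormedModule)); now exists b).
  rewrite is_Cderive_eps in Hf. rewrite is_curve_derive_eps in Hg |- *. intros e He.
  assert (Ha := Cmod_ge_0 a). assert (Hb := Cmod_ge_0 b).
  set (e1 := e / (2 * (2 + Cmod b))).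
  assert (He1 : 0 < e1) by (apply Rdiv_lt_0_compat; lra).
  set (e2 := Rmin 1 (e / (2 * (1 + Cmod a)))).
  assert (He2 : 0 < e2) by (apply Rmin_pos; [lra | apply Rdiv_lt_0_compat; lra]).
  destruct (Hf e1 He1) as [d [Hd Hfd]].
  rewrite continuous_Cmod in Hgc.
  eapply filter_imp; [| apply (filter_and _ _ (Hg e2 He2) (Hgc d Hd))].
  intros s [H1' H2].
  specialize (Hfd (g s) H2).
  assert (Hst := Rabs_pos (s - t)).
  assert (Hg2 : Cmod (g s - g t) <= (1 + Cmod b) * Rabs (s - t)).
  { replace (g s - g t)%C with ((g s - g t - RtoC (s - t) * b) + RtoC (s - t) * b)%C by ring.
    eapply Rle_trans; [apply Cmod_triangle|]. rewrite Cmod_mult, Cmod_R.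
    assert (e2 <= 1) by apply Rmin_l. nra. }
  replace (f (g s) - f (g t) - RtoC (s - t) * (b * a))%C with
    ((f (g s) - f (g t) - (g s - g t) * a) + (g s - g t - RtoC (s - t) * b) * a)%C by ring.
  eapply Rle_trans; [apply Cmod_triangle|]. rewrite Cmod_mult.
  assert (E1 : e1 * (1 + Cmod b) <= e / 2).
  { unfold e1. apply (Rmult_le_reg_r (2 * (2 + Cmod b))); [lra|].
    field_simplify; [|lra]. nra. }
  assert (E2 : e2 * Cmod a <= e / 2).
  { assert (H3 : e2 <= e / (2 * (1 + Cmod a))) by apply Rmin_r.
    apply Rle_trans with (e / (2 * (1 + Cmod a)) * Cmod a);
      [apply Rmult_le_compat_r; lra|].
    apply (Rmult_le_reg_r (2 * (1 + Cmod a))); [lra|].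
    field_simplify; [|lra]. nra. }
  apply Rle_trans with (e1 * ((1 + Cmod b) * Rabs (s - t)) + e2 * Rabs (s - t) * Cmod a).
  - apply Rplus_le_compat; [|apply Rmult_le_compat_r; assumption].
    eapply Rle_trans; [exact Hfd|]. apply Rmult_le_compat_l; lra.
  - nra.
Qed.

Lemma is_curve_derive_Re (g : R -> C) (t : R) (l : C) :
  is_curve_derive g t l -> is_derive (fun s => Re (g s)) t (Re l).
Proof.
  rewrite is_curve_derive_eps, is_derive_eps. intros H e He.
  eapply filter_imp; [|exact (H e He)]. intros s Hs. eapply Rle_trans; [|exact Hs].
  replace (Re (g s) - Re (g t) - (s - t) * Re l)
    with (Re (g s - g t - RtoC (s - t) * l)%C)
    by (unfold Cminus; rewrite !re_plus, !re_opp, re_scal_l; reflexivity).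
  apply re_le_Cmod.
Qed.

Lemma is_curve_derive_Im (g : R -> C) (t : R) (l : C) :
  is_curve_derive g t l -> is_derive (fun s => Im (g s)) t (Im l).
Proof.
  rewrite is_curve_derive_eps, is_derive_eps. intros H e He.
  eapply filter_imp; [|exact (H e He)]. intros s Hs. eapply Rle_trans; [|exact Hs].
  replace (Im (g s) - Im (g t) - (s - t) * Im l)
    with (Im (g s - g t - RtoC (s - t) * l)%C)
    by (unfold Cminus; rewrite !im_plus, !im_opp, im_scal_l; reflexivity).
  apply im_le_Cmod.
Qed.

(** * Integrals of complex-valued functions *)

Notation CInt := (RInt (V := C_R_CompleteNormedModule)).
Notation Ccont := (continuous (U := C_UniformSpace)).

Lemma ex_CInt (f : R -> C) (a b : R) :
  (forall t, Ccont f t) -> ex_RInt (V := C_R_CompleteNormedModule) f a b.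
Proof. intros H. apply (ex_RInt_continuous (V := C_R_CompleteNormedModule)). auto. Qed.

Lemma Re_CInt (f : R -> C) (a b : R) :
  (forall t, Ccont f t) -> Re (CInt f a b) = RInt (fun t => Re (f t)) a b.
Proof.
  intros H. symmetry. apply is_RInt_unique.
  apply (is_RInt_fct_extend_fst (U := R_NormedModule) (V := R_NormedModule) f).
  apply (RInt_correct (V := C_R_CompleteNormedModule)), ex_CInt, H.
Qed.

Lemma Im_CInt (f : R -> C) (a b : R) :
  (forall t, Ccont f t) -> Im (CInt f a b) = RInt (fun t => Im (f t)) a b.
Proof.
  intros H. symmetry. apply is_RInt_unique.
  apply (is_RInt_fct_extend_snd (U := R_NormedModule) (V := R_NormedModule) f).
  apply (RInt_correct (V := C_R_CompleteNormedModule)), ex_CInt, H.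
Qed.

Lemma C_ext (z w : C) : Re z = Re w -> Im z = Im w -> z = w.
Proof. destruct z, w; simpl; now intros -> ->. Qed.

Lemma CInt_ext (f g : R -> C) (a b : R) :
  (forall t, f t = g t) -> CInt f a b = CInt g a b.
Proof. intros H. apply RInt_ext. intros t _; apply H. Qed.

Lemma CInt_plus (f g : R -> C) (a b : R) :
  (forall t, Ccont f t) -> (forall t, Ccont g t) ->
  CInt (fun t => f t + g t)%C a b = (CInt f a b + CInt g a b)%C.
Proof.
  intros Hf Hg.
  apply (RInt_plus (V := C_R_CompleteNormedModule) f g a b); now apply ex_CInt.
Qed.

Lemma CInt_minus (f g : R -> C) (a b : R) :
  (forall t, Ccont f t) -> (forall t, Ccont g t) ->
  CInt (fun t => f t - g t)%C a b = (CInt f a b - CInt g a b)%C.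
Proof.
  intros Hf Hg.
  apply (RInt_minus (V := C_R_CompleteNormedModule) f g a b); now apply ex_CInt.
Qed.

Lemma ex_RInt_cont (f : R -> R) (a b : R) :
  (forall t, continuous f t) -> ex_RInt f a b.
Proof. intros H. apply (ex_RInt_continuous (V := R_CompleteNormedModule)). auto. Qed.

Lemma RInt_linear_combination (p q : R -> R) (u v a b : R) :
  (forall t, continuous p t) -> (forall t, continuous q t) ->
  RInt (fun t => u * p t + v * q t) a b = u * RInt p a b + v * RInt q a b.
Proof.
  intros Hp Hq. apply is_RInt_unique.
  apply (is_RInt_plus (V := R_NormedModule) (fun t => u * p t) (fun t => v * q t)).
  - apply (is_RInt_scal (V := R_NormedModule) p).
    apply (RInt_correct (V := R_CompleteNormedModule)), ex_RInt_cont, Hp.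
  - apply (is_RInt_scal (V := R_NormedModule) q).
    apply (RInt_correct (V := R_CompleteNormedModule)), ex_RInt_cont, Hq.
Qed.

Lemma CInt_scal (c : C) (f : R -> C) (a b : R) :
  (forall t, Ccont f t) ->
  CInt (fun t => c * f t)%C a b = (c * CInt f a b)%C.
Proof.
  intros Hf.
  assert (Hcf : forall t, Ccont (fun t => c * f t)%C t)
    by (intros t; apply continuous_C_mult; [apply continuous_C_const | apply Hf]).
  assert (Hre : forall t, continuous (fun t => Re (f t)) t)
    by (intros t; now apply continuous_Re).
  assert (Him : forall t, continuous (fun t => Im (f t)) t)
    by (intros t; now apply continuous_Im).
  apply C_ext.
  - rewrite re_mult, !Re_CInt, Im_CInt by assumption.
    rewrite (RInt_ext _ (fun t => Re c * Re (f t) + (- Im c) * Im (f t))).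
    + rewrite RInt_linear_combination by assumption. ring.
    + intros t _. rewrite re_mult. apply Rminus_def || (unfold Rminus; now rewrite Ropp_mult_distr_l).
  - rewrite im_mult, !Im_CInt, Re_CInt by assumption.
    rewrite (RInt_ext _ (fun t => Re c * Im (f t) + Im c * Re (f t))).
    + rewrite RInt_linear_combination by assumption. ring.
    + intros t _. apply im_mult.
Qed.

Lemma Cmod_CInt_le (f : R -> C) (a b M : R) :
  a <= b -> (forall t, Ccont f t) -> (forall t, a <= t <= b -> Cmod (f t) <= M) ->
  Cmod (CInt f a b) <= (b - a) * M.
Proof.
  intros Hab Hf HM. rewrite <- norm_C_R.
  apply (norm_RInt_le_const (V := C_R_NormedModule) f a b (CInt f a b) M Hab).
  - intros t Ht. rewrite norm_C_R. auto.
  - apply (RInt_correct (V := C_R_CompleteNormedModule)), ex_CInt, Hf.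
Qed.

Lemma CInt_derive (f df : R -> C) (a b : R) :
  (forall t, is_curve_derive f t (df t)) -> (forall t, Ccont df t) ->
  CInt df a b = (f b - f a)%C.
Proof.
  intros Hf Hdf. apply (is_RInt_unique (V := C_R_CompleteNormedModule)).
  apply (is_RInt_derive (V := C_R_CompleteNormedModule) f df a b); auto.
Qed.

Lemma CInt_Chasles (f : R -> C) (a b c : R) :
  (forall t, Ccont f t) -> (CInt f a b + CInt f b c)%C = CInt f a c.
Proof.
  intros Hf. apply (RInt_Chasles (V := C_R_CompleteNormedModule) f a b c); now apply ex_CInt.
Qed.

Lemma CInt_const (c : C) (a b : R) : CInt (fun _ => c) a b = (RtoC (b - a) * c)%C.
Proof.
  rewrite (RInt_const (V := C_R_CompleteNormedModule) a b c).
  apply scal_R_Cmult.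
Qed.

Lemma is_curve_derive_line (z h : C) (t : R) :
  is_curve_derive (fun s => z + RtoC s * h)%C t h.
Proof.
  destruct z as [x y], h as [p q].
  apply (is_derive_ext (fun s => (x + s * p, y + s * q) : C)).
  { intros s. unfold Cplus, Cmult, RtoC; simpl. f_equal; ring. }
  apply is_curve_derive_pair; auto_derive; auto; ring.
Qed.

Lemma is_curve_derive_continuous (g : R -> C) (t : R) (l : C) :
  is_curve_derive g t l -> Ccont g t.
Proof.
  intros H. apply (ex_derive_continuous (K := R_AbsRing) (V := C_R_NormedModule)). now exists l.
Qed.

(** The mean value theorem along the segment, applied to the real and to the
    imaginary part of the linearization error; hence the factor 2. *)
Lemma linearization_bound (F F' : C -> C) (z h : C) (e : R) :
  (forall s, 0 <= s <= 1 -> is_Cderive F (z + RtoC s * h)%C (F' (z + RtoC s * h)%C)) ->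
  (forall s, 0 <= s <= 1 -> Cmod (F' (z + RtoC s * h)%C - F' z) <= e) ->
  Cmod (F (z + h)%C - F z - h * F' z) <= 2 * (e * Cmod h).
Proof.
  intros HF He.
  assert (Hd : forall s, 0 <= s <= 1 ->
     is_curve_derive (fun s => F (z + RtoC s * h) - RtoC s * (h * F' z))%C s
       (h * (F' (z + RtoC s * h)%C - F' z))%C).
  { intros s Hs.
    replace (h * (F' (z + RtoC s * h)%C - F' z))%C
      with (minus (h * F' (z + RtoC s * h)%C)%C (h * F' z)%C : C_R_NormedModule)
      by (change (h * F' (z + RtoC s * h) - h * F' z = h * (F' (z + RtoC s * h)%C - F' z))%C; ring).
    apply (is_derive_minus (V := C_R_NormedModule)).
    - apply (is_Cderive_curve F (fun s => z + RtoC s * h)%C); [auto|].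
      apply is_curve_derive_line.
    - apply (is_derive_ext (fun s => RtoC 0 + RtoC s * (h * F' z))%C).
      { intros u. apply Cplus_0_l. }
      apply is_curve_derive_line. }
  replace (F (z + h)%C - F z - h * F' z)%C with
    ((F (z + RtoC 1 * h)%C - RtoC 1 * (h * F' z)) -
     (F (z + RtoC 0 * h)%C - RtoC 0 * (h * F' z)))%C.
  2:{ rewrite !Cmult_0_l, !Cplus_0_r, !Cmult_1_l. ring. }
  set (G := fun s => (F (z + RtoC s * h) - RtoC s * (h * F' z))%C) in *.
  fold (G 1) (G 0).
  assert (Hbd : forall s, 0 <= s <= 1 -> Cmod (h * (F' (z + RtoC s * h)%C - F' z))%C <= e * Cmod h).
  { intros s Hs. rewrite Cmod_mult. generalize (Cmod_ge_0 h) (He s Hs); nra. }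
  eapply Rle_trans; [apply Cmod_le_sum|].
  assert (Hb1 : Rabs (Re (G 1) - Re (G 0)) <= e * Cmod h).
  { destruct (MVT_gen (fun s => Re (G s)) 0 1
               (fun s => Re (h * (F' (z + RtoC s * h)%C - F' z))%C)) as [c [Hc ->]].
    - intros x Hx. rewrite Rmin_left, Rmax_right in Hx by lra.
      apply is_curve_derive_Re, Hd; lra.
    - intros x Hx. rewrite Rmin_left, Rmax_right in Hx by lra.
      apply continuity_pt_filterlim, (continuous_Re G).
      eapply is_curve_derive_continuous, Hd; lra.
    - rewrite Rmin_left, Rmax_right in Hc by lra.
      rewrite Rminus_0_r, Rmult_1_r.
      eapply Rle_trans; [apply re_le_Cmod | auto]. }
  assert (Hb2 : Rabs (Im (G 1) - Im (G 0)) <= e * Cmod h).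
  { destruct (MVT_gen (fun s => Im (G s)) 0 1
               (fun s => Im (h * (F' (z + RtoC s * h)%C - F' z))%C)) as [c [Hc ->]].
    - intros x Hx. rewrite Rmin_left, Rmax_right in Hx by lra.
      apply is_curve_derive_Im, Hd; lra.
    - intros x Hx. rewrite Rmin_left, Rmax_right in Hx by lra.
      apply continuity_pt_filterlim, (continuous_Im G).
      eapply is_curve_derive_continuous, Hd; lra.
    - rewrite Rmin_left, Rmax_right in Hc by lra.
      rewrite Rminus_0_r, Rmult_1_r.
      eapply Rle_trans; [apply im_le_Cmod | auto]. }
  replace (Re (G 1 - G 0)) with (Re (G 1) - Re (G 0))
    by (unfold Cminus; rewrite re_plus, re_opp; reflexivity).
  replace (Im (G 1 - G 0)) with (Im (G 1) - Im (G 0))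
    by (unfold Cminus; rewrite im_plus, im_opp; reflexivity).
  lra.
Qed.

(** [ring] does not recognize an equality in [C] that is typed in one of the
    module structures on [C]. *)
Ltac Cring :=
  cbv beta; match goal with |- ?a = ?b => change (@eq C a b) end;
  try change (@zero C_R_NormedModule) with (RtoC 0); try ring.

(** * Goursat's theorem for rectangles *)

Lemma nested_intervals (x w : nat -> R) :
  (forall n, x n <= x (S n)) ->
  (forall n, x (S n) + w (S n) <= x n + w n) ->
  (forall n, 0 <= w n) ->
  exists p, forall n, x n <= p <= x n + w n.
Proof.
  intros Hx Hw H0.
  assert (Hmono : forall n k, x n <= x (n + k)%nat).
  { intros n k. induction k as [|k IH].
    - rewrite Nat.add_0_r; lra.
    - rewrite Nat.add_succ_r. eapply Rle_trans; [exact IH | apply Hx]. }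
  assert (Hanti : forall n k, x (n + k)%nat + w (n + k)%nat <= x n + w n).
  { intros n k. induction k as [|k IH].
    - rewrite Nat.add_0_r; lra.
    - rewrite Nat.add_succ_r. eapply Rle_trans; [apply Hw | exact IH]. }
  assert (Hub : forall n m, x m <= x n + w n).
  { intros n m. eapply Rle_trans; [apply (Hmono m n)|].
    eapply Rle_trans; [| apply (Hanti n m)].
    rewrite (Nat.add_comm m n). generalize (H0 (n + m)%nat); lra. }
  destruct (completeness (fun r => exists n, r = x n)) as [p [Hp1 Hp2]].
  - exists (x 0%nat + w 0%nat). intros r [n ->]. apply Hub.
  - now exists (x 0%nat), 0%nat.
  - exists p. intros n. split.
    + apply Hp1. now exists n.
    + apply Hp2. intros r [m ->]. apply Hub.
Qed.

(** A property failing for a rectangle fails for one of its quarters, hence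
    for nested rectangles shrinking to a point.  Rectangles are given by their
    lower left corner and side lengths. *)
Lemma rectangle_bisection (P : R -> R -> R -> R -> Prop) :
  (forall x w y h, 0 <= w -> 0 <= h ->
     P x (w / 2) y (h / 2) -> P (x + w / 2) (w / 2) y (h / 2) ->
     P x (w / 2) (y + h / 2) (h / 2) -> P (x + w / 2) (w / 2) (y + h / 2) (h / 2) ->
     P x w y h) ->
  (forall p q, exists d, 0 < d /\ forall x w y h,
     x <= p <= x + w -> y <= q <= y + h -> w + h < d -> P x w y h) ->
  forall x w y h, 0 <= w -> 0 <= h -> P x w y h.
Proof.
  intros Hsplit Hloc x0 w0 y0 h0 Hw0 Hh0. apply NNPP. intros Hbad0.
  set (bad := fun s : (R * R) * (R * R) =>
    0 <= snd (fst s) /\ 0 <= snd (snd s) /\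
    ~ P (fst (fst s)) (snd (fst s)) (fst (snd s)) (snd (snd s))).
  set (quarter := fun s s' : (R * R) * (R * R) =>
    snd (fst s') = snd (fst s) / 2 /\ snd (snd s') = snd (snd s) / 2 /\
    (fst (fst s') = fst (fst s) \/ fst (fst s') = fst (fst s) + snd (fst s) / 2) /\
    (fst (snd s') = fst (snd s) \/ fst (snd s') = fst (snd s) + snd (snd s) / 2)).
  assert (Hstep : forall s : {s | bad s}, exists s' : {s | bad s},
             quarter (proj1_sig s) (proj1_sig s')).
  { intros [[[x w] [y h]] [Hw [Hh HP]]]. simpl in Hw, Hh, HP. apply NNPP. intros Hno.
    assert (Hq : forall x' y', (x' = x \/ x' = x + w / 2) -> (y' = y \/ y' = y + h / 2) ->
              P x' (w / 2) y' (h / 2)).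
    { intros x' y' Hx' Hy'. apply NNPP. intros HP'. apply Hno.
      assert (Hb : bad ((x', w / 2), (y', h / 2))).
      { repeat split; simpl; [lra | lra | exact HP']. }
      exists (exist _ _ Hb). repeat split; simpl; auto. }
    apply HP, Hsplit; auto. }
  set (next := fun s => proj1_sig (constructive_indefinite_description _ (Hstep s))).
  assert (Hnext : forall s, quarter (proj1_sig s) (proj1_sig (next s)))
    by (intros s; apply (proj2_sig (constructive_indefinite_description _ (Hstep s)))).
  assert (Hb0 : bad ((x0, w0), (y0, h0))) by (repeat split; assumption).
  set (st := fix st (n : nat) : {s | bad s} :=
    match n with O => exist _ _ Hb0 | S k => next (st k) end).
  set (X := fun n => fst (fst (proj1_sig (st n)))).
  set (W := fun n => snd (fst (proj1_sig (st n)))).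
  set (Y := fun n => fst (snd (proj1_sig (st n)))).
  set (Hh := fun n => snd (snd (proj1_sig (st n)))).
  assert (Hq : forall n, W (S n) = W n / 2 /\ Hh (S n) = Hh n / 2 /\
     (X (S n) = X n \/ X (S n) = X n + W n / 2) /\
     (Y (S n) = Y n \/ Y (S n) = Y n + Hh n / 2))
    by (intros n; apply (Hnext (st n))).
  assert (Hbn : forall n, 0 <= W n /\ 0 <= Hh n /\ ~ P (X n) (W n) (Y n) (Hh n))
    by (intros n; exact (proj2_sig (st n))).
  destruct (nested_intervals X W) as [p Hp].
  { intros n. destruct (Hq n) as (_ & _ & Hx & _), (Hbn n) as (? & _). lra. }
  { intros n. destruct (Hq n) as (? & _ & Hx & _), (Hbn n) as (? & _). lra. }
  { intros n. apply Hbn. }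
  destruct (nested_intervals Y Hh) as [q Hqq].
  { intros n. destruct (Hq n) as (_ & _ & _ & Hx), (Hbn n) as (_ & ? & _). lra. }
  { intros n. destruct (Hq n) as (_ & ? & _ & Hx), (Hbn n) as (_ & ? & _). lra. }
  { intros n. apply Hbn. }
  destruct (Hloc p q) as [d [Hd HP]].
  assert (Hsize : forall n, W n + Hh n = (w0 + h0) * (1 / 2) ^ n).
  { induction n as [|n IH].
    - simpl. unfold W, Hh; simpl. ring.
    - destruct (Hq n) as (-> & -> & _).
      replace (W n / 2 + Hh n / 2) with ((W n + Hh n) / 2) by field.
      rewrite IH. simpl. field. }
  assert (Hwh : 0 < d / (1 + w0 + h0)) by (apply Rdiv_lt_0_compat; lra).
  destruct (pow_lt_1_zero (1 / 2) ltac:(rewrite Rabs_pos_eq; lra) _ Hwh) as [N HN].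
  specialize (HN N (Nat.le_refl N)).
  rewrite Rabs_pos_eq in HN by (apply pow_le; lra).
  apply (Hbn N). apply HP; auto.
  rewrite Hsize.
  apply (Rmult_lt_compat_l (1 + w0 + h0)) in HN; [|lra].
  replace ((1 + w0 + h0) * (d / (1 + w0 + h0))) with d in HN by (field; lra).
  assert (0 <= (1 / 2) ^ N) by (apply pow_le; lra). nra.
Qed.

Definition everywhere_continuous (f : C -> C) :=
  forall z : C, continuous (T := C_UniformSpace) (U := C_UniformSpace) f z.

Lemma entire_continuous (f : C -> C) : entire f -> everywhere_continuous f.
Proof. intros H z. destruct (H z) as [l Hl]. eapply is_Cderive_continuous_pt, Hl. Qed.

Lemma continuous_horizontal (f : C -> C) (y t : R) :
  everywhere_continuous f -> Ccont (fun x : R => f (x, y)) t.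
Proof.
  intros H. apply (continuous_comp (V := C_UniformSpace) (fun x : R => (x, y) : C) f); [|apply H].
  apply continuous_C_pair; [apply continuous_id | apply continuous_const].
Qed.

Lemma continuous_vertical (f : C -> C) (x t : R) :
  everywhere_continuous f -> Ccont (fun y : R => f (x, y)) t.
Proof.
  intros H. apply (continuous_comp (V := C_UniformSpace) (fun y : R => (x, y) : C) f); [|apply H].
  apply continuous_C_pair; [apply continuous_const | apply continuous_id].
Qed.

Definition hint (f : C -> C) (y a b : R) : C := CInt (fun x => f (x, y)) a b.
Definition vint (f : C -> C) (x c d : R) : C := (Ci * CInt (fun y => f (x, y)) c d)%C.

(** The contour integral around the rectangle with lower left corner
    [(x, y)], counterclockwise. *)
Definition rect_int (f : C -> C) (x w y h : R) : C :=
  (hint f y x (x + w) + vint f (x + w) y (y + h)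
   - hint f (y + h) x (x + w) - vint f x y (y + h))%C.

Lemma hint_Chasles (f : C -> C) (y a b c : R) :
  everywhere_continuous f -> (hint f y a b + hint f y b c)%C = hint f y a c.
Proof. intros H. apply CInt_Chasles. intros t; now apply continuous_horizontal. Qed.

Lemma vint_Chasles (f : C -> C) (x a b c : R) :
  everywhere_continuous f -> (vint f x a b + vint f x b c)%C = vint f x a c.
Proof.
  intros H. unfold vint. rewrite <- Cmult_plus_distr_l, CInt_Chasles; [reflexivity|].
  intros t; now apply continuous_vertical.
Qed.

Lemma rect_int_quarters (f : C -> C) (x w y h : R) :
  everywhere_continuous f ->
  rect_int f x w y h =
  (rect_int f x (w / 2) y (h / 2) + rect_int f (x + w / 2) (w / 2) y (h / 2)
   + rect_int f x (w / 2) (y + h / 2) (h / 2)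
   + rect_int f (x + w / 2) (w / 2) (y + h / 2) (h / 2))%C.
Proof.
  intros H. unfold rect_int.
  replace (x + w / 2 + w / 2) with (x + w) by field.
  replace (y + h / 2 + h / 2) with (y + h) by field.
  rewrite <- (hint_Chasles f y x (x + w / 2) (x + w)) by assumption.
  rewrite <- (hint_Chasles f (y + h) x (x + w / 2) (x + w)) by assumption.
  rewrite <- (vint_Chasles f (x + w) y (y + h / 2) (y + h)) by assumption.
  rewrite <- (vint_Chasles f x y (y + h / 2) (y + h)) by assumption.
  ring.
Qed.

Lemma hint_primitive (F F' : C -> C) (y a b : R) :
  (forall z, is_Cderive F z (F' z)) -> everywhere_continuous F' ->
  hint F' y a b = (F (b, y) - F (a, y))%C.
Proof.
  intros HF HF'. unfold hint.
  apply (CInt_derive (fun x => F (x, y))).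
  - intros t. apply (is_curve_derive_eq _ _ (RtoC 1 * F' (t, y))%C); [|apply Cmult_1_l].
    apply (is_Cderive_curve F (fun x : R => (x, y) : C)); [apply HF|].
    apply is_curve_derive_pair; auto_derive; auto.
  - intros t; now apply continuous_horizontal.
Qed.

Lemma vint_primitive (F F' : C -> C) (x c d : R) :
  (forall z, is_Cderive F z (F' z)) -> everywhere_continuous F' ->
  vint F' x c d = (F (x, d) - F (x, c))%C.
Proof.
  intros HF HF'. unfold vint. rewrite <- CInt_scal by (intros t; now apply continuous_vertical).
  apply (CInt_derive (fun y => F (x, y))).
  - intros t. apply (is_Cderive_curve F (fun y : R => (x, y) : C)); [apply HF|].
    apply is_curve_derive_pair; auto_derive; auto.
  - intros t; apply continuous_C_mult; [apply continuous_C_const | now apply continuous_vertical].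
Qed.

Lemma rect_int_primitive (F F' : C -> C) (x w y h : R) :
  (forall z, is_Cderive F z (F' z)) -> everywhere_continuous F' -> rect_int F' x w y h = RtoC 0.
Proof.
  intros HF HF'. unfold rect_int.
  rewrite !(hint_primitive F F'), !(vint_primitive F F') by assumption. ring.
Qed.

Lemma rect_int_minus (f g : C -> C) (x w y h : R) :
  everywhere_continuous f -> everywhere_continuous g ->
  rect_int (fun z => f z - g z)%C x w y h = (rect_int f x w y h - rect_int g x w y h)%C.
Proof.
  intros Hf Hg. unfold rect_int, hint, vint.
  rewrite !CInt_minus by (intros t; apply continuous_horizontal || apply continuous_vertical; assumption).
  ring.
Qed.

Lemma hint_bound (f : C -> C) (y a b M : R) :
  everywhere_continuous f -> a <= b -> (forall t, a <= t <= b -> Cmod (f (t, y)) <= M) ->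
  Cmod (hint f y a b) <= (b - a) * M.
Proof.
  intros Hf Hab HM. apply Cmod_CInt_le; auto. intros t; now apply continuous_horizontal.
Qed.

Lemma vint_bound (f : C -> C) (x c d M : R) :
  everywhere_continuous f -> c <= d -> (forall t, c <= t <= d -> Cmod (f (x, t)) <= M) ->
  Cmod (vint f x c d) <= (d - c) * M.
Proof.
  intros Hf Hab HM. unfold vint. rewrite Cmod_mult, Cmod_Ci, Rmult_1_l.
  apply Cmod_CInt_le; auto. intros t; now apply continuous_vertical.
Qed.

Lemma rect_int_bound (f : C -> C) (x w y h M : R) :
  everywhere_continuous f -> 0 <= w -> 0 <= h ->
  (forall s t, x <= s <= x + w -> y <= t <= y + h -> Cmod (f (s, t)) <= M) ->
  Cmod (rect_int f x w y h) <= 2 * M * (w + h).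
Proof.
  intros Hf Hw Hh HM. unfold rect_int.
  assert (B1 : Cmod (hint f y x (x + w)) <= (x + w - x) * M)
    by (apply hint_bound; [assumption | lra | intros; apply HM; lra]).
  assert (B2 : Cmod (hint f (y + h) x (x + w)) <= (x + w - x) * M)
    by (apply hint_bound; [assumption | lra | intros; apply HM; lra]).
  assert (B3 : Cmod (vint f (x + w) y (y + h)) <= (y + h - y) * M)
    by (apply vint_bound; [assumption | lra | intros; apply HM; lra]).
  assert (B4 : Cmod (vint f x y (y + h)) <= (y + h - y) * M)
    by (apply vint_bound; [assumption | lra | intros; apply HM; lra]).
  unfold Cminus.
  eapply Rle_trans; [apply Cmod_triangle|]. rewrite Cmod_opp.
  eapply Rle_trans; [apply Rplus_le_compat_r, Cmod_triangle|]. rewrite Cmod_opp.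
  eapply Rle_trans; [apply Rplus_le_compat_r, Rplus_le_compat_r, Cmod_triangle|].
  lra.
Qed.

(** Near a point [p] an entire function is affine up to [o(|z - p|)], affine
    functions have primitives, and the perimeter contributes a second factor
    of the same size: small rectangles have integral [o(size^2)].  Quartering
    propagates this to every rectangle. *)
Theorem goursat (f : C -> C) (x w y h : R) :
  entire f -> 0 <= w -> 0 <= h -> rect_int f x w y h = RtoC 0.
Proof.
  intros Hf Hw0 Hh0. assert (Hc := entire_continuous f Hf).
  assert (Hall : forall e, 0 < e -> Cmod (rect_int f x w y h) <= e * (w + h) ^ 2).
  { intros e He. revert x w y h Hw0 Hh0. apply rectangle_bisection.
    - intros x w y h Hw Hh H1 H2 H3 H4.
      rewrite rect_int_quarters by assumption.
      eapply Rle_trans; [apply Cmod_triangle|].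
      eapply Rle_trans; [apply Rplus_le_compat_r, Cmod_triangle|].
      eapply Rle_trans; [apply Rplus_le_compat_r, Rplus_le_compat_r, Cmod_triangle|].
      nra.
    - intros p q. destruct (Hf (p, q)) as [l Hl].
      assert (He2 : 0 < e / 2) by lra.
      rewrite is_Cderive_eps in Hl. destruct (Hl _ He2) as [d [Hd Hfd]].
      exists d. split; [exact Hd|]. intros x w y h Hx Hy Hwh.
      set (g := fun z => (f (p, q) + (z - (p, q)) * l)%C).
      set (G := fun z => (f (p, q) * z + (z - (p, q)) * (z - (p, q)) * (l / 2))%C).
      assert (HG : forall z, is_Cderive G z (g z)).
      { intros z. unfold G, g. eapply is_Cderive_eq.
        - apply is_Cderive_plus.
          + apply is_Cderive_mult; [apply is_Cderive_const | apply is_Cderive_id].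
          + apply is_Cderive_mult; [apply is_Cderive_mult | apply is_Cderive_const];
            (apply is_Cderive_minus; [apply is_Cderive_id | apply is_Cderive_const]).
        - simpl. field. }
      assert (Hg : everywhere_continuous g).
      { intros z. unfold g. apply continuous_C_plus; [apply continuous_C_const|].
        apply continuous_C_mult; [|apply continuous_C_const].
        apply continuous_C_minus; [apply continuous_id | apply continuous_C_const]. }
      replace (rect_int f x w y h) with (rect_int (fun z => f z - g z)%C x w y h).
      2:{ rewrite rect_int_minus, (rect_int_primitive G g) by assumption. ring. }
      eapply Rle_trans.
      + apply (rect_int_bound _ x w y h (e / 2 * (w + h))); [| lra | lra |].
        * intros z. apply continuous_C_minus; auto.
        * intros s t Hs Ht.
          assert (Hst : Cmod ((s, t) - (p, q)) <= w + h).
          { eapply Rle_trans; [apply Cmod_le_sum|]. simpl.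
            apply Rplus_le_compat; apply Rabs_le; lra. }
          unfold g.
          replace (f (s, t) - (f (p, q) + ((s, t) - (p, q)) * l))%C
            with (f (s, t) - f (p, q) - ((s, t) - (p, q)) * l)%C by ring.
          eapply Rle_trans; [apply Hfd; lra|].
          apply Rmult_le_compat_l; lra.
      + nra. }
  apply Cmod_eq_0. apply Rle_antisym; [|apply Cmod_ge_0].
  apply le_epsilon. intros e He.
  assert (He' : 0 < e / (1 + (w + h) ^ 2)) by (apply Rdiv_lt_0_compat; nra).
  specialize (Hall _ He').
  assert (e / (1 + (w + h) ^ 2) * (w + h) ^ 2 <= e); [|lra].
  apply (Rmult_le_reg_r (1 + (w + h) ^ 2)); [nra|].
  field_simplify; nra.
Qed.

(** * Primitives, and differentiation under the integral sign *)

Lemma CInt_swap (f : R -> C) (a b : R) :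
  (forall t, Ccont f t) -> CInt f b a = (- CInt f a b)%C.
Proof.
  intros H. apply (is_RInt_unique (V := C_R_CompleteNormedModule)).
  apply (is_RInt_swap (V := C_R_NormedModule)).
  apply (RInt_correct (V := C_R_CompleteNormedModule)), ex_CInt, H.
Qed.

Lemma Cmod_CInt_le_abs (f : R -> C) (a b M : R) :
  (forall t, Ccont f t) -> (forall t, Rmin a b <= t <= Rmax a b -> Cmod (f t) <= M) ->
  Cmod (CInt f a b) <= Rabs (b - a) * M.
Proof.
  intros Hf HM. destruct (Rle_dec a b) as [Hab|Hab].
  - rewrite Rmin_left, Rmax_right in HM by lra. rewrite Rabs_pos_eq by lra.
    now apply Cmod_CInt_le.
  - rewrite Rmin_right, Rmax_left in HM by lra.
    rewrite CInt_swap, Cmod_opp, Rabs_left by (auto; lra).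
    replace (- (b - a)) with (a - b) by ring.
    apply Cmod_CInt_le; auto; lra.
Qed.

Lemma goursat_signed (f : C -> C) (x w y h : R) : entire f -> rect_int f x w y h = RtoC 0.
Proof.
  intros Hf. assert (Hc := entire_continuous f Hf).
  assert (Hh : forall u a b, hint f u b a = (- hint f u a b)%C)
    by (intros; apply CInt_swap; intros t; now apply continuous_horizontal).
  assert (Hv : forall u a b, vint f u b a = (- vint f u a b)%C).
  { intros; unfold vint. rewrite CInt_swap by (intros t; now apply continuous_vertical). ring. }
  assert (Hpos : forall x w, 0 <= w -> rect_int f x w y h = RtoC 0).
  { clear x w. intros x w Hw. destruct (Rle_dec 0 h) as [H|H]; [now apply goursat|].
    transitivity (- rect_int f x w (y + h) (- h))%C.
    - unfold rect_int. replace (y + h + - h) with y by ring.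
      rewrite (Hv (x + w) (y + h) y), (Hv x (y + h) y). ring.
    - rewrite goursat by (auto; lra). ring. }
  destruct (Rle_dec 0 w) as [H|H]; [now apply Hpos|].
  transitivity (- rect_int f (x + w) (- w) y h)%C.
  - unfold rect_int. replace (x + w + - w) with x by ring.
    rewrite (Hh y (x + w) x), (Hh (y + h) (x + w) x). ring.
  - rewrite Hpos by lra. ring.
Qed.

(** The primitive integrates from 0 along a horizontal and then a vertical
    side.  By Goursat's theorem the other order gives the same value, so an
    increment is an integral over two short sides at the endpoint. *)
Lemma entire_primitive (f : C -> C) :
  entire f -> exists P, forall z, is_Cderive P z (f z).
Proof.
  intros Hf. assert (Hc := entire_continuous f Hf).
  set (P := fun z : C => (hint f 0 0 (fst z) + vint f (fst z) 0 (snd z))%C).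
  exists P.
  assert (Hdiff : forall x y p q : R,
    (P ((x + p)%R, (y + q)%R) - P (x, y))%C = (hint f y x (x + p) + vint f (x + p) y (y + q))%C).
  { intros x y p q. unfold P; simpl.
    assert (G1 := goursat_signed f 0 x 0 y Hf).
    assert (G2 := goursat_signed f 0 (x + p) 0 y Hf).
    unfold rect_int in G1, G2. rewrite !Rplus_0_l in G1, G2.
    rewrite <- (vint_Chasles f (x + p) 0 y (y + q)) by assumption.
    rewrite <- (hint_Chasles f y 0 x (x + p)) in G2 by assumption.
    apply Ceq_minus. transitivity
      ((hint f 0 0 (x + p) + vint f (x + p) 0 y - (hint f y 0 x + hint f y x (x + p))
        - vint f 0 0 y) -
       (hint f 0 0 x + vint f x 0 y - hint f y 0 x - vint f 0 0 y))%C; [ring|].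
    rewrite G1, G2. ring. }
  intros [x y]. apply is_Cderive_eps. intros e He.
  assert (He2 : 0 < e / 2) by lra.
  specialize (Hc (x, y)). rewrite continuous_Cmod in Hc.
  specialize (Hc _ He2). apply (proj1 (locally_Cmod (x, y) _)) in Hc.
  destruct Hc as [d [Hd Hfd]].
  assert (Hc := entire_continuous f Hf).
  exists (d / 2). split; [lra|].
  intros [x' y'] Hw.
  assert (Hp := re_le_Cmod ((x', y') - (x, y))%C).
  assert (Hq := im_le_Cmod ((x', y') - (x, y))%C).
  change (Re ((x', y') - (x, y))%C) with (x' - x) in Hp.
  change (Im ((x', y') - (x, y))%C) with (y' - y) in Hq.
  set (N := Cmod ((x', y') - (x, y))%C) in *.
  set (c := f (x, y)) in *.
  replace x' with (x + (x' - x)) by ring. replace y' with (y + (y' - y)) by ring.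
  rewrite Hdiff. set (p := x' - x) in *. set (q := y' - y) in *.
  assert (Hsmall : forall s t, Rabs (s - x) <= Rabs p -> Rabs (t - y) <= Rabs q ->
            Cmod (f (s, t) - c) <= e / 2).
  { intros s t Hs Ht. apply Rlt_le, Hfd.
    eapply Rle_lt_trans; [apply Cmod_le_sum|].
    change (Rabs (s - x) + Rabs (t - y) < d). lra. }
  assert (H1 : (hint f y x (x + p) - RtoC p * c)%C = CInt (fun s => f (s, y) - c)%C x (x + p)).
  { rewrite CInt_minus, CInt_const.
    - replace (x + p - x) with p by ring. reflexivity.
    - intros t; now apply continuous_horizontal.
    - intros t; apply continuous_C_const. }
  assert (H2 : (vint f (x + p) y (y + q) - Ci * (RtoC q * c))%C
               = (Ci * CInt (fun t => f ((x + p)%R, t) - c)%C y (y + q))%C).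
  { rewrite CInt_minus, CInt_const.
    - replace (y + q - y) with q by ring. unfold vint. ring.
    - intros t; now apply continuous_vertical.
    - intros t; apply continuous_C_const. }
  replace ((((x + p)%R, (y + q)%R) : C) - (x, y))%C with (RtoC p + Ci * RtoC q)%C.
  2:{ apply C_ext; simpl; ring. }
  match goal with |- Cmod (?A + ?B - ?D) <= _ =>
    replace (A + B - D)%C with
      ((A - RtoC p * c) + (B - Ci * (RtoC q * c)))%C by ring end.
  rewrite H1, H2.
  eapply Rle_trans; [apply Cmod_triangle|].
  rewrite Cmod_mult, Cmod_Ci, Rmult_1_l.
  assert (Hb : forall u v t, Rmin u (u + v) <= t <= Rmax u (u + v) -> Rabs (t - u) <= Rabs v).
  { intros u v t Ht. destruct (Rle_dec 0 v).
    - rewrite Rmin_left, Rmax_right in Ht by lra. rewrite !Rabs_pos_eq; lra.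
    - rewrite Rmin_right, Rmax_left in Ht by lra.
      rewrite (Rabs_left v) by lra. apply Rabs_le; lra. }
  assert (B1 : Cmod (CInt (fun s => f (s, y) - c)%C x (x + p)) <= Rabs p * (e / 2)).
  { replace p with (x + p - x) at 2 by ring. apply Cmod_CInt_le_abs.
    - intros t; apply continuous_C_minus; [now apply continuous_horizontal | apply continuous_C_const].
    - intros t Ht. apply Hsmall; [now apply Hb | rewrite Rminus_diag, Rabs_R0; apply Rabs_pos]. }
  assert (B2 : Cmod (CInt (fun t => f ((x + p)%R, t) - c)%C y (y + q)) <= Rabs q * (e / 2)).
  { replace q with (y + q - y) at 2 by ring. apply Cmod_CInt_le_abs.
    - intros t; apply continuous_C_minus; [now apply continuous_vertical | apply continuous_C_const].
    - intros t Ht. apply Hsmall; [replace (x + p - x) with p by ring; lra | now apply Hb]. }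
  generalize (Cmod_ge_0 ((x', y') - (x, y))%C). fold N. intros HN0. nra.
Qed.

(** Compactness of [[a, b]] makes the continuity of [Q] in its first variable
    uniform in the second one. *)
Lemma continuous_param_uniform (Q : C -> R -> C) (z0 : C) (a b : R) :
  (forall t, continuous (T := prod_UniformSpace C_UniformSpace R_UniformSpace)
     (U := C_UniformSpace) (fun p => Q (fst p) (snd p)) (z0, t)) ->
  forall e, 0 < e -> exists d, 0 < d /\ forall z t,
    Cmod (z - z0) < d -> a <= t <= b -> Cmod (Q z t - Q z0 t) < e.
Proof.
  intros HQ e He. assert (He2 : 0 < e / 2) by lra.
  assert (Hloc : forall t, exists d : posreal, forall z s,
            Cmod (z - z0) < d -> Rabs (s - t) < d -> Cmod (Q z s - Q z0 t) < e / 2).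
  { intros t. specialize (HQ t). rewrite continuous_Cmod in HQ.
    destruct (HQ _ He2) as [d Hd]. exists d. intros z s Hz Hs.
    apply (Hd (z, s)). split; [apply ball_Cmod; exact Hz | exact Hs]. }
  set (delta := fun t => proj1_sig (constructive_indefinite_description _ (Hloc t))).
  assert (Hdelta : forall t z s, Cmod (z - z0) < delta t -> Rabs (s - t) < delta t ->
            Cmod (Q z s - Q z0 t) < e / 2)
    by (intros t; exact (proj2_sig (constructive_indefinite_description _ (Hloc t)))).
  destruct (compactness_value_1d a b delta) as [d Hd].
  exists d. split; [apply cond_pos|]. intros z s Hz Hs.
  destruct (NNPP _ (Hd s Hs)) as [t [_ [Hst Hdt]]].
  assert (Hz0 : Cmod (z0 - z0) < delta t).
  { replace (z0 - z0)%C with (RtoC 0) by ring. rewrite Cmod_0. apply cond_pos. }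
  assert (H1 := Hdelta t z s ltac:(lra) Hst).
  assert (H2 := Hdelta t z0 s Hz0 Hst).
  replace (Q z s - Q z0 s)%C with ((Q z s - Q z0 t) + - (Q z0 s - Q z0 t))%C by ring.
  eapply Rle_lt_trans; [apply Cmod_triangle|]. rewrite Cmod_opp. lra.
Qed.

Notation continuous_joint Q z t :=
  (continuous (T := prod_UniformSpace C_UniformSpace R_UniformSpace)
     (U := C_UniformSpace) (fun p => Q (fst p) (snd p)) (z, t)).

Lemma continuous_joint_section (Q : C -> R -> C) (z : C) (t : R) :
  continuous_joint Q z t -> Ccont (Q z) t.
Proof.
  intros H.
  apply (continuous_comp_2 (U := R_UniformSpace) (V := C_UniformSpace) (W := R_UniformSpace) (X := C_UniformSpace)
           (fun _ : R => z) (fun s : R => s) Q).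
  - apply continuous_C_const.
  - apply continuous_id.
  - exact H.
Qed.

Lemma CInt_param_continuous (Q : C -> R -> C) (z0 : C) (a b : R) :
  a <= b -> (forall z t, continuous_joint Q z t) ->
  continuous (T := C_UniformSpace) (U := C_UniformSpace) (fun z => CInt (Q z) a b) z0.
Proof.
  intros Hab HQ. apply continuous_Cmod. intros e He.
  assert (He' : 0 < e / (1 + (b - a))) by (apply Rdiv_lt_0_compat; lra).
  destruct (continuous_param_uniform Q z0 a b (HQ z0) _ He') as [d [Hd H]].
  apply locally_Cmod. exists d. split; [exact Hd|]. intros z Hz.
  assert (Hs : forall z t, Ccont (Q z) t) by (intros; now apply continuous_joint_section).
  rewrite <- CInt_minus by auto.
  apply Rle_lt_trans with ((b - a) * (e / (1 + (b - a)))).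
  - apply Cmod_CInt_le; [exact Hab | |].
    + intros t; apply continuous_C_minus; auto.
    + intros t Ht. apply Rlt_le, H; auto.
  - apply (Rmult_lt_reg_r (1 + (b - a))); [lra|]. field_simplify; nra.
Qed.

Lemma is_Cderive_CInt (K K' : C -> R -> C) (z0 : C) (rho a b : R) :
  a <= b -> 0 < rho ->
  (forall z t, Cmod (z - z0) < rho -> is_Cderive (fun z => K z t) z (K' z t)) ->
  (forall z t, Cmod (z - z0) < rho -> continuous_joint K' z t) ->
  (forall z t, Cmod (z - z0) < rho -> Ccont (K z) t) ->
  is_Cderive (fun z => CInt (K z) a b) z0 (CInt (K' z0) a b).
Proof.
  intros Hab Hrho HK HK' Hcont. apply is_Cderive_eps. intros e He.
  assert (Hz0 : Cmod (z0 - z0) < rho).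
  { replace (z0 - z0)%C with (RtoC 0) by ring. now rewrite Cmod_0. }
  assert (HK0 : forall t, Ccont (K' z0) t)
    by (intros t; apply continuous_joint_section; auto).
  assert (He' : 0 < e / (2 * (1 + (b - a)))) by (apply Rdiv_lt_0_compat; lra).
  destruct (continuous_param_uniform K' z0 a b (fun t => HK' z0 t Hz0) _ He') as [d [Hd H]].
  exists (Rmin rho d). split; [now apply Rmin_pos|]. intros w Hw.
  assert (Hw1 : Cmod (w - z0) < rho) by (eapply Rlt_le_trans; [exact Hw | apply Rmin_l]).
  assert (Hw2 : Cmod (w - z0) < d) by (eapply Rlt_le_trans; [exact Hw | apply Rmin_r]).
  rewrite <- CInt_scal, <- !CInt_minus; auto.
  2:{ intros t; apply continuous_C_minus; auto. }
  2:{ intros t; apply continuous_C_mult; [apply continuous_C_const | auto]. }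
  set (N := Cmod (w - z0)) in *. assert (HN : 0 <= N) by apply Cmod_ge_0.
  apply Rle_trans with ((b - a) * (2 * (e / (2 * (1 + (b - a))) * N))).
  - apply Cmod_CInt_le; [exact Hab | |].
    + intros t. apply continuous_C_minus; [apply continuous_C_minus; auto |].
      apply continuous_C_mult; [apply continuous_C_const | auto].
    + intros t Ht.
      assert (Hseg : forall s, 0 <= s <= 1 -> Cmod (z0 + RtoC s * (w - z0) - z0) <= N).
      { intros s Hs. replace (z0 + RtoC s * (w - z0) - z0)%C with (RtoC s * (w - z0))%C by ring.
        rewrite Cmod_mult, Cmod_R, Rabs_pos_eq by lra. fold N. nra. }
      assert (L := linearization_bound (fun z => K z t) (fun z => K' z t) z0 (w - z0)
                     (e / (2 * (1 + (b - a))))).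
      replace (z0 + (w - z0))%C with w in L by ring.
      apply L.
      * intros s Hs. apply HK. specialize (Hseg s Hs). lra.
      * intros s Hs. apply Rlt_le, H; [|exact Ht]. specialize (Hseg s Hs). lra.
  - replace ((b - a) * (2 * (e / (2 * (1 + (b - a))) * N)))
      with (e * N * ((b - a) / (1 + (b - a)))) by (field; lra).
    rewrite <- (Rmult_1_r (e * N)) at 2. apply Rmult_le_compat_l; [nra|].
    apply (Rmult_le_reg_r (1 + (b - a))); [lra|]. field_simplify; lra.
Qed.

(** * Circular means and Cauchy's formula for the derivative *)

Definition cis (t : R) : C := (cos t, sin t).

Lemma is_curve_derive_cis (t : R) : is_curve_derive cis t (Ci * cis t)%C.
Proof.
  apply (is_curve_derive_eq _ _ (- sin t, cos t)).
  - apply is_curve_derive_pair; [apply is_derive_cos | apply is_derive_sin].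
  - apply C_ext; simpl; ring.
Qed.

Lemma continuous_cis {T : UniformSpace} (p : T -> R) (x : T) :
  continuous p x -> Ccont (fun y => cis (p y)) x.
Proof.
  intros Hp. apply (continuous_comp (U := T) (V := R_UniformSpace) (W := C_UniformSpace) p cis x Hp).
  eapply is_curve_derive_continuous, is_curve_derive_cis.
Qed.

Lemma cis_conj (t : R) : (cis t * Cconj (cis t))%C = RtoC 1.
Proof. apply C_ext; simpl; [generalize (sin2_cos2 t); unfold Rsqr; lra | ring]. Qed.

Lemma Cmod_cis (t : R) : Cmod (cis t) = 1.
Proof.
  unfold Cmod, cis; simpl fst; simpl snd.
  replace (cos t ^ 2 + sin t ^ 2) with 1; [apply sqrt_1|].
  generalize (sin2_cos2 t); unfold Rsqr; lra.
Qed.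

Lemma Cmod_mult_cis (z : C) (t : R) : Cmod (z * cis t) = Cmod z.
Proof. rewrite Cmod_mult, Cmod_cis. ring. Qed.

Lemma cis_2PI : cis (2 * PI) = cis 0.
Proof. unfold cis. now rewrite cos_2PI, sin_2PI, cos_0, sin_0. Qed.

Lemma is_curve_derive_mult (g h : R -> C) (t : R) (a b : C) :
  is_curve_derive g t a -> is_curve_derive h t b ->
  is_curve_derive (fun s => g s * h s)%C t (a * h t + g t * b)%C.
Proof.
  intros Hg Hh.
  assert (Hg1 := is_curve_derive_Re g t a Hg). assert (Hg2 := is_curve_derive_Im g t a Hg).
  assert (Hh1 := is_curve_derive_Re h t b Hh). assert (Hh2 := is_curve_derive_Im h t b Hh).
  assert (M : forall (p q : R -> R) (u v : R), is_derive p t u -> is_derive q t v ->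
            is_derive (fun s => p s * q s) t (u * q t + p t * v)).
  { intros p q u v Hp Hq. apply (is_derive_mult (K := R_AbsRing) p q t u v Hp Hq).
    intros n m; apply Rmult_comm. }
  unfold Cmult at 1.
  eapply is_curve_derive_eq.
  - apply is_curve_derive_pair.
    + apply (is_derive_minus (V := R_NormedModule) (fun s => Re (g s) * Re (h s))
               (fun s => Im (g s) * Im (h s))); apply M; eassumption.
    + apply (is_derive_plus (V := R_NormedModule) (fun s => Re (g s) * Im (h s))
               (fun s => Im (g s) * Re (h s))); apply M; eassumption.
  - apply C_ext; simpl; unfold minus, plus, opp; simpl; unfold Re, Im; ring.
Qed.

Lemma CInt_periodic (g dg : R -> C) :
  (forall t, is_curve_derive g t (dg t)) -> (forall t, Ccont dg t) ->
  g (2 * PI) = g 0 -> CInt dg 0 (2 * PI) = RtoC 0.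
Proof. intros Hg Hdg Hp. rewrite (CInt_derive g dg) by assumption. rewrite Hp. Cring. Qed.

Lemma CInt_conj_cis : CInt (fun t => Cconj (cis t)) 0 (2 * PI) = RtoC 0.
Proof.
  assert (Hd : forall t, is_curve_derive (fun t => Cconj (cis t)) t (- Ci * Cconj (cis t))%C).
  { intros t. apply (is_curve_derive_eq _ _ (- sin t, - cos t)).
    - apply is_curve_derive_pair; [apply is_derive_cos|].
      apply (is_derive_opp (V := R_NormedModule)), is_derive_sin.
    - apply C_ext; simpl; ring. }
  assert (Hc : forall t, Ccont (fun t => Cconj (cis t)) t)
    by (intros t; eapply is_curve_derive_continuous, Hd).
  assert (H := CInt_periodic (fun t => Ci * Cconj (cis t))%C (fun t => Cconj (cis t))).
  apply H; [| exact Hc | now rewrite cis_2PI].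
  intros t. eapply is_curve_derive_eq.
  - apply (is_Cderive_curve (fun z => Ci * z)%C (fun t => Cconj (cis t)) t Ci); [|apply Hd].
    eapply is_Cderive_eq; [apply is_Cderive_mult; [apply is_Cderive_const | apply is_Cderive_id]|].
    Cring.
  - transitivity (- (Ci * Ci) * Cconj (cis t))%C; [ring|].
    replace (Ci * Ci)%C with (- RtoC 1)%C by (apply C_ext; simpl; ring). ring.
Qed.

(** With a continuous derivative, circular means can be differentiated under
    the integral sign, so that discs need no second Goursat argument. *)
Definition C1_disc (R' : R) (F F' : C -> C) : Prop :=
  forall z, Cmod z < R' -> is_Cderive F z (F' z) /\
    continuous (T := C_UniformSpace) (U := C_UniformSpace) F' z.

Lemma C1_disc_continuous (R' : R) (F F' : C -> C) (z : C) :
  C1_disc R' F F' -> Cmod z < R' ->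
  continuous (T := C_UniformSpace) (U := C_UniformSpace) F z.
Proof. intros H Hz. eapply is_Cderive_continuous_pt, H, Hz. Qed.

(** A function of a complex [z] rather than of the radius: circular means
    are then themselves holomorphic, and constant once their derivative
    vanishes. *)
Definition circle_int (F : C -> C) (w : R -> C) (z : C) : C :=
  CInt (fun t => F (z * cis t) * w t)%C 0 (2 * PI).

Lemma continuous_circle (F : C -> C) (w : R -> C) (z : C) (t : R) :
  continuous (T := C_UniformSpace) (U := C_UniformSpace) F (z * cis t)%C ->
  Ccont w t -> Ccont (fun t => F (z * cis t) * w t)%C t.
Proof.
  intros HF Hw. apply continuous_C_mult; [|exact Hw].
  apply (continuous_comp (U := R_UniformSpace) (V := C_UniformSpace) (W := C_UniformSpace)
           (fun t => z * cis t)%C F); [|exact HF].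
  apply continuous_C_mult; [apply continuous_C_const|].
  apply continuous_cis, continuous_id.
Qed.

Lemma circle_int_derive (R' : R) (F F' : C -> C) (w : R -> C) (z : C) :
  C1_disc R' F F' -> (forall t, Ccont w t) -> Cmod z < R' ->
  is_Cderive (circle_int F w) z (circle_int F' (fun t => cis t * w t)%C z).
Proof.
  intros HF Hw Hz.
  assert (Hin : forall y, Cmod (y - z) < R' - Cmod z -> Cmod y < R').
  { intros y Hy. replace y with (z + (y - z))%C by ring.
    eapply Rle_lt_trans; [apply Cmod_triangle | lra]. }
  assert (Hwc : forall t, Ccont (fun t => cis t * w t)%C t)
    by (intros t; apply continuous_C_mult; [apply continuous_cis, continuous_id | apply Hw]).
  apply (is_Cderive_CInt (fun z t => F (z * cis t) * w t)%C
           (fun z t => F' (z * cis t) * (cis t * w t))%C z (R' - Cmod z)).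
  - generalize PI_RGT_0; lra.
  - lra.
  - intros y t Hy. eapply is_Cderive_eq.
    + apply is_Cderive_mult; [|apply is_Cderive_const].
      apply (is_Cderive_comp F (fun y => y * cis t)%C).
      * apply HF. rewrite Cmod_mult_cis. auto.
      * apply is_Cderive_mult; [apply is_Cderive_id | apply is_Cderive_const].
    + Cring.
  - intros y t Hy.
    apply continuous_C_mult.
    + apply (continuous_comp (U := prod_UniformSpace C_UniformSpace R_UniformSpace)
         (V := C_UniformSpace) (W := C_UniformSpace) (fun p => fst p * cis (snd p))%C F').
      * apply continuous_C_mult; [apply continuous_fst|].
        apply continuous_cis, continuous_snd.
      * apply HF. simpl. rewrite Cmod_mult_cis. auto.
    + apply (continuous_comp (U := prod_UniformSpace C_UniformSpace R_UniformSpace)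
         (V := R_UniformSpace) (W := C_UniformSpace) snd (fun t => cis t * w t)%C);
        [apply continuous_snd | apply Hwc].
  - intros y t Hy. apply continuous_circle; [|apply Hw].
    eapply C1_disc_continuous; [exact HF|]. rewrite Cmod_mult_cis. auto.
Qed.

Lemma zero_derivative_segment (F F' : C -> C) (z h : C) :
  (forall s, 0 <= s <= 1 -> is_Cderive F (z + RtoC s * h)%C (F' (z + RtoC s * h)%C)) ->
  (forall s, 0 <= s <= 1 -> F' (z + RtoC s * h)%C = RtoC 0) ->
  F (z + h)%C = F z.
Proof.
  intros HF H0.
  assert (Hz : F' z = RtoC 0).
  { rewrite <- (H0 0) by lra. f_equal. ring. }
  assert (L := linearization_bound F F' z h 0 HF).
  rewrite Hz in L. apply Ceq_minus, Cmod_eq_0, Rle_antisym; [|apply Cmod_ge_0].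
  replace (F (z + h) - F z)%C with (F (z + h) - F z - h * RtoC 0)%C by ring.
  eapply Rle_trans; [apply L|lra].
  intros s Hs. rewrite H0 by assumption. replace (RtoC 0 - RtoC 0)%C with (RtoC 0) by ring.
  rewrite Cmod_0; lra.
Qed.

Lemma disc_segment (R' : R) (z : C) (s : R) :
  Cmod z < R' -> 0 <= s <= 1 -> Cmod (RtoC 0 + RtoC s * z) < R'.
Proof.
  intros Hz Hs. rewrite Cplus_0_l, Cmod_mult, Cmod_R, Rabs_pos_eq by lra.
  generalize (Cmod_ge_0 z); nra.
Qed.

(** The radial derivative of a circular mean is, up to a factor, the integral
    of an angular derivative over a full period. *)
Lemma mean_value (R' : R) (F F' : C -> C) (z : C) :
  C1_disc R' F F' -> Cmod z < R' ->
  circle_int F (fun _ => RtoC 1) z = (RtoC (2 * PI) * F (RtoC 0))%C.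
Proof.
  intros HF Hz.
  assert (Hw : forall t : R, Ccont (fun _ : R => RtoC 1) t) by (intros; apply continuous_C_const).
  assert (Hd := fun y Hy => circle_int_derive R' F F' _ y HF Hw Hy).
  assert (H0 : forall y, Cmod y < R' -> circle_int F' (fun t => cis t * RtoC 1)%C y = RtoC 0).
  { intros y Hy.
    assert (Hc : forall t, Ccont (fun t => F' (y * cis t) * (cis t * RtoC 1))%C t).
    { intros t. apply continuous_circle.
      - apply HF. now rewrite Cmod_mult_cis.
      - apply continuous_C_mult; [apply continuous_cis, continuous_id | apply continuous_C_const]. }
    assert (Hper : (Ci * y * circle_int F' (fun t => cis t * RtoC 1) y)%C = RtoC 0).
    { unfold circle_int. rewrite <- CInt_scal by exact Hc.
      apply (CInt_periodic (fun t => F (y * cis t)%C)).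
      - intros t. eapply is_curve_derive_eq.
        + apply (is_Cderive_curve F (fun t => y * cis t)%C).
          * apply HF. now rewrite Cmod_mult_cis.
          * apply (is_curve_derive_mult (fun _ => y) cis); [|apply is_curve_derive_cis].
            apply (is_derive_const (K := R_AbsRing) (V := C_R_NormedModule)).
        + Cring.
      - intros t. apply continuous_C_mult; [apply continuous_C_const | apply Hc].
      - now rewrite cis_2PI. }
    destruct (Ceq_dec y (RtoC 0)) as [->|Hy0].
    - unfold circle_int. rewrite (CInt_ext _ (fun t => F' (RtoC 0) * cis t)%C)
        by (intros t; rewrite Cmult_0_l; ring).
      rewrite CInt_scal by (intros t; apply continuous_cis, continuous_id).
      rewrite (CInt_periodic (fun t => - Ci * cis t)%C cis); [ring | | |].
      + intros t. eapply is_curve_derive_eq.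
        * apply (is_curve_derive_mult (fun _ => - Ci)%C cis); [|apply is_curve_derive_cis].
          apply (is_derive_const (K := R_AbsRing) (V := C_R_NormedModule)).
        * change (@zero C_R_NormedModule) with (RtoC 0).
          transitivity (- (Ci * Ci) * cis t)%C; [ring|].
          replace (Ci * Ci)%C with (- RtoC 1)%C by (apply C_ext; simpl; ring). ring.
      + intros t; apply continuous_cis, continuous_id.
      + now rewrite cis_2PI.
    - destruct (Ceq_dec (circle_int F' (fun t => cis t * RtoC 1)%C y) (RtoC 0)) as [E|E]; [exact E|].
      exfalso. revert Hper. apply Cmult_neq_0; [|exact E].
      apply Cmult_neq_0; [apply Ci_nz | exact Hy0]. }
  transitivity (circle_int F (fun _ => RtoC 1) (RtoC 0)).
  - rewrite <- (Cplus_0_l z) at 1.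
    apply (zero_derivative_segment _ (circle_int F' (fun t => cis t * RtoC 1)%C)).
    + intros s Hs. apply Hd, disc_segment; assumption.
    + intros s Hs. apply H0, disc_segment; assumption.
  - unfold circle_int.
    rewrite (CInt_ext _ (fun _ => F (RtoC 0))) by (intros t; rewrite Cmult_0_l; ring).
    rewrite CInt_const, Rminus_0_r. reflexivity.
Qed.

Lemma entire_C1_disc (F F' : C -> C) (R' : R) (c : C) :
  (forall z, is_Cderive F z (F' z)) -> everywhere_continuous F' ->
  C1_disc R' (fun z => F (c + z)%C) (fun z => F' (c + z)%C).
Proof.
  intros HF HF' z _. split.
  - eapply is_Cderive_eq.
    + apply (is_Cderive_comp F (fun z => c + z)%C); [apply HF|].
      apply is_Cderive_plus; [apply is_Cderive_const | apply is_Cderive_id].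
    + Cring.
  - apply (continuous_comp (U := C_UniformSpace) (V := C_UniformSpace) (W := C_UniformSpace)
             (fun z => c + z)%C F'); [|apply HF'].
    apply continuous_C_plus; [apply continuous_C_const | apply continuous_id].
Qed.

(** With [G zeta] the integral below at radius [zeta], integration by parts
    in the angle gives [zeta G' = G], so [G / zeta] is constant on (0, 1]; its
    limit at 0 is [G' 0 = 2 pi F' z]. *)
Lemma cauchy_derivative (F F' : C -> C) (z : C) :
  (forall z, is_Cderive F z (F' z)) -> everywhere_continuous F' ->
  CInt (fun t => F (z + cis t) * Cconj (cis t))%C 0 (2 * PI) = (RtoC (2 * PI) * F' z)%C.
Proof.
  intros HF HF'.
  assert (HC1 := entire_C1_disc F F' 2 z HF HF').
  set (G := circle_int (fun y => F (z + y)%C) (fun t => Cconj (cis t))).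
  set (G' := circle_int (fun y => F' (z + y)%C) (fun t => cis t * Cconj (cis t))%C).
  assert (Hw : forall t, Ccont (fun t => Cconj (cis t)) t)
    by (intros t; apply continuous_Cconj, continuous_cis, continuous_id).
  assert (HG : forall y, Cmod y < 2 -> is_Cderive G y (G' y))
    by (intros y Hy; apply (circle_int_derive 2 _ _ _ y HC1 Hw Hy)).
  assert (HFc : everywhere_continuous F) by (intros y; eapply is_Cderive_continuous_pt, HF).
  assert (Hshift : forall H : C -> C, everywhere_continuous H -> everywhere_continuous (fun y => H (z + y)%C)).
  { intros H HH y.
    apply (continuous_comp (U := C_UniformSpace) (V := C_UniformSpace) (W := C_UniformSpace)
             (fun y => z + y)%C H); [|apply HH].
    apply continuous_C_plus; [apply continuous_C_const | apply continuous_id]. }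
  assert (HG0 : G' (RtoC 0) = (RtoC (2 * PI) * F' z)%C).
  { unfold G', circle_int.
    rewrite (CInt_ext _ (fun _ => F' z)), CInt_const, Rminus_0_r; [reflexivity|].
    intros t. rewrite cis_conj, Cmult_0_l, Cplus_0_r. ring. }
  assert (HG00 : G (RtoC 0) = RtoC 0).
  { unfold G, circle_int.
    rewrite (CInt_ext _ (fun t => F z * Cconj (cis t))%C)
      by (intros t; now rewrite Cmult_0_l, Cplus_0_r).
    rewrite CInt_scal, CInt_conj_cis by exact Hw. ring. }
  assert (Heuler : forall y, (y * G' y)%C = G y).
  { intros y.
    assert (C1 : forall t, Ccont (fun t => F' (z + y * cis t) * (cis t * Cconj (cis t)))%C t).
    { intros t. apply (continuous_circle (fun y => F' (z + y)%C)); [now apply Hshift|].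
      apply continuous_C_mult; [apply continuous_cis, continuous_id | apply Hw]. }
    assert (C2 : forall t, Ccont (fun t => F (z + y * cis t) * Cconj (cis t))%C t).
    { intros t. apply (continuous_circle (fun y => F (z + y)%C)); [now apply Hshift | apply Hw]. }
    assert (Hper : (Ci * (y * G' y - G y))%C = RtoC 0).
    { unfold G', G, circle_int.
      rewrite <- CInt_scal, <- CInt_minus, <- CInt_scal; auto.
      2:{ intros t; apply continuous_C_minus; [|apply C2].
          apply continuous_C_mult; [apply continuous_C_const | apply C1]. }
      2:{ intros t; apply continuous_C_mult; [apply continuous_C_const | apply C1]. }
      apply (CInt_periodic (fun t => F (z + y * cis t) * Cconj (cis t))%C).
      - intros t. eapply is_curve_derive_eq.
        + apply (is_curve_derive_mult (fun t => F (z + y * cis t)%C) (fun t => Cconj (cis t))).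
          * apply (is_Cderive_curve F (fun t => z + y * cis t)%C); [apply HF|].
            apply (is_derive_plus (V := C_R_NormedModule) (fun _ => z) (fun t => y * cis t)%C).
            -- apply (is_derive_const (K := R_AbsRing) (V := C_R_NormedModule)).
            -- apply (is_curve_derive_mult (fun _ => y) cis); [|apply is_curve_derive_cis].
               apply (is_derive_const (K := R_AbsRing) (V := C_R_NormedModule)).
          * instantiate (1 := (- Ci * Cconj (cis t))%C).
            apply (is_curve_derive_eq _ _ (- sin t, - cos t)).
            -- apply is_curve_derive_pair; [apply is_derive_cos|].
               apply (is_derive_opp (V := R_NormedModule)), is_derive_sin.
            -- apply C_ext; simpl; ring.
        + change (@zero C_R_NormedModule) with (RtoC 0).
          change (@plus C_R_NormedModule) with Cplus. ring.
      - intros t. apply continuous_C_mult; [apply continuous_C_const|].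
        apply continuous_C_minus; [|apply C2].
        apply continuous_C_mult; [apply continuous_C_const | apply C1].
      - now rewrite cis_2PI. }
    apply Ceq_minus.
    destruct (Ceq_dec (y * G' y - G y)%C (RtoC 0)) as [E|E]; [exact E|].
    exfalso. revert Hper. apply Cmult_neq_0; [apply Ci_nz | exact E]. }
  set (k := fun y => (G y / y)%C).
  assert (Hk : forall y, y <> RtoC 0 -> Cmod y < 2 -> is_Cderive k y (RtoC 0)).
  { intros y Hy Hy2. eapply is_Cderive_eq.
    - apply (is_Cderive_div G (fun y => y) y (G' y) (RtoC 1)); [auto | apply is_Cderive_id | exact Hy].
    - rewrite <- Heuler. field. exact Hy. }
  assert (Hconst : forall e, 0 < e <= 1 -> k (RtoC 1) = k (RtoC e)).
  { intros e He.
    replace (RtoC 1) with (RtoC e + RtoC (1 - e))%C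
      by (rewrite <- RtoC_plus; f_equal; ring).
    apply (zero_derivative_segment k (fun _ => RtoC 0)); [|reflexivity].
    intros s Hs. rewrite <- RtoC_mult, <- RtoC_plus.
    apply Hk.
    - intros E. apply RtoC_inj in E. nra.
    - rewrite Cmod_R, Rabs_pos_eq by nra. nra. }
  assert (Hone : G (RtoC 1) = CInt (fun t => F (z + cis t) * Cconj (cis t))%C 0 (2 * PI)).
  { unfold G, circle_int. apply CInt_ext. intros t. now rewrite Cmult_1_l. }
  rewrite <- Hone, <- HG0.
  replace (G (RtoC 1)) with (k (RtoC 1)) by (unfold k; field; apply C1_nz).
  apply Ceq_minus, Cmod_eq_0, Rle_antisym; [|apply Cmod_ge_0].
  apply le_epsilon. intros e He. rewrite Rplus_0_l.
  assert (HD : is_Cderive G (RtoC 0) (G' (RtoC 0))) by (apply HG; rewrite Cmod_0; lra).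
  rewrite is_Cderive_eps in HD. destruct (HD e He) as [d [Hd HGd]].
  set (r := Rmin 1 (d / 2)).
  assert (Hr : 0 < r) by (apply Rmin_pos; lra).
  assert (Hr1 : r <= 1) by apply Rmin_l.
  assert (Hr2 : r <= d / 2) by apply Rmin_r.
  rewrite (Hconst r) by lra.
  specialize (HGd (RtoC r)). rewrite HG00 in HGd.
  replace (RtoC r - RtoC 0)%C with (RtoC r) in HGd by ring.
  rewrite Cmod_R, Rabs_pos_eq in HGd by lra.
  specialize (HGd ltac:(lra)).
  assert (Hr0 : RtoC r <> RtoC 0) by (intros E; apply RtoC_inj in E; lra).
  apply (Rmult_le_reg_r r); [exact Hr|].
  eapply Rle_trans; [|exact HGd]. apply Req_le.
  rewrite <- (Rabs_pos_eq r) at 2 by lra. rewrite <- (Cmod_R r), <- Cmod_mult.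
  f_equal. unfold k. field. exact Hr0.
Qed.

(** * Derivatives and quotients of entire functions *)

Lemma RtoC_2PI_neq_0 : RtoC (2 * PI) <> RtoC 0.
Proof. intros E. apply RtoC_inj in E. generalize PI_RGT_0; lra. Qed.

Lemma continuous_joint_shift (F : C -> C) (z : C) (t : R) :
  everywhere_continuous F ->
  continuous_joint (fun z t => F (z + cis t) * Cconj (cis t))%C z t.
Proof.
  intros HF. apply continuous_C_mult.
  - apply (continuous_comp (U := prod_UniformSpace C_UniformSpace R_UniformSpace)
       (V := C_UniformSpace) (W := C_UniformSpace) (fun p => fst p + cis (snd p))%C F);
      [|apply HF].
    apply continuous_C_plus; [apply continuous_fst | apply continuous_cis, continuous_snd].
  - apply continuous_Cconj, continuous_cis, continuous_snd.
Qed.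

Lemma cauchy_derivative_div (F F' : C -> C) (z : C) :
  (forall z, is_Cderive F z (F' z)) -> everywhere_continuous F' ->
  F' z = (/ RtoC (2 * PI) * CInt (fun t => F (z + cis t) * Cconj (cis t))%C 0 (2 * PI))%C.
Proof.
  intros HF HF'. rewrite (cauchy_derivative F F' z HF HF').
  field. apply RtoC_2PI_neq_0.
Qed.

(** Cauchy's formula expresses [F'] by an integral in which [z] occurs only
    through [F], and which can therefore be differentiated. *)
Lemma derivative_derivable (F F' : C -> C) (z : C) :
  (forall z, is_Cderive F z (F' z)) -> everywhere_continuous F' ->
  is_Cderive F' z
    (/ RtoC (2 * PI) * CInt (fun t => F' (z + cis t) * Cconj (cis t))%C 0 (2 * PI))%C.
Proof.
  intros HF HF'.
  assert (HFc : everywhere_continuous F) by (intros y; eapply is_Cderive_continuous_pt, HF).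
  apply (is_derive_ext (K := C_AbsRing) (V := C_NormedModule)
    (fun z => / RtoC (2 * PI) * CInt (fun t => F (z + cis t) * Cconj (cis t))%C 0 (2 * PI))%C).
  { intros y. symmetry. now apply cauchy_derivative_div. }
  eapply is_Cderive_eq.
  - apply is_Cderive_mult; [apply is_Cderive_const|].
    apply (is_Cderive_CInt (fun z t => F (z + cis t) * Cconj (cis t))%C
             (fun z t => F' (z + cis t) * Cconj (cis t))%C z 1).
    + generalize PI_RGT_0; lra.
    + lra.
    + intros y t _. eapply is_Cderive_eq.
      * apply is_Cderive_mult; [|apply is_Cderive_const].
        apply (is_Cderive_comp F (fun y => y + cis t)%C); [apply HF|].
        apply is_Cderive_plus; [apply is_Cderive_id | apply is_Cderive_const].
      * Cring.
    + intros y t _. now apply continuous_joint_shift.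
    + intros y t _.
      apply (continuous_joint_section (fun z t => F (z + cis t) * Cconj (cis t))%C y t).
      now apply continuous_joint_shift.
  - Cring.
Qed.

(** Applied to a primitive of [f], Cauchy's formula shows that [f'] exists and
    is continuous; applied to [f] itself, that [f'] is differentiable. *)
Theorem entire_derivative (f : C -> C) :
  entire f -> exists f', (forall z, is_Cderive f z (f' z)) /\ entire f'.
Proof.
  intros Hf. destruct (entire_primitive f Hf) as [P HP].
  assert (Hc := entire_continuous f Hf).
  set (f' := fun z =>
    (/ RtoC (2 * PI) * CInt (fun t => f (z + cis t) * Cconj (cis t))%C 0 (2 * PI))%C).
  assert (Hf' : forall z, is_Cderive f z (f' z))
    by (intros z; now apply (derivative_derivable P f z)).
  assert (Hc' : everywhere_continuous f').
  { intros z. apply continuous_C_mult; [apply continuous_C_const|].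
    apply (CInt_param_continuous (fun z t => f (z + cis t) * Cconj (cis t))%C).
    - generalize PI_RGT_0; lra.
    - intros y t. now apply continuous_joint_shift. }
  exists f'. split; [exact Hf'|].
  intros z. eexists. apply (derivative_derivable f f' z Hf' Hc').
Qed.

(** The quotient is [h z = int_0^1 f' (a + t (z - a)) dt]. *)
Theorem entire_division (f : C -> C) (a : C) :
  entire f -> f a = RtoC 0 ->
  exists h, entire h /\ forall z, f z = ((z - a) * h z)%C.
Proof.
  intros Hf Ha.
  destruct (entire_derivative f Hf) as [f1 [Hf1 Ef1]].
  destruct (entire_derivative f1 Ef1) as [f2 [Hf2 Ef2]].
  assert (C1 := entire_continuous f1 Ef1). assert (C2 := entire_continuous f2 Ef2).
  assert (Hcomp : forall F : C -> C, everywhere_continuous F -> forall z t,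
     continuous_joint (fun z t => F (a + RtoC t * (z - a)))%C z t).
  { intros F HF z t.
    apply (continuous_comp (U := prod_UniformSpace C_UniformSpace R_UniformSpace)
       (V := C_UniformSpace) (W := C_UniformSpace)
       (fun p => a + RtoC (snd p) * (fst p - a))%C F); [|apply HF].
    apply continuous_C_plus; [apply continuous_C_const|].
    apply continuous_C_mult; [apply continuous_RtoC, continuous_snd|].
    apply continuous_C_minus; [apply continuous_fst | apply continuous_C_const]. }
  assert (Hsec : forall z t, Ccont (fun t => f1 (a + RtoC t * (z - a)))%C t).
  { intros z t. apply (continuous_joint_section (fun z t => f1 (a + RtoC t * (z - a)))%C z t).
    now apply Hcomp. }
  exists (fun z => CInt (fun t => f1 (a + RtoC t * (z - a)))%C 0 1). split.
  - intros z. eexists.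
    apply (is_Cderive_CInt (fun z t => f1 (a + RtoC t * (z - a)))%C
             (fun z t => RtoC t * f2 (a + RtoC t * (z - a)))%C z 1); try lra.
    + intros y t _. apply (is_Cderive_comp f1 (fun y => a + RtoC t * (y - a))%C); [apply Hf2|].
      eapply is_Cderive_eq.
      * apply is_Cderive_plus; [apply is_Cderive_const|].
        apply is_Cderive_mult; [apply is_Cderive_const|].
        apply is_Cderive_minus; [apply is_Cderive_id | apply is_Cderive_const].
      * Cring.
    + intros y t _. apply continuous_C_mult; [apply continuous_RtoC, continuous_snd|].
      now apply Hcomp.
    + intros y t _. apply Hsec.
  - intros z. rewrite <- CInt_scal by (intros t; apply Hsec).
    rewrite (CInt_derive (fun t => f (a + RtoC t * (z - a))%C)).
    + rewrite Cmult_0_l, Cmult_1_l, Cplus_0_r, Ha.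
      replace (a + (z - a))%C with z by ring. Cring.
    + intros t. apply (is_Cderive_curve f (fun t => a + RtoC t * (z - a))%C); [apply Hf1|].
      apply is_curve_derive_line.
    + intros t. apply continuous_C_mult; [apply continuous_C_const | apply Hsec].
Qed.

(** * Circular means of a logarithmic derivative *)

Ltac Cderivation :=
  lazymatch goal with
  | |- is_derive (fun x => (@?u x + @?v x)%C) _ _ =>
      refine (is_Cderive_plus u v _ _ _ _ _); [Cderivation | Cderivation]
  | |- is_derive (fun x => (@?u x - @?v x)%C) _ _ =>
      refine (is_Cderive_minus u v _ _ _ _ _); [Cderivation | Cderivation]
  | |- is_derive (fun x => (@?u x * @?v x)%C) _ _ =>
      refine (is_Cderive_mult u v _ _ _ _ _); [Cderivation | Cderivation]
  | |- is_derive (fun x => x) _ _ => exact (is_Cderive_id _)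
  | |- is_derive (fun x => ?h x) ?z _ =>
      lazymatch goal with H : is_derive h z _ |- _ => exact H end
  | |- is_derive (fun x => ?c) _ _ => exact (is_Cderive_const _ _)
  | |- is_derive ?h ?z _ =>
      lazymatch goal with H : is_derive h z _ |- _ => exact H end
  end.

Ltac Ccontinuity :=
  lazymatch goal with
  | |- continuous (fun x => (@?u x + @?v x)%C) _ =>
      refine (continuous_C_plus _ _ _ _ _); Ccontinuity
  | |- continuous (fun x => (@?u x - @?v x)%C) _ =>
      refine (continuous_C_minus _ _ _ _ _); Ccontinuity
  | |- continuous (fun x => (@?u x * @?v x)%C) _ =>
      refine (continuous_C_mult _ _ _ _ _); Ccontinuity
  | |- continuous (fun x => ?c) _ => exact (continuous_C_const _ _)
  | |- continuous (fun x => ?h x) ?z =>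
      lazymatch goal with H : continuous h z |- _ => exact H end
  | |- continuous ?h ?z =>
      lazymatch goal with H : continuous h z |- _ => exact H end
  end.

(** The second and third derivatives of [log f] in terms of those of [f]. *)
Definition log_jet2 (f0 f1 f2 : C) : C := (f2 / f0 - f1 / f0 * (f1 / f0))%C.
Definition log_jet3 (f0 f1 f2 f3 : C) : C :=
  (f3 / f0 - RtoC 3 * (f1 / f0 * (f2 / f0))
   + RtoC 2 * (f1 / f0 * (f1 / f0 * (f1 / f0))))%C.

Lemma log_derivative_jet (R' : R) (g g1 g2 g3 : C -> C) :
  (forall z, is_Cderive g z (g1 z)) -> (forall z, is_Cderive g1 z (g2 z)) ->
  (forall z, is_Cderive g2 z (g3 z)) -> entire g3 ->
  (forall z, Cmod z < R' -> g z <> RtoC 0) ->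
  exists q1 q2 q3,
    C1_disc R' (fun z => g1 z / g z)%C q1 /\ C1_disc R' q1 q2 /\ C1_disc R' q2 q3 /\
    q1 (RtoC 0) = log_jet2 (g (RtoC 0)) (g1 (RtoC 0)) (g2 (RtoC 0)) /\
    q2 (RtoC 0) = log_jet3 (g (RtoC 0)) (g1 (RtoC 0)) (g2 (RtoC 0)) (g3 (RtoC 0)).
Proof.
  intros H0 H1 H2 E3 Hnz.
  destruct (entire_derivative g3 E3) as [g4 [H3 E4]].
  (* as polynomials in 1/g and the derivatives of g, all the functions below
     have mechanical derivatives *)
  set (i := fun z => (/ g z)%C).
  assert (Hi : forall z, Cmod z < R' -> is_Cderive i z (- (g1 z * (i z * i z)))%C).
  { intros z Hz. eapply is_Cderive_eq; [apply is_Cderive_inv; [apply H0 | auto]|].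
    unfold i. cbv beta. match goal with |- ?a = ?b => change (@eq C a b) end. field. auto. }
  exists (fun z => g2 z * i z - g1 z * i z * (g1 z * i z))%C,
    (fun z => g3 z * i z - RtoC 3 * (g1 z * i z * (g2 z * i z))
              + RtoC 2 * (g1 z * i z * (g1 z * i z * (g1 z * i z))))%C,
    (fun z => g4 z * i z - RtoC 4 * (g1 z * i z * (g3 z * i z))
              - RtoC 3 * (g2 z * i z * (g2 z * i z))
              + RtoC 12 * (g1 z * i z * (g1 z * i z * (g2 z * i z)))
              - RtoC 6 * (g1 z * i z * (g1 z * i z * (g1 z * i z * (g1 z * i z)))))%C.
  assert (Hder : forall z, Cmod z < R' ->
    is_Cderive (fun z => g1 z * i z)%C z (g2 z * i z - g1 z * i z * (g1 z * i z))%C /\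
    is_Cderive (fun z => g2 z * i z - g1 z * i z * (g1 z * i z))%C z
      (g3 z * i z - RtoC 3 * (g1 z * i z * (g2 z * i z))
              + RtoC 2 * (g1 z * i z * (g1 z * i z * (g1 z * i z))))%C /\
    is_Cderive (fun z => g3 z * i z - RtoC 3 * (g1 z * i z * (g2 z * i z))
              + RtoC 2 * (g1 z * i z * (g1 z * i z * (g1 z * i z))))%C z
     (g4 z * i z - RtoC 4 * (g1 z * i z * (g3 z * i z))
              - RtoC 3 * (g2 z * i z * (g2 z * i z))
              + RtoC 12 * (g1 z * i z * (g1 z * i z * (g2 z * i z)))
              - RtoC 6 * (g1 z * i z * (g1 z * i z * (g1 z * i z * (g1 z * i z)))))%C).
  { intros z Hz. assert (Hiz := Hi z Hz). clearbody i.
    assert (A0 := H0 z). assert (A1 := H1 z). assert (A2 := H2 z). assert (A3 := H3 z).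
    refine (conj _ (conj _ _)).
    - apply (is_Cderive_eq _ _ (g2 z * i z + g1 z * - (g1 z * (i z * i z)))%C); [|Cring].
      apply is_Cderive_mult; assumption.
    - eapply is_Cderive_eq; [Cderivation | Cring].
    - eapply is_Cderive_eq; [Cderivation | Cring]. }
  refine (conj _ (conj _ (conj _ (conj _ _)))); [| | | reflexivity | reflexivity];
    (intros z Hz; split; [apply Hder; assumption|]).
  - exact (is_Cderive_continuous_pt _ _ _ (proj1 (proj2 (Hder z Hz)))).
  - exact (is_Cderive_continuous_pt _ _ _ (proj2 (proj2 (Hder z Hz)))).
  - assert (continuous (T := C_UniformSpace) (U := C_UniformSpace) i z)
      by (eapply is_Cderive_continuous_pt, Hi; assumption).
    assert (continuous (T := C_UniformSpace) (U := C_UniformSpace) g1 z)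
      by (eapply is_Cderive_continuous_pt, H1).
    assert (continuous (T := C_UniformSpace) (U := C_UniformSpace) g2 z)
      by (eapply is_Cderive_continuous_pt, H2).
    assert (continuous (T := C_UniformSpace) (U := C_UniformSpace) g3 z)
      by (eapply is_Cderive_continuous_pt, H3).
    assert (continuous (T := C_UniformSpace) (U := C_UniformSpace) g4 z)
      by (apply entire_continuous, E4).
    Ccontinuity.
Qed.

Lemma CInt_conj (f : R -> C) (a b : R) :
  (forall t, Ccont f t) ->
  CInt (fun t => Cconj (f t)) a b = Cconj (CInt f a b).
Proof.
  intros Hf.
  assert (Hc : forall t, Ccont (fun t => Cconj (f t)) t) by (intros t; now apply continuous_Cconj).
  apply C_ext.
  - rewrite re_conj, !Re_CInt by assumption. apply RInt_ext. intros t _. apply re_conj.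
  - rewrite im_conj, !Im_CInt by assumption.
    rewrite (RInt_ext _ (fun t => -1 * Im (f t) + 0 * 0)).
    + rewrite RInt_linear_combination; [change (-1 * RInt (fun t => Im (f t)) a b + 0 * RInt (fun _ => 0) a b
                                  = - RInt (fun t => Im (f t)) a b); ring | |].
      * intros t. now apply continuous_Im.
      * intros t. apply continuous_const.
    + intros t _. rewrite im_conj. match goal with |- ?u = ?v => change (@eq R u v) end. ring.
Qed.

Lemma is_Cderive_pow_S (n : nat) (z : C) :
  is_Cderive (fun z => z ^ S n)%C z (RtoC (INR (S n)) * z ^ n)%C.
Proof.
  assert (Hid := is_Cderive_id z).
  induction n as [|n IH].
  - apply (is_derive_ext (K := C_AbsRing) (V := C_NormedModule) (fun z => z)).
    { intros t. symmetry. apply Cpow_1_r. }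
    eapply is_Cderive_eq; [exact Hid|]. simpl. Cring.
  - apply (is_derive_ext (K := C_AbsRing) (V := C_NormedModule) (fun z => z * z ^ S n)%C).
    { intros t. symmetry. apply Cpow_S. }
    eapply is_Cderive_eq; [exact (is_Cderive_mult _ _ _ _ _ Hid IH)|].
    rewrite (S_INR (S n)), RtoC_plus, Cpow_S. Cring.
Qed.

Lemma continuous_cis_pow (n : nat) (t : R) : Ccont (fun t => cis t ^ n)%C t.
Proof. apply continuous_C_pow, continuous_cis, continuous_id. Qed.

Lemma CInt_cis_pow (n : nat) : CInt (fun t => cis t ^ S n)%C 0 (2 * PI) = RtoC 0.
Proof.
  transitivity (circle_int (fun z => z ^ S n)%C (fun _ => RtoC 1) (RtoC 1)).
  - apply CInt_ext. intros t. rewrite Cmult_1_l, Cmult_1_r. reflexivity.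
  - rewrite (mean_value 2 _ (fun z => RtoC (INR (S n)) * z ^ n)%C).
    + simpl. ring.
    + intros z _. split; [apply is_Cderive_pow_S|].
      apply continuous_C_mult; [apply continuous_C_const|].
      apply continuous_C_pow, continuous_id.
    + rewrite Cmod_1. lra.
Qed.

(** After multiplication by [z ^ S n] this is a circular mean of a function
    that vanishes at 0. *)
Lemma circle_int_cis_pow (R' : R) (q q1 : C -> C) (n : nat) (z : C) :
  C1_disc R' q q1 -> Cmod z < R' ->
  circle_int q (fun t => cis t ^ S n)%C z = RtoC 0.
Proof.
  intros Hq Hz.
  destruct (Ceq_dec z (RtoC 0)) as [->|Hz0].
  - unfold circle_int.
    rewrite (CInt_ext _ (fun t => q (RtoC 0) * cis t ^ S n)%C)
      by (intros t; now rewrite Cmult_0_l).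
    rewrite CInt_scal, CInt_cis_pow by (intros t; apply continuous_cis_pow). ring.
  - assert (HC : C1_disc R' (fun z => z ^ S n * q z)%C
               (fun z => RtoC (INR (S n)) * z ^ n * q z + z ^ S n * q1 z)%C).
    { intros y Hy. split.
      - apply (is_Cderive_mult (fun z => z ^ S n)%C q); [apply is_Cderive_pow_S | apply Hq, Hy].
      - apply continuous_C_plus; apply continuous_C_mult.
        + apply continuous_C_mult; [apply continuous_C_const|].
          apply continuous_C_pow, continuous_id.
        + eapply C1_disc_continuous; eassumption.
        + apply continuous_C_pow, continuous_id.
        + apply Hq, Hy. }
    assert (M := mean_value R' _ _ z HC Hz).
    assert (E : (z ^ S n * circle_int q (fun t => cis t ^ S n)%C z)%C = RtoC 0).
    { unfold circle_int. rewrite <- CInt_scal.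
      - transitivity (circle_int (fun z => z ^ S n * q z)%C (fun _ => RtoC 1) z).
        + apply CInt_ext. intros t. rewrite Cpow_mult_l. ring.
        + rewrite M. simpl. ring.
      - intros t. apply continuous_circle; [|apply continuous_cis_pow].
        eapply C1_disc_continuous; [exact Hq | now rewrite Cmod_mult_cis]. }
    destruct (Ceq_dec (circle_int q (fun t => cis t ^ S n)%C z) (RtoC 0)) as [H|H]; [exact H|].
    exfalso. revert E. apply Cmult_neq_0; [now apply Cpow_nz | exact H].
Qed.

Lemma circle_int_at_0 (q : C -> C) (w : R -> C) :
  (forall t, Ccont w t) -> CInt w 0 (2 * PI) = RtoC 0 -> circle_int q w (RtoC 0) = RtoC 0.
Proof.
  intros Hw H. unfold circle_int.
  rewrite (CInt_ext _ (fun t => q (RtoC 0) * w t)%C) by (intros t; now rewrite Cmult_0_l).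
  rewrite CInt_scal, H by exact Hw. ring.
Qed.

Lemma continuous_conj_cis_pow (n : nat) (t : R) : Ccont (fun t => Cconj (cis t) ^ n)%C t.
Proof. apply continuous_C_pow, continuous_Cconj, continuous_cis, continuous_id. Qed.

Lemma CInt_conj_cis_pow (n : nat) : CInt (fun t => Cconj (cis t) ^ S n)%C 0 (2 * PI) = RtoC 0.
Proof.
  rewrite (CInt_ext _ (fun t => Cconj (cis t ^ S n))) by (intros t; now rewrite Cpow_conj).
  rewrite CInt_conj, CInt_cis_pow by (intros t; apply continuous_cis_pow).
  apply C_ext; simpl; ring.
Qed.

(** Differentiation in [z] produces a factor [cis t], which cancels the
    conjugate and leaves a circular mean of [q1]. *)
Lemma circle_int_conj1 (R' : R) (q q1 q2 : C -> C) (z : C) :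
  C1_disc R' q q1 -> C1_disc R' q1 q2 -> Cmod z < R' ->
  circle_int q (fun t => Cconj (cis t) ^ 1)%C z = (RtoC (2 * PI) * q1 (RtoC 0) * z)%C.
Proof.
  intros Hq Hq1 Hz. apply Ceq_minus.
  set (Psi := fun z => (circle_int q (fun t => Cconj (cis t) ^ 1) z
                        - RtoC (2 * PI) * q1 (RtoC 0) * z)%C).
  change (Psi z = RtoC 0). transitivity (Psi (RtoC 0)).
  - rewrite <- (Cplus_0_l z). apply (zero_derivative_segment Psi (fun _ => RtoC 0)); [|reflexivity].
    intros s Hs. assert (Hs' := disc_segment R' z s Hz Hs).
    eapply is_Cderive_eq.
    + apply is_Cderive_minus.
      * apply (circle_int_derive R' q q1); [exact Hq | apply continuous_conj_cis_pow | exact Hs'].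
      * apply is_Cderive_mult; [apply is_Cderive_const | apply is_Cderive_id].
    + transitivity (circle_int q1 (fun _ => RtoC 1) (RtoC 0 + RtoC s * z)%C
                    - RtoC (2 * PI) * q1 (RtoC 0))%C.
      * assert (E : circle_int q1 (fun t => cis t * Cconj (cis t) ^ 1)%C (RtoC 0 + RtoC s * z)%C
                  = circle_int q1 (fun _ => RtoC 1) (RtoC 0 + RtoC s * z)%C).
        { apply CInt_ext. intros t. rewrite Cpow_1_r, cis_conj. reflexivity. }
        rewrite E. Cring.
      * rewrite (mean_value R' q1 q2) by assumption. Cring.
  - unfold Psi. rewrite circle_int_at_0; [ring | apply continuous_conj_cis_pow | apply CInt_conj_cis_pow].
Qed.

Lemma circle_int_conj2 (R' : R) (q q1 q2 q3 : C -> C) (z : C) :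
  C1_disc R' q q1 -> C1_disc R' q1 q2 -> C1_disc R' q2 q3 -> Cmod z < R' ->
  circle_int q (fun t => Cconj (cis t) ^ 2)%C z = (RtoC PI * q2 (RtoC 0) * (z * z))%C.
Proof.
  intros Hq Hq1 Hq2 Hz. apply Ceq_minus.
  set (Psi := fun z => (circle_int q (fun t => Cconj (cis t) ^ 2) z
                        - RtoC PI * q2 (RtoC 0) * (z * z))%C).
  change (Psi z = RtoC 0). transitivity (Psi (RtoC 0)).
  - rewrite <- (Cplus_0_l z). apply (zero_derivative_segment Psi (fun _ => RtoC 0)); [|reflexivity].
    intros s Hs. assert (Hs' := disc_segment R' z s Hz Hs).
    eapply is_Cderive_eq.
    + apply is_Cderive_minus.
      * apply (circle_int_derive R' q q1); [exact Hq | apply continuous_conj_cis_pow | exact Hs'].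
      * apply is_Cderive_mult; [apply is_Cderive_const|].
        apply is_Cderive_mult; apply is_Cderive_id.
    + assert (E : circle_int q1 (fun t => cis t * Cconj (cis t) ^ 2)%C (RtoC 0 + RtoC s * z)%C
                  = circle_int q1 (fun t => Cconj (cis t) ^ 1)%C (RtoC 0 + RtoC s * z)%C).
      { apply CInt_ext. intros t. f_equal.
        transitivity (cis t * Cconj (cis t) * Cconj (cis t) ^ 1)%C; [ring|].
        rewrite cis_conj. ring. }
      cbv beta. rewrite E, (circle_int_conj1 R' q1 q2 q3) by assumption.
      rewrite RtoC_mult. Cring.
  - unfold Psi. rewrite circle_int_at_0; [ring | apply continuous_conj_cis_pow | apply CInt_conj_cis_pow].
Qed.

(** * The Borel-Caratheodory bound for a logarithm *)

Lemma is_derive_ln_sqrt (p q : R -> R) (t dp dq : R) :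
  is_derive p t dp -> is_derive q t dq -> 0 < p t ^ 2 + q t ^ 2 ->
  is_derive (fun s => ln (sqrt (p s ^ 2 + q s ^ 2))) t
    ((p t * dp + q t * dq) / (p t ^ 2 + q t ^ 2)).
Proof.
  intros Hp Hq HN.
  assert (Hs := sqrt_lt_R0 _ HN).
  assert (Hss := sqrt_sqrt _ (Rlt_le _ _ HN)).
  evar_last.
  - auto_derive; [|reflexivity].
    replace (p t * (p t * 1) + q t * (q t * 1)) with (p t ^ 2 + q t ^ 2) by ring.
    repeat split; auto; eexists; eassumption.
  - replace (Derive (fun x => p x) t) with dp by (symmetry; now apply is_derive_unique).
    replace (Derive (fun x => q x) t) with dq by (symmetry; now apply is_derive_unique).
    replace (p t * (p t * 1) + q t * (q t * 1)) with (p t ^ 2 + q t ^ 2) by ring.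
    set (N := p t ^ 2 + q t ^ 2) in *. set (s := sqrt N) in *. clearbody s.
    rewrite <- Hss. field. lra.
Qed.

Lemma is_derive_ln_Cmod (G : R -> C) (t : R) (d : C) :
  is_curve_derive G t d -> G t <> RtoC 0 ->
  is_derive (fun s => ln (Cmod (G s))) t (Re (d / G t)).
Proof.
  intros HG Hnz.
  assert (HN : 0 < Re (G t) ^ 2 + Im (G t) ^ 2).
  { destruct (Rle_lt_dec (Re (G t) ^ 2 + Im (G t) ^ 2) 0) as [H|H]; [exfalso|exact H].
    apply Hnz, C_ext; simpl; nra. }
  assert (D := is_derive_ln_sqrt _ _ t _ _ (is_curve_derive_Re G t d HG)
                 (is_curve_derive_Im G t d HG) HN).
  replace (Re (d / G t)) with
    ((Re (G t) * Re d + Im (G t) * Im d) / (Re (G t) ^ 2 + Im (G t) ^ 2)); [exact D|].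
  destruct (G t) as [x y], d as [u v]. simpl in *. field. lra.
Qed.

Lemma is_curve_derive_RtoC_mult (c : C) (r : R) : is_curve_derive (fun r => RtoC r * c)%C r c.
Proof.
  apply (is_derive_ext (fun s => RtoC 0 + RtoC s * c)%C).
  { intros s. apply Cplus_0_l. }
  apply is_curve_derive_line.
Qed.

Lemma locally_lt_abs (R' r : R) : Rabs r < R' -> locally r (fun u => Rabs u < R').
Proof.
  intros H. assert (Hd : 0 < R' - Rabs r) by lra.
  exists (mkposreal _ Hd). intros u Hu.
  change (Rabs (u - r) < R' - Rabs r) in Hu.
  replace u with (r + (u - r)) by ring.
  eapply Rle_lt_trans; [apply Rabs_triang | lra].
Qed.

Lemma continuity_2d_pt_C (Q : R -> R -> C) (x y : R) :
  continuous (T := prod_UniformSpace R_UniformSpace R_UniformSpace) (U := C_UniformSpace)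
    (fun p => Q (fst p) (snd p)) (x, y) ->
  continuity_2d_pt (fun u v => Re (Q u v)) x y.
Proof.
  intros H. apply continuity_2d_pt_filterlim.
  apply (continuous_Re (T := prod_UniformSpace R_UniformSpace R_UniformSpace)
           (fun p => Q (fst p) (snd p)) (x, y) H).
Qed.

Section LogModulus.
Variables (R' : R) (g g1 q1 : C -> C) (w : R -> R).
Hypothesis Hg : forall z, is_Cderive g z (g1 z).
Hypothesis Hnz : forall z, Cmod z < R' -> g z <> RtoC 0.
Hypothesis Hq : C1_disc R' (fun z => g1 z / g z)%C q1.
Hypothesis Hw : forall t, continuous w t.

Definition log_mean (r : R) : R :=
  RInt (fun t => ln (Cmod (g (RtoC r * cis t))) * w t) 0 (2 * PI).

Let polar (r t : R) : C := (RtoC (w t) * (cis t * (g1 (RtoC r * cis t) / g (RtoC r * cis t))))%C.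

Lemma ln_Cmod_circle_derive (r t : R) :
  Rabs r < R' ->
  is_derive (fun r => ln (Cmod (g (RtoC r * cis t))) * w t) r (Re (polar r t)).
Proof.
  intros Hr.
  assert (Hz : Cmod (RtoC r * cis t) < R') by now rewrite Cmod_mult_cis, Cmod_R.
  assert (H := is_derive_ln_Cmod (fun r => g (RtoC r * cis t)%C) r _
    (is_Cderive_curve g _ r _ _ (Hg _) (is_curve_derive_RtoC_mult (cis t) r)) (Hnz _ Hz)).
  apply (is_derive_ext (fun r => w t * ln (Cmod (g (RtoC r * cis t)%C)))).
  { intros s. apply Rmult_comm. }
  unfold polar. rewrite re_scal_l.
  replace (cis t * (g1 (RtoC r * cis t) / g (RtoC r * cis t)))%C
    with (cis t * g1 (RtoC r * cis t) / g (RtoC r * cis t))%C by (unfold Cdiv; ring).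
  exact (is_derive_scal _ r (w t) _ H).
Qed.

Lemma continuous_polar (r t : R) :
  Rabs r < R' ->
  continuous (T := prod_UniformSpace R_UniformSpace R_UniformSpace) (U := C_UniformSpace)
    (fun p => polar (fst p) (snd p)) (r, t).
Proof.
  intros Hr. unfold polar.
  apply continuous_C_mult.
  - apply continuous_RtoC.
    apply (continuous_comp (U := prod_UniformSpace R_UniformSpace R_UniformSpace)
             (V := R_UniformSpace) snd w); [apply continuous_snd | apply Hw].
  - apply continuous_C_mult; [apply continuous_cis, continuous_snd|].
    apply (continuous_comp (U := prod_UniformSpace R_UniformSpace R_UniformSpace)
             (V := C_UniformSpace) (W := C_UniformSpace)
             (fun p => RtoC (fst p) * cis (snd p))%C (fun z => g1 z / g z)%C).
    + apply continuous_C_mult; [apply continuous_RtoC, continuous_fst | apply continuous_cis, continuous_snd].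
    + eapply C1_disc_continuous; [exact Hq|]. simpl. now rewrite Cmod_mult_cis, Cmod_R.
Qed.

Lemma continuous_ln_Cmod_circle (r t : R) :
  Rabs r < R' -> continuous (fun t => ln (Cmod (g (RtoC r * cis t)))) t.
Proof.
  intros Hr.
  assert (Hz : Cmod (RtoC r * cis t) < R') by now rewrite Cmod_mult_cis, Cmod_R.
  apply (ex_derive_continuous (K := R_AbsRing) (V := R_NormedModule)). eexists.
  apply (is_derive_ln_Cmod (fun t => g (RtoC r * cis t)%C)).
  - apply (is_Cderive_curve g (fun t => RtoC r * cis t)%C); [apply Hg|].
    apply (is_curve_derive_mult (fun _ => RtoC r) cis); [|apply is_curve_derive_cis].
    apply (is_derive_const (K := R_AbsRing) (V := C_R_NormedModule)).
  - apply Hnz, Hz.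
Qed.

Lemma ex_RInt_log_mean (r : R) :
  Rabs r < R' -> ex_RInt (fun t => ln (Cmod (g (RtoC r * cis t))) * w t) 0 (2 * PI).
Proof.
  intros Hr. apply ex_RInt_cont. intros t.
  apply (continuous_mult (K := R_AbsRing)); [now apply continuous_ln_Cmod_circle | apply Hw].
Qed.

Lemma log_mean_derive (r : R) :
  Rabs r < R' ->
  is_derive log_mean r
    (Re (circle_int (fun z => g1 z / g z)%C (fun t => cis t * RtoC (w t))%C (RtoC r))).
Proof.
  intros Hr.
  assert (Hloc := locally_lt_abs R' r Hr).
  replace (Re (circle_int (fun z => g1 z / g z)%C (fun t => cis t * RtoC (w t))%C (RtoC r)))
    with (RInt (fun t => Derive (fun u => ln (Cmod (g (RtoC u * cis t))) * w t) r) 0 (2 * PI)).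
  - apply is_derive_RInt_param.
    + eapply filter_imp; [|exact Hloc]. intros u Hu t _. eexists.
      now apply ln_Cmod_circle_derive.
    + intros t _.
      apply (continuity_2d_pt_ext_loc (fun u v => Re (polar u v))).
      * destruct Hloc as [d Hd]. exists d. intros u v Hu _.
        symmetry. apply is_derive_unique, ln_Cmod_circle_derive, Hd, Hu.
      * apply continuity_2d_pt_C, continuous_polar, Hr.
    + eapply filter_imp; [|exact Hloc]. intros u Hu. now apply ex_RInt_log_mean.
  - unfold circle_int. rewrite Re_CInt.
    + apply RInt_ext. intros t _.
      etransitivity; [apply is_derive_unique, ln_Cmod_circle_derive, Hr|].
      unfold polar. f_equal. ring.
    + intros t.
      apply (continuous_circle (fun z => g1 z / g z)%C (fun t => cis t * RtoC (w t))%C).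
      * eapply C1_disc_continuous; [exact Hq|]. now rewrite Cmod_mult_cis, Cmod_R.
      * apply continuous_C_mult; [apply continuous_cis, continuous_id|].
        apply continuous_RtoC, Hw.
Qed.
End LogModulus.

(** [Re (cis t ^ n) = cos (n t)]. *)
Definition cosn (n : nat) (t : R) : R := Re (cis t ^ n).

Lemma continuous_cosn (n : nat) (t : R) : continuous (cosn n) t.
Proof. apply (continuous_Re (fun t => cis t ^ n)%C), continuous_cis_pow. Qed.

Lemma cosn_bound (n : nat) (t : R) : -1 <= cosn n t <= 1.
Proof.
  apply Rabs_le_between. eapply Rle_trans; [apply re_le_Cmod|].
  rewrite Cmod_pow, Cmod_cis, pow1. lra.
Qed.

Lemma RInt_cosn (n : nat) : RInt (cosn (S n)) 0 (2 * PI) = 0.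
Proof.
  unfold cosn. rewrite <- (Re_CInt (fun t => cis t ^ S n)%C) by (apply continuous_cis_pow).
  now rewrite CInt_cis_pow.
Qed.

Lemma RtoC_cosn (n : nat) (t : R) :
  RtoC (cosn n t) = ((cis t ^ n + Cconj (cis t) ^ n) / RtoC 2)%C.
Proof. unfold cosn. rewrite re_alt, Cpow_conj. reflexivity. Qed.

(** [cis t] times the cosine of order [n + 1] is half the sum of frequencies
    [n + 2] and [- n]; the positive one integrates to 0. *)
Lemma circle_int_cosn (R' : R) (q q1 : C -> C) (n : nat) (z : C) :
  C1_disc R' q q1 -> Cmod z < R' ->
  circle_int q (fun t => cis t * RtoC (cosn (S n) t))%C z =
  (/ RtoC 2 * circle_int q (fun t => Cconj (cis t) ^ n)%C z)%C.
Proof.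
  intros Hq Hz.
  assert (Hc : forall t, continuous (T := C_UniformSpace) (U := C_UniformSpace) q (z * cis t)%C)
    by (intros t; eapply C1_disc_continuous; [exact Hq | now rewrite Cmod_mult_cis]).
  transitivity (/ RtoC 2 * (circle_int q (fun t => cis t ^ S (S n))%C z
                  + circle_int q (fun t => Cconj (cis t) ^ n)%C z))%C.
  - unfold circle_int. rewrite <- CInt_plus, <- CInt_scal.
    + apply CInt_ext. intros t. rewrite RtoC_cosn.
      transitivity (q (z * cis t) / RtoC 2 *
        (cis t ^ S (S n) + (cis t * Cconj (cis t)) * Cconj (cis t) ^ n))%C;
        [simpl; unfold Cdiv; ring|].
      rewrite cis_conj. unfold Cdiv. ring.
    + intros t. apply continuous_C_plus;
        (apply continuous_circle; [apply Hc|]);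
        [apply continuous_cis_pow | apply continuous_conj_cis_pow].
    + intros t. apply continuous_circle; [apply Hc | apply continuous_cis_pow].
    + intros t. apply continuous_circle; [apply Hc | apply continuous_conj_cis_pow].
  - rewrite (circle_int_cis_pow R' q q1) by assumption. ring.
Qed.

Lemma log_mean_at_0 (g : C -> C) (w : R -> R) :
  (forall t, continuous w t) ->
  log_mean g w 0 = ln (Cmod (g (RtoC 0))) * RInt w 0 (2 * PI).
Proof.
  intros Hw. unfold log_mean.
  rewrite (RInt_ext _ (fun t => ln (Cmod (g (RtoC 0))) * w t + 0 * w t))
    by (intros t _; rewrite Cmult_0_l, Rmult_0_l, Rplus_0_r; reflexivity).
  rewrite RInt_linear_combination by assumption. ring.
Qed.

Lemma eq_from_equal_derivatives (F G dF : R -> R) (a b : R) :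
  a < b -> (forall t, a <= t <= b -> is_derive F t (dF t)) ->
  (forall t, a <= t <= b -> is_derive G t (dF t)) -> F a = G a -> F b = G b.
Proof.
  intros Hab HF HG Ha.
  assert (H : F a - G a = F b - G b).
  { apply (eq_is_derive (V := R_NormedModule) (fun t => F t - G t) a b); [|exact Hab].
    intros t Ht.
    replace (@zero R_NormedModule) with (minus (dF t) (dF t) : R_NormedModule)
      by apply (minus_eq_zero (G := R_AbelianGroup)).
    apply (is_derive_minus (V := R_NormedModule)); auto. }
  lra.
Qed.

Section BorelCaratheodory.
Variables (R' : R) (g g1 q1 q2 q3 : C -> C).
Hypothesis Hg : forall z, is_Cderive g z (g1 z).
Hypothesis Hnz : forall z, Cmod z < R' -> g z <> RtoC 0.
Hypothesis Hq : C1_disc R' (fun z => g1 z / g z)%C q1.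
Hypothesis Hq1 : C1_disc R' q1 q2.
Hypothesis Hq2 : C1_disc R' q2 q3.

(** This and the next two means are found by integrating their derivatives in
    the radius from 0, where they are explicit. *)
Lemma log_mean_0 (r : R) : 0 < r < R' -> log_mean g (cosn 0) r = 2 * PI * ln (Cmod (g (RtoC 0))).
Proof.
  intros Hr.
  transitivity (log_mean g (cosn 0) 0).
  - symmetry. apply (eq_from_equal_derivatives (fun _ => log_mean g (cosn 0) 0) (log_mean g (cosn 0)) (fun _ => 0) 0 r).
    + lra.
    + intros t _. apply (is_derive_const (K := R_AbsRing) (V := R_NormedModule)).
    + intros t Ht. assert (Ht' : Rabs t < R') by (rewrite Rabs_pos_eq; lra).
      replace 0 with (Re (circle_int (fun z => g1 z / g z)%C
                           (fun t => cis t * RtoC (cosn 0 t))%C (RtoC t))).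
      { apply (log_mean_derive R' g g1 q1); auto. apply continuous_cosn. }
      replace (circle_int (fun z => g1 z / g z)%C (fun t => cis t * RtoC (cosn 0 t))%C (RtoC t))
        with (RtoC 0); [reflexivity|].
      symmetry. transitivity (circle_int (fun z => g1 z / g z)%C (fun t => cis t ^ 1)%C (RtoC t)).
      * apply CInt_ext. intros s. unfold cosn. simpl. ring.
      * apply (circle_int_cis_pow R' _ q1); [exact Hq | now rewrite Cmod_R].
    + reflexivity.
  - rewrite log_mean_at_0 by apply continuous_cosn.
    replace (RInt (cosn 0) 0 (2 * PI)) with (2 * PI); [ring|].
    unfold cosn; simpl. rewrite RInt_const. unfold scal; simpl. unfold mult; simpl. ring.
Qed.

Lemma log_mean_2 (r : R) :
  0 < r < R' -> log_mean g (cosn 2) r = PI / 2 * Re (q1 (RtoC 0)) * r ^ 2.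
Proof.
  intros Hr.
  apply (eq_from_equal_derivatives (log_mean g (cosn 2)) (fun r => PI / 2 * Re (q1 (RtoC 0)) * r ^ 2)
           (fun t => PI * Re (q1 (RtoC 0)) * t) 0 r).
  - lra.
  - intros t Ht. assert (Ht' : Rabs t < R') by (rewrite Rabs_pos_eq; lra).
    replace (PI * Re (q1 (RtoC 0)) * t) with (Re (circle_int (fun z => g1 z / g z)%C
                           (fun t => cis t * RtoC (cosn 2 t))%C (RtoC t))).
    { apply (log_mean_derive R' g g1 q1); auto. apply continuous_cosn. }
    rewrite (circle_int_cosn R' _ q1), (circle_int_conj1 R' _ q1 q2); try assumption;
      try (now rewrite Cmod_R).
    transitivity (Re (RtoC (PI * t) * q1 (RtoC 0))%C).
    + f_equal. rewrite !RtoC_mult. field.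
    + rewrite re_scal_l. ring.
  - intros t _. auto_derive; [auto|]. simpl. field.
  - rewrite log_mean_at_0, RInt_cosn by apply continuous_cosn. ring.
Qed.

Lemma log_mean_3 (r : R) :
  0 < r < R' -> log_mean g (cosn 3) r = PI / 6 * Re (q2 (RtoC 0)) * r ^ 3.
Proof.
  intros Hr.
  apply (eq_from_equal_derivatives (log_mean g (cosn 3)) (fun r => PI / 6 * Re (q2 (RtoC 0)) * r ^ 3)
           (fun t => PI / 2 * Re (q2 (RtoC 0)) * t ^ 2) 0 r).
  - lra.
  - intros t Ht. assert (Ht' : Rabs t < R') by (rewrite Rabs_pos_eq; lra).
    replace (PI / 2 * Re (q2 (RtoC 0)) * t ^ 2) with (Re (circle_int (fun z => g1 z / g z)%C
                           (fun t => cis t * RtoC (cosn 3 t))%C (RtoC t))).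
    { apply (log_mean_derive R' g g1 q1); auto. apply continuous_cosn. }
    rewrite (circle_int_cosn R' _ q1), (circle_int_conj2 R' _ q1 q2 q3); try assumption;
      try (now rewrite Cmod_R).
    transitivity (Re (RtoC (/ 2 * PI * (t * t)) * q2 (RtoC 0))%C).
    + f_equal. rewrite !RtoC_mult, RtoC_inv by lra. field.
    + rewrite re_scal_l. field.
  - intros t _. auto_derive; [auto|]. simpl. field.
  - rewrite log_mean_at_0, RInt_cosn by apply continuous_cosn. ring.
Qed.

(** Integrating [(A - ln|g|) (1 +- cos (n t)) >= 0] over the circle. *)
Lemma log_mean_bound (n : nat) (A r : R) :
  0 < r < R' -> (forall z, Cmod z = r -> ln (Cmod (g z)) <= A) ->
  Rabs (log_mean g (cosn (S n)) r) <= 2 * PI * (A - ln (Cmod (g (RtoC 0)))).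
Proof.
  intros Hr HA. assert (Hr' : Rabs r < R') by (rewrite Rabs_pos_eq; lra).
  assert (HPI := PI_RGT_0).
  assert (Hpos : forall s, -1 <= s <= 1 ->
    0 <= 2 * PI * (A - ln (Cmod (g (RtoC 0)))) - s * log_mean g (cosn (S n)) r).
  { intros s Hs.
    set (U := fun t => ln (Cmod (g (RtoC r * cis t)))).
    assert (HU : forall t, continuous U t)
      by (intros t; eapply continuous_ln_Cmod_circle; eauto).
    assert (HUw : forall k t, continuous (fun t => U t * cosn k t) t)
      by (intros k t; apply (continuous_mult (K := R_AbsRing)); [apply HU | apply continuous_cosn]).
    assert (E : RInt (fun t => (A - U t) * (1 + s * cosn (S n) t)) 0 (2 * PI)
      = 2 * PI * (A - ln (Cmod (g (RtoC 0)))) - s * log_mean g (cosn (S n)) r).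
    { rewrite (RInt_ext _ (fun t => 1 * (A * 1 + (A * s) * cosn (S n) t) +
         (-1) * (1 * (U t * cosn 0 t) + s * (U t * cosn (S n) t)))).
      - assert (C1 : forall t, continuous (fun t => A * 1 + (A * s) * cosn (S n) t) t).
        { intros t. apply (continuous_plus (V := R_NormedModule) (fun _ => A * 1)).
          - apply continuous_const.
          - apply (continuous_scal_r (V := R_NormedModule) (A * s)), continuous_cosn. }
        assert (C2 : forall t, continuous (fun t => 1 * (U t * cosn 0 t) + s * (U t * cosn (S n) t)) t).
        { intros t. apply (continuous_plus (V := R_NormedModule) (fun t => 1 * (U t * cosn 0 t)));
            apply (continuous_scal_r (V := R_NormedModule)), HUw. }
        rewrite RInt_linear_combination by assumption.
        rewrite (RInt_linear_combination (fun _ => 1)), RInt_linear_combination; try apply HUw;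
          [| intros; apply continuous_const | apply continuous_cosn].
        rewrite RInt_cosn.
        fold (log_mean g (cosn 0) r) (log_mean g (cosn (S n)) r).
        change (RInt (fun t => U t * cosn 0 t) 0 (2 * PI)) with (log_mean g (cosn 0) r).
        change (RInt (fun t => U t * cosn (S n) t) 0 (2 * PI)) with (log_mean g (cosn (S n)) r).
        rewrite log_mean_0 by exact Hr.
        rewrite RInt_const. unfold scal; simpl. unfold mult; simpl. ring.
      - intros t _. change (cosn 0 t) with 1.
        match goal with |- ?a = ?b => change (@eq R a b) end. ring. }
    rewrite <- E. apply RInt_ge_0.
    - lra.
    - apply ex_RInt_cont. intros t. apply (continuous_mult (K := R_AbsRing)).
      + apply (continuous_minus (V := R_NormedModule) (fun _ => A)); [apply continuous_const | apply HU].
      + apply (continuous_plus (V := R_NormedModule) (fun _ => 1)); [apply continuous_const|].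
        apply (continuous_scal_r (V := R_NormedModule) s), continuous_cosn.
    - intros t _. assert (Hc := cosn_bound (S n) t).
      assert (HUA : U t <= A).
      { apply HA. rewrite Cmod_mult_cis, Cmod_R. apply Rabs_pos_eq; lra. }
      apply Rmult_le_pos; [lra | nra]. }
  apply Rabs_le. generalize (Hpos 1 ltac:(lra)) (Hpos (-1) ltac:(lra)). lra.
Qed.
End BorelCaratheodory.

(** For a zero-free function this is the Borel--Caratheodory bound on the
    Taylor coefficients of order two and three of its logarithm. *)
Theorem log_jet_bound (rho R' A : R) (g g1 g2 g3 : C -> C) :
  (forall z, is_Cderive g z (g1 z)) -> (forall z, is_Cderive g1 z (g2 z)) ->
  (forall z, is_Cderive g2 z (g3 z)) -> entire g3 ->
  0 < rho < R' -> (forall z, Cmod z < R' -> g z <> RtoC 0) ->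
  (forall z, Cmod z = rho -> ln (Cmod (g z)) <= A) ->
  Rabs (Re (log_jet2 (g (RtoC 0)) (g1 (RtoC 0)) (g2 (RtoC 0)))) * rho ^ 2
    <= 4 * (A - ln (Cmod (g (RtoC 0)))) /\   Rabs (Re (log_jet3 (g (RtoC 0)) (g1 (RtoC 0)) (g2 (RtoC 0)) (g3 (RtoC 0)))) * rho ^ 3
    <= 12 * (A - ln (Cmod (g (RtoC 0)))).
Proof.
  intros H0 H1 H2 E3 Hr Hnz HA. assert (HPI := PI_RGT_0).
  destruct (log_derivative_jet R' g g1 g2 g3 H0 H1 H2 E3 Hnz)
    as (q1 & q2 & q3 & Hq & Hq1 & Hq2 & <- & <-).
  assert (B1 := log_mean_bound R' g g1 q1 H0 Hnz Hq 1 A rho Hr HA).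
  assert (B2 := log_mean_bound R' g g1 q1 H0 Hnz Hq 2 A rho Hr HA).
  rewrite (log_mean_2 R' g g1 q1 q2) in B1 by assumption.
  rewrite (log_mean_3 R' g g1 q1 q2 q3) in B2 by assumption.
  rewrite !Rabs_mult in B1, B2.
  rewrite (Rabs_pos_eq (rho ^ 2)) in B1 by (apply pow_le; lra).
  rewrite (Rabs_pos_eq (rho ^ 3)) in B2 by (apply pow_le; lra).
  rewrite (Rabs_pos_eq (PI / 2)) in B1 by lra.
  rewrite (Rabs_pos_eq (PI / 6)) in B2 by lra.
  split; (apply (Rmult_le_reg_l PI); [lra|]); lra.
Qed.

(** * Removing real zeros by reflection in a circle *)

Definition entire_jet (f f1 f2 f3 : C -> C) : Prop :=
  (forall z, is_Cderive f z (f1 z)) /\ (forall z, is_Cderive f1 z (f2 z)) /\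
  (forall z, is_Cderive f2 z (f3 z)) /\ entire f3.

Lemma entire_jet_exists (f : C -> C) : entire f -> exists f1 f2 f3, entire_jet f f1 f2 f3.
Proof.
  intros E. destruct (entire_derivative f E) as [f1 [H1 E1]].
  destruct (entire_derivative f1 E1) as [f2 [H2 E2]].
  destruct (entire_derivative f2 E2) as [f3 [H3 E3]].
  exists f1, f2, f3. exact (conj H1 (conj H2 (conj H3 E3))).
Qed.

Lemma is_Cderive_unique (f g : C -> C) (z a b : C) :
  (forall z, f z = g z) -> is_Cderive f z a -> is_Cderive g z b -> a = b.
Proof.
  intros E Hf Hg. rewrite <- (is_C_derive_unique f z a Hf).
  apply is_C_derive_unique.
  apply (is_derive_ext (K := C_AbsRing) (V := C_NormedModule) g f); [|exact Hg].
  intros t. symmetry. apply E.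
Qed.

Lemma entire_jet_unique (f f1 f2 f3 g g1 g2 g3 : C -> C) :
  entire_jet f f1 f2 f3 -> entire_jet g g1 g2 g3 -> (forall z, f z = g z) ->
  (forall z, f1 z = g1 z) /\ (forall z, f2 z = g2 z) /\ (forall z, f3 z = g3 z).
Proof.
  intros (F1 & F2 & F3 & _) (G1 & G2 & G3 & _) E.
  assert (E1 : forall z, f1 z = g1 z)
    by (intros z; exact (is_Cderive_unique f g z _ _ E (F1 z) (G1 z))).
  assert (E2 : forall z, f2 z = g2 z)
    by (intros z; exact (is_Cderive_unique f1 g1 z _ _ E1 (F2 z) (G2 z))).
  assert (E3 : forall z, f3 z = g3 z)
    by (intros z; exact (is_Cderive_unique f2 g2 z _ _ E2 (F3 z) (G3 z))).
  auto.
Qed.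

Lemma entire_jet_linear_factor (p r : C) (f f1 f2 f3 : C -> C) :
  entire_jet f f1 f2 f3 ->
  entire_jet (fun z => (p + r * z) * f z)%C
    (fun z => r * f z + (p + r * z) * f1 z)%C
    (fun z => RtoC 2 * r * f1 z + (p + r * z) * f2 z)%C
    (fun z => RtoC 3 * r * f2 z + (p + r * z) * f3 z)%C.
Proof.
  intros (F1 & F2 & F3 & E3).
  assert (D : forall z, is_Cderive f z (f1 z) /\ is_Cderive f1 z (f2 z) /\
     is_Cderive f2 z (f3 z) /\ exists l, is_Cderive f3 z l)
    by (intros z; exact (conj (F1 z) (conj (F2 z) (conj (F3 z) (E3 z))))).
  refine (conj _ (conj _ (conj _ _))); intros z; destruct (D z) as (D1 & D2 & D3 & l & D4).
  - eapply is_Cderive_eq; [Cderivation | Cring].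
  - eapply is_Cderive_eq; [Cderivation | Cring].
  - eapply is_Cderive_eq; [Cderivation | Cring].
  - eexists. Cderivation.
Qed.

Lemma log_jet2_linear_factor (p r f0 f1 f2 : C) :
  p <> RtoC 0 -> f0 <> RtoC 0 ->
  log_jet2 (p * f0) (r * f0 + p * f1) (RtoC 2 * r * f1 + p * f2) =
  (log_jet2 f0 f1 f2 - r / p * (r / p))%C.
Proof. intros Hp Hf. unfold log_jet2. field. auto. Qed.

Lemma log_jet3_linear_factor (p r f0 f1 f2 f3 : C) :
  p <> RtoC 0 -> f0 <> RtoC 0 ->
  log_jet3 (p * f0) (r * f0 + p * f1) (RtoC 2 * r * f1 + p * f2) (RtoC 3 * r * f2 + p * f3) =
  (log_jet3 f0 f1 f2 f3 + RtoC 2 * (r / p * (r / p * (r / p))))%C.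
Proof. intros Hp Hf. unfold log_jet3. field. auto. Qed.

(** Reflecting a zero [a] in the circle of radius [rho] changes the second
    derivative of the logarithm at 0 by this weight, and half the third one by
    [/ a ^ 3 - a ^ 3 / rho ^ 6]. *)
Lemma zero_weight_nonneg (rho a : R) :
  0 < rho -> a <> 0 -> Rabs a < rho -> 0 <= / a ^ 2 - a ^ 2 / rho ^ 4.
Proof.
  intros Hr Ha Har.
  assert (Ha2 : 0 < a ^ 2) by (generalize (pow2_gt_0 a Ha); lra).
  assert (Hlt : a ^ 2 <= rho ^ 2).
  { rewrite <- pow2_abs. apply pow_incr. split; [apply Rabs_pos | lra]. }
  assert (Hr4 : 0 < rho ^ 4) by (apply pow_lt; lra).
  replace (/ a ^ 2 - a ^ 2 / rho ^ 4) with ((rho ^ 2 - a ^ 2) * (rho ^ 2 + a ^ 2) / (a ^ 2 * rho ^ 4))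
    by (field; lra).
  apply Rdiv_le_0_compat; [|nra]. apply Rmult_le_pos; nra.
Qed.

(** As [rho] tends to infinity the second inequality becomes
    [1 / a^3 <= (1 / a^2)^(3/2)].  With [a = rho y] and the lower bound
    [(1 - y^4) / (rho y)] for the square root it reduces to
    [1 - y^6 <= (1 - y^4) (1 - y^4 + 2 y)]. *)
Lemma zero_weight_bound_pos (rho a : R) :
  0 < a < rho ->
  0 <= / a ^ 3 - a ^ 3 / rho ^ 6 <=
  (/ a ^ 2 - a ^ 2 / rho ^ 4) * (sqrt (/ a ^ 2 - a ^ 2 / rho ^ 4) + 2 / rho).
Proof.
  intros Ha.
  assert (Hw := zero_weight_nonneg rho a ltac:(lra) ltac:(lra) ltac:(rewrite Rabs_pos_eq; lra)).
  set (y := a / rho).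
  assert (Hy : 0 < y < 1).
  { unfold y; split; [apply Rdiv_lt_0_compat; lra|].
    apply (Rmult_lt_reg_r rho); [lra|]. unfold Rdiv. rewrite Rmult_assoc, Rinv_l; lra. }
  assert (Ea : a = rho * y) by (unfold y; field; lra).
  clearbody y. subst a.
  assert (Hy2 : 0 < y ^ 2 < 1) by nra.
  assert (Hy4 : 0 < y ^ 4 < 1) by nra.
  assert (Hy6 : 0 < y ^ 6 < 1) by (replace (y ^ 6) with (y ^ 2 * y ^ 4) by ring; nra).
  assert (Hr3 : 0 < (rho * y) ^ 3) by (apply pow_lt; nra).
  set (w := / (rho * y) ^ 2 - (rho * y) ^ 2 / rho ^ 4) in *.
  assert (Ew : w = (1 - y ^ 4) / (rho * y) ^ 2) by (unfold w; field; lra).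
  assert (Ev : / (rho * y) ^ 3 - (rho * y) ^ 3 / rho ^ 6 = (1 - y ^ 6) / (rho * y) ^ 3)
    by (field; lra).
  rewrite Ev. split; [apply Rdiv_le_0_compat; lra|].
  assert (Hs : (1 - y ^ 4) / (rho * y) <= sqrt w).
  { rewrite <- (sqrt_pow2 ((1 - y ^ 4) / (rho * y))) by (apply Rdiv_le_0_compat; nra).
    apply sqrt_le_1_alt. rewrite Ew.
    replace (((1 - y ^ 4) / (rho * y)) ^ 2) with ((1 - y ^ 4) ^ 2 / (rho * y) ^ 2) by (field; lra).
    apply Rmult_le_compat_r; [apply Rlt_le, Rinv_0_lt_compat, pow_lt; nra | nra]. }
  apply Rle_trans with (w * ((1 - y ^ 4) / (rho * y) + 2 / rho)).
  - rewrite Ew.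
    replace ((1 - y ^ 4) / (rho * y) ^ 2 * ((1 - y ^ 4) / (rho * y) + 2 / rho))
      with ((1 - y ^ 4) * (1 - y ^ 4 + 2 * y) / (rho * y) ^ 3) by (field; lra).
    apply Rmult_le_compat_r; [apply Rlt_le, Rinv_0_lt_compat, Hr3|].
    assert (H : 0 <= (1 - y ^ 2) * (2 * y + 2 * y ^ 3 - 2 * y ^ 4 - y ^ 6)).
    { apply Rmult_le_pos; [lra|].
      replace (y ^ 6) with (y ^ 4 * y ^ 2) by ring.
      replace (y ^ 4) with (y ^ 3 * y) by ring.
      assert (0 < y ^ 3) by (apply pow_lt; lra).
      assert (y ^ 3 <= y) by (replace (y ^ 3) with (y * y ^ 2) by ring; nra).
      assert (y ^ 3 * y <= y ^ 3) by nra.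
      assert (y ^ 3 * y * y ^ 2 <= y ^ 3 * y) by nra. nra. }
    nra.
  - apply Rmult_le_compat_l; lra.
Qed.

Lemma zero_weight_bound (rho a : R) :
  a <> 0 -> Rabs a < rho ->
  Rabs (/ a ^ 3 - a ^ 3 / rho ^ 6) <=
  (/ a ^ 2 - a ^ 2 / rho ^ 4) * (sqrt (/ a ^ 2 - a ^ 2 / rho ^ 4) + 2 / rho).
Proof.
  intros Ha Har. destruct (Rle_lt_dec 0 a) as [H|H].
  - rewrite (Rabs_pos_eq a) in Har by lra.
    assert (B := zero_weight_bound_pos rho a ltac:(lra)).
    rewrite Rabs_pos_eq; lra.
  - rewrite (Rabs_left a) in Har by lra.
    assert (B := zero_weight_bound_pos rho (- a) ltac:(lra)).
    replace ((- a) ^ 2) with (a ^ 2) in B by ring.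
    replace (/ (- a) ^ 3 - (- a) ^ 3 / rho ^ 6) with (- (/ a ^ 3 - a ^ 3 / rho ^ 6)) in B
      by (field; split; lra).
    rewrite Rabs_left1; lra.
Qed.

(** This is how sums over several zeros inherit the bound for one: the factor
    [sqrt W + k] increases with [W]. *)
Lemma weight_bound_add (k W w V v : R) :
  0 <= W -> 0 <= w -> Rabs V <= W * (sqrt W + k) -> Rabs v <= w * (sqrt w + k) ->
  Rabs (V + v) <= (W + w) * (sqrt (W + w) + k).
Proof.
  intros HW Hw HV Hv.
  assert (S1 : sqrt W <= sqrt (W + w)) by (apply sqrt_le_1_alt; lra).
  assert (S2 : sqrt w <= sqrt (W + w)) by (apply sqrt_le_1_alt; lra).
  eapply Rle_trans; [apply Rabs_triang|]. nra.
Qed.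

Lemma Cmod_reflected_factor (rho x : R) (z : C) :
  0 < rho -> Cmod z = rho ->
  Cmod (RtoC rho + RtoC (- x / rho) * z) = Cmod (RtoC (- x) + RtoC 1 * z).
Proof.
  intros Hr Hz. assert (Hz2 := Cmod2_alt z). rewrite Hz in Hz2.
  destruct z as [u v]. unfold Re, Im in Hz2; simpl fst in Hz2; simpl snd in Hz2.
  unfold Cmod. f_equal. simpl.
  assert (E : u ^ 2 = rho ^ 2 - v ^ 2) by lra.
  field_simplify; [|lra]. apply (Rmult_eq_reg_r (rho ^ 2)); [|nra].
  field_simplify; [|lra]. rewrite E. ring [E].
Qed.

(** Each zero [x] is removed by replacing the factor [z - x] by its
    reflection [(rho^2 - x z) / rho], which has the same modulus on the circle
    [|z| = rho] and no zero in the disc: this is division by a Blaschke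
    factor. *)
Lemma jet_bound_zeros (rho A : R) (l : list R) :
  0 < rho -> forall (R' : R) (f f1 f2 f3 : C -> C),
  entire_jet f f1 f2 f3 -> rho < R' -> f (RtoC 0) <> RtoC 0 ->
  (forall z, Cmod z < R' -> f z = RtoC 0 ->
     f1 z <> RtoC 0 /\ exists x, In x l /\ z = RtoC x /\ Rabs x < rho) ->
  (forall z, Cmod z = rho -> ln (Cmod (f z)) <= A) ->
  exists W V, 0 <= W /\ Rabs V <= W * (sqrt W + 2 / rho) /\
    Rabs (Re (log_jet2 (f (RtoC 0)) (f1 (RtoC 0)) (f2 (RtoC 0))) + W) * rho ^ 2
      <= 4 * (A - ln (Cmod (f (RtoC 0)))) /\
    Rabs (Re (log_jet3 (f (RtoC 0)) (f1 (RtoC 0)) (f2 (RtoC 0)) (f3 (RtoC 0))) + 2 * V) * rho ^ 3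
      <= 12 * (A - ln (Cmod (f (RtoC 0)))).
Proof.
  intros Hr. induction l as [|x l IH]; intros R' f f1 f2 f3 Hjet HR' Hf0 Hz HA.
  { destruct Hjet as (F1 & F2 & F3 & E3).
    destruct (log_jet_bound rho R' A f f1 f2 f3 F1 F2 F3 E3) as [B1 B2]; [lra | | exact HA |].
    { intros z Hzd Hz0. destruct (Hz z Hzd Hz0) as (_ & y & [] & _). }
    exists 0, 0. rewrite Rplus_0_r, Rmult_0_r, Rplus_0_r, Rmult_0_l, Rabs_R0.
    repeat split; auto; lra. }
  destruct (classic (f (RtoC x) = RtoC 0 /\ Rabs x < R')) as [[Hx HxR]|Hno].
  2:{ apply (IH R' f f1 f2 f3 Hjet HR' Hf0); [|exact HA].
      intros z Hzd Hz0. destruct (Hz z Hzd Hz0) as (Hs & y & [Hy|Hy] & Hzy & Hyr).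
      - exfalso. apply Hno. subst y. rewrite <- Hzy. split; [exact Hz0 | lra].
      - split; [exact Hs|]. exists y. auto. }
  assert (Hxr : Rabs x < rho).
  { destruct (Hz (RtoC x)) as (_ & y & _ & Hxy & Hyr); [now rewrite Cmod_R | exact Hx |].
    apply RtoC_inj in Hxy. now subst y. }
  assert (Hx0 : x <> 0) by (intros E; apply Hf0; now rewrite E in Hx).
  assert (Hax : 0 < Rabs x) by now apply Rabs_pos_lt.
  assert (Ef : entire f) by (intros z; eexists; exact (proj1 Hjet z)).
  destruct (entire_division f (RtoC x) Ef Hx) as [h [Eh Hfh]].
  destruct (entire_jet_exists h Eh) as (h1 & h2 & h3 & Hh).
  set (p := RtoC (- x)) in *. set (r := RtoC (- x / rho)).
  assert (Hfh' : forall z, f z = ((p + RtoC 1 * z) * h z)%C).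
  { intros z. rewrite Hfh. unfold p. rewrite RtoC_opp. ring. }
  assert (Hjf := entire_jet_linear_factor p (RtoC 1) h h1 h2 h3 Hh).
  destruct (entire_jet_unique _ _ _ _ _ _ _ _ Hjet Hjf Hfh') as (U1 & U2 & U3).
  assert (Hjg := entire_jet_linear_factor (RtoC rho) r h h1 h2 h3 Hh).
  assert (Hrho0 : RtoC rho <> RtoC 0) by (intros E; apply RtoC_inj in E; lra).
  assert (Hp0 : p <> RtoC 0) by (intros E; apply RtoC_inj in E; lra).
  assert (Hf00 : f (RtoC 0) = (p * h (RtoC 0))%C) by (rewrite Hfh'; ring).
  assert (Hh0 : h (RtoC 0) <> RtoC 0) by (intros E; apply Hf0; rewrite Hf00, E; ring).
  set (R2 := Rmin R' (rho ^ 2 / Rabs x)).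
  assert (HR2 : rho < R2).
  { apply Rmin_glb_lt; [exact HR'|]. apply (Rmult_lt_reg_r (Rabs x)); [exact Hax|].
    unfold Rdiv. rewrite Rmult_assoc, Rinv_l; nra. }
  assert (Hfac : forall z, Cmod z < R2 -> (RtoC rho + r * z)%C <> RtoC 0).
  { intros z Hzd E.
    assert (E2 : (RtoC x * z)%C = RtoC (rho * rho)).
    { apply Ceq_minus. transitivity (- RtoC rho * (RtoC rho + r * z))%C; [|rewrite E; ring].
      unfold r. rewrite RtoC_div, RtoC_opp, RtoC_mult by lra. field. exact Hrho0. }
    apply (f_equal Cmod) in E2. rewrite Cmod_mult, !Cmod_R in E2.
    rewrite (Rabs_pos_eq (rho * rho)) in E2 by nra.
    assert (Hz2 : Cmod z < rho ^ 2 / Rabs x) by (eapply Rlt_le_trans; [exact Hzd | apply Rmin_r]).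
    apply (Rmult_lt_compat_l (Rabs x)) in Hz2; [|exact Hax].
    replace (Rabs x * (rho ^ 2 / Rabs x)) with (rho * rho) in Hz2 by (field; lra). lra. }
  destruct (IH R2 _ _ _ _ Hjg HR2) as (W & V & HW & HV & B1 & B2).
  - rewrite Cmult_0_r, Cplus_0_r. now apply Cmult_neq_0.
  - intros z Hzd Hg0.
    assert (Hhz : h z = RtoC 0).
    { destruct (Ceq_dec (h z) (RtoC 0)) as [E|E]; [exact E|].
      exfalso. revert Hg0. apply Cmult_neq_0; auto. }
    assert (Hfz : f z = RtoC 0) by (rewrite Hfh', Hhz; ring).
    assert (HzR' : Cmod z < R') by (eapply Rlt_le_trans; [exact Hzd | apply Rmin_l]).
    destruct (Hz z HzR' Hfz) as (Hs & y & Hy & Hzy & Hyr).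
    rewrite U1, Hhz in Hs.
    assert (Hh1z : h1 z <> RtoC 0) by (intros E; apply Hs; rewrite E; ring).
    split.
    + rewrite Hhz. replace (r * RtoC 0 + (RtoC rho + r * z) * h1 z)%C
        with ((RtoC rho + r * z) * h1 z)%C by ring.
      apply Cmult_neq_0; auto.
    + exists y. split; [|auto]. destruct Hy as [Hy|Hy]; [|exact Hy].
      exfalso. apply Hs. rewrite Hzy, <- Hy. unfold p. rewrite RtoC_opp. ring.
  - intros z Hzr. rewrite Cmod_mult. unfold r. rewrite Cmod_reflected_factor by assumption.
    fold p. rewrite <- Cmod_mult, <- Hfh'. auto.
  - set (w := / x ^ 2 - x ^ 2 / rho ^ 4). set (v := / x ^ 3 - x ^ 3 / rho ^ 6).
    assert (Hw := zero_weight_nonneg rho x Hr Hx0 Hxr). fold w in Hw.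
    assert (Hv := zero_weight_bound rho x Hx0 Hxr). fold w v in Hv.
    exists (W + w), (V + v).
    split; [lra|]. split; [now apply weight_bound_add|].
    rewrite Cmult_0_r, Cplus_0_r in B1, B2.
    rewrite log_jet2_linear_factor in B1 by assumption.
    rewrite log_jet3_linear_factor in B2 by assumption.
    assert (Hln : ln (Cmod (f (RtoC 0))) <= ln (Cmod (RtoC rho * h (RtoC 0)))).
    { apply ln_le; [now apply Cmod_gt_0|]. rewrite Hf00, !Cmod_mult. unfold p. rewrite !Cmod_R.
      apply Rmult_le_compat_r; [apply Cmod_ge_0|]. rewrite Rabs_Ropp, (Rabs_pos_eq rho) by lra. lra. }
    rewrite Hf00 in *. rewrite U1, U2, U3, Cmult_0_r, Cplus_0_r.
    rewrite log_jet2_linear_factor, log_jet3_linear_factor by assumption.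
    assert (Er : (r / RtoC rho)%C = RtoC (- x / rho / rho)) by (unfold r; now rewrite <- RtoC_div by lra).
    assert (Ep : (RtoC 1 / p)%C = RtoC (1 / - x)) by (unfold p; now rewrite <- RtoC_div by lra).
    rewrite Er in B1, B2. rewrite Ep.
    set (L2 := log_jet2 (h (RtoC 0)) (h1 (RtoC 0)) (h2 (RtoC 0))) in *.
    set (L3 := log_jet3 (h (RtoC 0)) (h1 (RtoC 0)) (h2 (RtoC 0)) (h3 (RtoC 0))) in *.
    unfold Cminus in *. rewrite re_plus, re_opp, <- RtoC_mult, re_RtoC in *.
    rewrite re_plus, <- !RtoC_mult, re_RtoC in *.
    split.
    + replace (Re L2 + - (1 / - x * (1 / - x)) + (W + w))
        with (Re L2 + - (- x / rho / rho * (- x / rho / rho)) + W)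
        by (unfold w; field; lra). lra.
    + replace (Re L3 + 2 * (1 / - x * (1 / - x * (1 / - x))) + 2 * (V + v))
        with (Re L3 + 2 * (- x / rho / rho * (- x / rho / rho * (- x / rho / rho))) + 2 * V)
        by (unfold v; field; lra). lra.
Qed.

(** * Power sums over real zeros *)

(** Simple zeros are isolated, so compactness leaves finitely many. *)
Lemma real_zeros_finite (f f1 : C -> C) (B : R) :
  (forall z, is_Cderive f z (f1 z)) ->
  (forall x : R, f (RtoC x) = RtoC 0 -> f1 (RtoC x) <> RtoC 0) ->
  exists l, forall x, Rabs x <= B -> f (RtoC x) = RtoC 0 -> In x l.
Proof.
  intros Hf Hs.
  assert (Hiso : forall t : R, exists d : posreal, forall x, Rabs (x - t) < d ->
            f (RtoC x) = RtoC 0 -> x = t).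
  { intros t. destruct (Ceq_dec (f (RtoC t)) (RtoC 0)) as [E|E].
    - assert (Hm : 0 < Cmod (f1 (RtoC t))) by now apply Cmod_gt_0, Hs.
      assert (D := Hf (RtoC t)). rewrite is_Cderive_eps in D.
      destruct (D (Cmod (f1 (RtoC t)) / 2) ltac:(lra)) as [d [Hd H]].
      exists (mkposreal d Hd). intros x Hx Hfx. simpl in Hx.
      specialize (H (RtoC x)). rewrite <- RtoC_minus, Cmod_R in H.
      specialize (H Hx). rewrite Hfx, E in H.
      replace (RtoC 0 - RtoC 0 - RtoC (x - t) * f1 (RtoC t))%C
        with (- (RtoC (x - t) * f1 (RtoC t)))%C in H by ring.
      rewrite Cmod_opp, Cmod_mult, Cmod_R in H.
      destruct (Req_dec x t) as [Hxt|Hxt]; [exact Hxt|].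
      assert (0 < Rabs (x - t)) by (apply Rabs_pos_lt; lra). nra.
    - assert (Hm : 0 < Cmod (f (RtoC t))) by now apply Cmod_gt_0.
      assert (Cf := is_Cderive_continuous_pt f _ _ (Hf (RtoC t))).
      rewrite continuous_Cmod in Cf. specialize (Cf _ Hm).
      apply (proj1 (locally_Cmod (RtoC t) _)) in Cf. destruct Cf as [d [Hd H]].
      exists (mkposreal d Hd). intros x Hx Hfx. simpl in Hx. exfalso.
      specialize (H (RtoC x)). rewrite <- RtoC_minus, Cmod_R in H. specialize (H Hx).
      rewrite Hfx in H. replace (RtoC 0 - f (RtoC t))%C with (- f (RtoC t))%C in H by ring.
      rewrite Cmod_opp in H. lra. }
  set (delta := fun t : R => proj1_sig (constructive_indefinite_description _ (Hiso t))).
  assert (Hdelta : forall t x, Rabs (x - t) < delta t -> f (RtoC x) = RtoC 0 -> x = t)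
    by (intros t; exact (proj2_sig (constructive_indefinite_description _ (Hiso t)))).
  destruct (NNPP _ (compactness_list 1 (- B, tt) (B, tt) (fun t => delta (fst t)))) as [l Hl].
  exists (map fst l). intros x Hx Hfx.
  destruct (Hl (x, tt)) as ([t []] & Ht & _ & Hclose).
  { simpl. split; [|exact I]. apply Rabs_le_between. exact Hx. }
  simpl in Hclose. destruct Hclose as [Hclose _].
  rewrite (Hdelta t x Hclose Hfx). apply (in_map fst l (t, tt) Ht).
Qed.

(** Provides a circle with no zero on it or slightly outside. *)
Lemma gap_between_radii (l : list R) (c d : R) :
  c < d -> exists r R', c < r < R' /\ R' <= d /\ forall x, In x l -> Rabs x < r \/ R' <= Rabs x.
Proof.
  intros Hcd. induction l as [|x l (r & R' & Hr & Hd & H)].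
  - exists ((c + d) / 2), d. split; [lra|]. split; [lra|]. intros x [].
  - destruct (Rlt_le_dec (Rabs x) r) as [H1|H1].
    { exists r, R'. repeat split; try lra. intros y [<-|Hy]; auto. }
    destruct (Rlt_le_dec (Rabs x) R') as [H2|H2].
    + exists ((Rabs x + R') / 2), R'. repeat split; try lra.
      intros y [<-|Hy]; [left; lra|]. destruct (H y Hy); [left; lra | right; lra].
    + exists r, R'. repeat split; try lra. intros y [<-|Hy]; auto.
Qed.

(** Implied by an order less than 2, and stable under translation and division
    by [z]. *)
Definition minimal_type_2 (f : C -> C) : Prop :=
  forall e, 0 < e -> exists r0, forall z, r0 <= Cmod z -> Cmod (f z) <= exp (e * Cmod z ^ 2).

Lemma ln_Cmod_le (z : C) (a : R) : 0 <= a -> Cmod z <= exp a -> ln (Cmod z) <= a.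
Proof.
  intros Ha Hz. destruct (Rle_lt_or_eq_dec 0 (Cmod z) (Cmod_ge_0 z)) as [H|H].
  - rewrite <- (ln_exp a). now apply ln_le.
  - (* by convention [ln 0 = 0] *)
    rewrite <- H. unfold ln. destruct (Rlt_dec 0 0) as [H0|_]; [exfalso; lra | exact Ha].
Qed.

(** The bounds of order [rho^2] for [ln |f|] are divided by [rho^2] and
    [rho^3]; below order 2 the constant in front is as small as desired, so a
    large circle leaves only the contributions [W] and [V] of the zeros. *)
Lemma jet_approximation (f f1 f2 f3 : C -> C) (eta : R) :
  entire_jet f f1 f2 f3 -> f (RtoC 0) <> RtoC 0 -> minimal_type_2 f ->
  (forall z, f z = RtoC 0 -> Im z = 0 /\ f1 z <> RtoC 0) -> 0 < eta ->
  exists W V, 0 <= W /\ Rabs V <= W * (sqrt W + eta) /\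
    Rabs (Re (log_jet2 (f (RtoC 0)) (f1 (RtoC 0)) (f2 (RtoC 0))) + W) <= eta /\
    Rabs (Re (log_jet3 (f (RtoC 0)) (f1 (RtoC 0)) (f2 (RtoC 0)) (f3 (RtoC 0))) / 2 + V) <= eta.
Proof.
  intros Hjet Hf0 Hgr Hz Heta.
  destruct (Hgr (eta / 16) ltac:(lra)) as [r0 Hr0].
  set (K := Rabs (ln (Cmod (f (RtoC 0))))).
  assert (HK : 0 <= K) by apply Rabs_pos.
  (* radii above [c] make [2 / rho] and both error terms at most [eta] *)
  set (c := Rabs r0 + 1 + 2 / eta + 16 * K / eta).
  assert (Hc1 : 0 < 2 / eta) by (apply Rdiv_lt_0_compat; lra).
  assert (Hc2 : 0 <= 16 * K / eta) by (apply Rdiv_le_0_compat; lra).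
  assert (Hc3 := Rabs_pos r0). assert (Hc4 := Rle_abs r0).
  destruct (real_zeros_finite f f1 (c + 1)) as [l Hl].
  { apply Hjet. }
  { intros x Hx. apply Hz, Hx. }
  destruct (gap_between_radii l c (c + 1) ltac:(lra)) as (rho & R' & Hrho & HR' & Hgap).
  assert (Hrho1 : 1 < rho) by (unfold c in Hrho; lra).
  destruct (jet_bound_zeros rho (eta / 16 * rho ^ 2) l ltac:(lra) R' f f1 f2 f3 Hjet)
    as (W & V & HW & HV & B1 & B2); [lra | exact Hf0 | | |].
  - intros z Hzd Hz0. destruct (Hz z Hz0) as [Him Hs]. split; [exact Hs|].
    assert (Ez : z = RtoC (Re z)) by (apply C_ext; [reflexivity | exact Him]).
    exists (Re z). rewrite Ez in Hzd, Hz0. rewrite Cmod_R in Hzd.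
    assert (Hin : In (Re z) l) by (apply Hl; [lra | exact Hz0]).
    split; [exact Hin|]. split; [exact Ez|]. destruct (Hgap _ Hin); [assumption | lra].
  - intros z Hzr. apply ln_Cmod_le; [generalize (pow2_ge_0 rho); nra|].
    rewrite <- Hzr. apply Hr0. rewrite Hzr. unfold c in Hrho; lra.
  - assert (Hln : - ln (Cmod (f (RtoC 0))) <= K)
      by (unfold K; rewrite <- Rabs_Ropp; apply Rle_abs).
    assert (HrK : 16 * K <= eta * rho).
    { assert (H : 16 * K / eta <= rho) by (unfold c in Hrho; lra).
      apply (Rmult_le_compat_r eta) in H; [|lra].
      replace (16 * K / eta * eta) with (16 * K) in H by (field; lra). lra. }
    assert (Hr2 : rho <= rho ^ 2) by nra.
    assert (Hr3 : rho ^ 2 <= rho ^ 3) by nra.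
    assert (H2r : 2 / rho <= eta).
    { assert (H : 2 / eta <= rho) by (unfold c in Hrho; lra).
      apply (Rmult_le_compat_r eta) in H; [|lra].
      replace (2 / eta * eta) with 2 in H by (field; lra).
      apply (Rmult_le_reg_r rho); [lra|].
      replace (2 / rho * rho) with 2 by (field; lra). lra. }
    exists W, V. split; [exact HW|]. split; [|split].
    + eapply Rle_trans; [exact HV|]. apply Rmult_le_compat_l; lra.
    + apply (Rmult_le_reg_r (rho ^ 2)); [lra|]. nra.
    + match goal with |- Rabs (?L / 2 + V) <= eta =>
        replace (L / 2 + V) with ((L + 2 * V) * / 2) by field end.
      rewrite Rabs_mult, (Rabs_pos_eq (/ 2)) by lra.
      apply (Rmult_le_reg_r (rho ^ 3)); [lra|]. nra.
Qed.

(** For a function of order less than 2 with zeros [a_k], [S2] is the sum of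
    the [1 / a_k^2] and [S3] is minus the sum of the [1 / a_k^3]. *)
Theorem real_zeros_jet_inequalities (f f1 f2 f3 : C -> C) :
  entire_jet f f1 f2 f3 -> f (RtoC 0) <> RtoC 0 -> minimal_type_2 f ->
  (forall z, f z = RtoC 0 -> Im z = 0 /\ f1 z <> RtoC 0) ->
  let S2 := - Re (log_jet2 (f (RtoC 0)) (f1 (RtoC 0)) (f2 (RtoC 0))) in
  let S3 := Re (log_jet3 (f (RtoC 0)) (f1 (RtoC 0)) (f2 (RtoC 0)) (f3 (RtoC 0))) / 2 in
  0 <= S2 /\ Rabs S3 <= S2 * sqrt S2.
Proof.
  intros Hjet Hf0 Hgr Hz S2 S3.
  assert (Happ : forall eta, 0 < eta -> exists W V, 0 <= W /\
     Rabs V <= W * (sqrt W + eta) /\ Rabs (S2 - W) <= eta /\ Rabs (S3 + V) <= eta).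
  { intros eta Heta.
    destruct (jet_approximation f f1 f2 f3 eta Hjet Hf0 Hgr Hz Heta) as (W & V & H1 & H2 & H3 & H4).
    exists W, V. repeat split; auto.
    unfold S2. rewrite <- Rabs_Ropp.
    match goal with |- Rabs (- (- ?L - W)) <= _ => replace (- (- L - W)) with (L + W) by ring end.
    exact H3. }
  assert (HS2 : 0 <= S2).
  { apply le_epsilon. intros e He. destruct (Happ e He) as (W & V & H1 & _ & H3 & _).
    apply Rabs_le_between in H3. lra. }
  split; [exact HS2|].
  assert (Hlim : forall eta, 0 < eta ->
            Rabs S3 <= eta + (S2 + eta) * (sqrt (S2 + eta) + eta)).
  { intros eta Heta. destruct (Happ eta Heta) as (W & V & H1 & H2 & H3 & H4).
    apply Rabs_le_between in H3.
    assert (HWs : sqrt W <= sqrt (S2 + eta)) by (apply sqrt_le_1_alt; lra).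
    assert (Hs0 := sqrt_pos W).
    replace S3 with ((S3 + V) + - V) by ring.
    eapply Rle_trans; [apply Rabs_triang|]. rewrite Rabs_Ropp.
    assert (W * (sqrt W + eta) <= (S2 + eta) * (sqrt (S2 + eta) + eta)); [|lra].
    apply Rmult_le_compat; lra. }
  (* the bound is continuous in [eta], and at [eta = 0] it is the claim *)
  assert (Hcont : continuous (fun eta => eta + (S2 + eta) * (sqrt (S2 + eta) + eta)) 0).
  { assert (Hsq : continuous (fun eta => sqrt (S2 + eta)) 0).
    { apply (continuous_comp (fun eta => S2 + eta) sqrt).
      - apply (continuous_plus (V := R_NormedModule) (fun _ => S2) (fun eta => eta));
          [apply continuous_const | apply continuous_id].
      - apply continuous_sqrt. }
    apply (continuous_plus (V := R_NormedModule) (fun eta => eta)); [apply continuous_id|].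
    apply (continuous_mult (K := R_AbsRing)).
    - apply (continuous_plus (V := R_NormedModule) (fun _ => S2) (fun eta => eta));
        [apply continuous_const | apply continuous_id].
    - apply (continuous_plus (V := R_NormedModule) (fun eta => sqrt (S2 + eta)) (fun eta => eta));
        [exact Hsq | apply continuous_id]. }
  apply le_epsilon. intros e He.
  destruct (Hcont _ (locally_ball _ (mkposreal e He))) as [d Hd].
  assert (Hd2 : 0 < d / 2 < d) by (generalize (cond_pos d); lra).
  specialize (Hd (d / 2)). specialize (Hlim (d / 2) ltac:(lra)).
  assert (Hb : ball (M := R_UniformSpace) 0 d (d / 2)).
  { change (Rabs (d / 2 - 0) < d). rewrite Rabs_pos_eq; lra. }
  specialize (Hd Hb).
  change (Rabs (d / 2 + (S2 + d / 2) * (sqrt (S2 + d / 2) + d / 2)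
     - (0 + (S2 + 0) * (sqrt (S2 + 0) + 0))) < e) in Hd.
  rewrite !Rplus_0_r, Rplus_0_l in Hd.
  apply Rabs_lt_between in Hd. lra.
Qed.

(** * From growth on the plane to derivatives on the axis *)

Lemma growth_minimal_type_2 (f : C -> C) :
  Rbar_lt (growth_order f) (Finite 2) -> minimal_type_2 f.
Proof.
  intros Hlt.
  assert (Hk : exists k, growth_exponent f k /\ k < 2).
  { apply NNPP. intros Hno.
    destruct (Glb_Rbar_correct (growth_exponent f)) as [_ Hglb].
    apply (Rbar_lt_not_le _ _ Hlt). apply Hglb. intros k Hk. simpl.
    destruct (Rle_lt_dec 2 k) as [H|H]; [exact H|]. exfalso. apply Hno. now exists k. }
  destruct Hk as (k & (_ & r0 & Hr0 & Hf) & Hk2).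
  intros e He. exists (r0 + 1 + exp (ln e / (k - 2))).
  intros z Hz. assert (Hexp := exp_pos (ln e / (k - 2))).
  apply Rle_trans with (exp (Rpower (Cmod z) k)); [apply Rlt_le, Hf; lra|].
  set (r := Cmod z) in *.
  assert (Hexpm : forall u v, u <= v -> exp u <= exp v).
  { intros u v [H|H]; [now apply Rlt_le, exp_increasing | rewrite H; lra]. }
  apply Hexpm.
  replace (Rpower r k) with (Rpower r (k - 2) * r ^ 2).
  2:{ rewrite <- Rpower_pow by lra. rewrite <- Rpower_plus. f_equal. simpl. ring. }
  apply Rmult_le_compat_r; [apply pow2_ge_0|].
  unfold Rpower. rewrite <- (exp_ln e He). apply Hexpm.
  assert (Hln : ln e / (k - 2) <= ln r).
  { rewrite <- (ln_exp (ln e / (k - 2))). apply ln_le; lra. }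
  apply (Rmult_le_compat_neg_l (k - 2)) in Hln; [|lra].
  replace ((k - 2) * (ln e / (k - 2))) with (ln e) in Hln by (field; lra). exact Hln.
Qed.

Lemma minimal_type_2_quotient (f h : C -> C) (c : C) :
  minimal_type_2 f -> (forall z, f (c + z)%C = (z * h z)%C) -> minimal_type_2 h.
Proof.
  intros Hf Hh e He. destruct (Hf (e / 4) ltac:(lra)) as [r0 Hr0].
  assert (Hc := Cmod_ge_0 c). assert (Hr := Rabs_pos r0). assert (Hr' := Rle_abs r0).
  exists (1 + 2 * Cmod c + 2 * Rabs r0). intros z Hz.
  assert (H1 : Cmod z <= Cmod (c + z) + Cmod c).
  { replace z with ((c + z) + - c)%C at 1 by ring.
    eapply Rle_trans; [apply Cmod_triangle|]. rewrite Cmod_opp. lra. }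
  assert (H2 := Cmod_triangle c z).
  apply Rle_trans with (Cmod (f (c + z)%C)).
  - rewrite Hh, Cmod_mult. generalize (Cmod_ge_0 (h z)); nra.
  - eapply Rle_trans; [apply Hr0; lra|].
    assert (Hle : e / 4 * Cmod (c + z) ^ 2 <= e * Cmod z ^ 2).
    { assert (Cmod (c + z) ^ 2 <= (2 * Cmod z) ^ 2)
        by (apply pow_incr; split; [apply Cmod_ge_0 | lra]). nra. }
    destruct Hle as [H|H]; [now apply Rlt_le, exp_increasing | rewrite H; lra].
Qed.

Definition real_on_axis (f : C -> C) : Prop := forall x : R, Im (f (RtoC x)) = 0.

Lemma is_curve_derive_axis (f f' : C -> C) (x : R) :
  (forall z, is_Cderive f z (f' z)) ->
  is_curve_derive (fun x => f (RtoC x)) x (f' (RtoC x)).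
Proof.
  intros Hf. apply (is_curve_derive_eq _ _ (RtoC 1 * f' (RtoC x))%C); [|apply Cmult_1_l].
  apply (is_Cderive_curve f RtoC x); [apply Hf|].
  apply is_curve_derive_pair; auto_derive; auto.
Qed.

Lemma derivative_real_on_axis (f f' : C -> C) :
  (forall z, is_Cderive f z (f' z)) -> real_on_axis f -> real_on_axis f'.
Proof.
  intros Hf Hr x.
  assert (D := is_curve_derive_Im _ x _ (is_curve_derive_axis f f' x Hf)).
  rewrite <- (is_derive_unique _ _ _ D).
  rewrite (Derive_ext _ (fun _ => 0)) by (intros t; apply Hr).
  apply Derive_const.
Qed.

Lemma restr_R_derive (f f' : C -> C) (x : R) :
  (forall z, is_Cderive f z (f' z)) -> is_derive (restr_R f) x (restr_R f' x).
Proof. intros Hf. apply (is_curve_derive_Re _ x _ (is_curve_derive_axis f f' x Hf)). Qed.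

Lemma real_on_axis_value (f : C -> C) (x : R) :
  real_on_axis f -> f (RtoC x) = RtoC (restr_R f x).
Proof. intros H. apply C_ext; [reflexivity | apply H]. Qed.

(** With [y_k] the [k]-th derivative of [f] at a zero [xi], and
    [h z = f (xi + z) / z]: minus the second derivative of [log h] at 0, and
    half the third one. *)
Definition power_sum2 (y1 y2 y3 : R) : R := (y2 / (2 * y1)) ^ 2 - y3 / (3 * y1).
Definition power_sum3 (y1 y2 y3 y4 : R) : R :=
  (y4 / (4 * y1) - 3 * (y2 / (2 * y1) * (y3 / (3 * y1))) + 2 * (y2 / (2 * y1)) ^ 3) / 2.

(** The [k]-th derivative of [z h z] at 0 is [k] times the previous derivative
    of [h]. *)
Lemma power_sum_inequalities (f f1 f2 f3 f4 : C -> C) (xi : R) :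
  (forall z, is_Cderive f z (f1 z)) -> entire_jet f1 f2 f3 f4 ->
  real_on_axis f -> minimal_type_2 f -> only_real_simple_zeros f ->
  f (RtoC xi) = RtoC 0 ->
  let y1 := restr_R f1 xi in let y2 := restr_R f2 xi in
  let y3 := restr_R f3 xi in let y4 := restr_R f4 xi in
  y1 <> 0 /\ 0 <= power_sum2 y1 y2 y3 /\
  Rabs (power_sum3 y1 y2 y3 y4) <= power_sum2 y1 y2 y3 * sqrt (power_sum2 y1 y2 y3).
Proof.
  intros F1 (F2 & F3 & F4 & E4) Hreal Hgr Hz Hxi y1 y2 y3 y4.
  assert (R1 := derivative_real_on_axis _ _ F1 Hreal).
  assert (R2 := derivative_real_on_axis _ _ F2 R1).
  assert (R3 := derivative_real_on_axis _ _ F3 R2).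
  assert (R4 := derivative_real_on_axis _ _ F4 R3).
  assert (V1 := real_on_axis_value f1 xi R1). assert (V2 := real_on_axis_value f2 xi R2).
  assert (V3 := real_on_axis_value f3 xi R3). assert (V4 := real_on_axis_value f4 xi R4).
  fold y1 in V1. fold y2 in V2. fold y3 in V3. fold y4 in V4.
  set (c := RtoC xi) in *.
  assert (Hshift : forall F F' : C -> C, (forall z, is_Cderive F z (F' z)) ->
     forall z, is_Cderive (fun z => F (c + z)%C) z (F' (c + z)%C)).
  { intros F F' HF z. eapply is_Cderive_eq.
    - apply (is_Cderive_comp F (fun z => c + z)%C); [apply HF|].
      apply is_Cderive_plus; [apply is_Cderive_const | apply is_Cderive_id].
    - Cring. }
  assert (Hns : forall z, f z = RtoC 0 -> f1 z <> RtoC 0).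
  { intros z H0 H1. apply (proj2 (Hz z H0)). rewrite <- H1. apply F1. }
  assert (E3 : entire f3) by (intros z; eexists; apply F4).
  assert (Ef : entire (fun z => f (c + z)%C)) by (intros z; eexists; now apply Hshift).
  destruct (entire_division (fun z => f (c + z)%C) (RtoC 0) Ef) as [h [Eh Hh]].
  { now rewrite Cplus_0_r. }
  destruct (entire_jet_exists h Eh) as (h1 & h2 & h3 & Hjh).
  assert (Hh' : forall z, f (c + z)%C = (z * h z)%C) by (intros z; rewrite Hh; ring).
  assert (Hjf : entire_jet (fun z => f (c + z)%C) (fun z => f1 (c + z)%C)
                  (fun z => f2 (c + z)%C) (fun z => f3 (c + z)%C)).
  { refine (conj (Hshift _ _ F1) (conj (Hshift _ _ F2) (conj (Hshift _ _ F3) _))).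
    intros z. eexists. exact (Hshift _ _ F4 z). }
  assert (Hjz := entire_jet_linear_factor (RtoC 0) (RtoC 1) h h1 h2 h3 Hjh).
  destruct (entire_jet_unique _ _ _ _ _ _ _ _ Hjf Hjz) as (U1 & U2 & U3).
  { intros z. rewrite Hh'. ring. }
  assert (Hh0 : h (RtoC 0) = RtoC y1).
  { rewrite <- V1, <- (Cplus_0_r c), U1. ring. }
  assert (Hh1 : h1 (RtoC 0) = RtoC (y2 / 2)).
  { rewrite RtoC_div, <- V2, <- (Cplus_0_r c), U2 by lra. field. }
  assert (Hh2 : h2 (RtoC 0) = RtoC (y3 / 3)).
  { rewrite RtoC_div, <- V3, <- (Cplus_0_r c), U3 by lra. field. }
  assert (Hh3 : h3 (RtoC 0) = RtoC (y4 / 4)).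
  { rewrite RtoC_div, <- V4 by lra.
    assert (D : f4 (c + RtoC 0)%C = (RtoC 4 * h3 (RtoC 0))%C).
    { assert (D1 := Hjh). destruct D1 as (_ & _ & D3 & E).
      assert (D3' := D3 (RtoC 0)). destruct (E (RtoC 0)) as [l D4].
      apply (is_Cderive_unique _ _ (RtoC 0) _ _ U3); [now apply Hshift|].
      eapply is_Cderive_eq; [Cderivation | Cring]. }
    rewrite Cplus_0_r in D. rewrite D. field. }
  assert (Hy1 : y1 <> 0).
  { intros E. apply (Hns c Hxi). rewrite V1, E. reflexivity. }
  split; [exact Hy1|].
  assert (Hh00 : h (RtoC 0) <> RtoC 0) by (rewrite Hh0; intros E; apply RtoC_inj in E; auto).
  assert (Hzeros : forall z, h z = RtoC 0 -> Im z = 0 /\ h1 z <> RtoC 0).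
  { intros z Hhz. assert (Hfz : f (c + z)%C = RtoC 0) by (rewrite Hh', Hhz; ring).
    split.
    - assert (I := proj1 (Hz _ Hfz)). rewrite im_plus in I. unfold c in I.
      rewrite im_RtoC in I. lra.
    - intros E. apply (Hns _ Hfz). rewrite U1, Hhz, E. ring. }
  destruct (real_zeros_jet_inequalities h h1 h2 h3 Hjh Hh00
              (minimal_type_2_quotient f h c Hgr Hh') Hzeros) as [B2 B3].
  rewrite Hh0, Hh1, Hh2 in B2, B3. rewrite Hh3 in B3.
  assert (E2 : - Re (log_jet2 (RtoC y1) (RtoC (y2 / 2)) (RtoC (y3 / 3))) = power_sum2 y1 y2 y3).
  { unfold log_jet2. rewrite <- !RtoC_div, <- RtoC_mult, <- RtoC_minus, re_RtoC by assumption.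
    unfold power_sum2. field. exact Hy1. }
  assert (E3' : Re (log_jet3 (RtoC y1) (RtoC (y2 / 2)) (RtoC (y3 / 3)) (RtoC (y4 / 4))) / 2
               = power_sum3 y1 y2 y3 y4).
  { unfold log_jet3.
    rewrite <- !RtoC_div, <- !RtoC_mult, <- RtoC_minus, <- RtoC_plus, re_RtoC by assumption.
    unfold power_sum3. field. exact Hy1. }
  rewrite E2 in B2, B3. rewrite E3' in B3. split; assumption.
Qed.

(** * Nonnegative quartic polynomials *)

(** With [m = |mu|] and [t = |lam| sqrt S2] the worst case
    of the last term gives [m^4 + 6 m^2 t^2 - 16 m t^3 + 9 t^4
    = (m - t)^2 (m^2 + 2 m t + 9 t^2)]. *)
Lemma power_sum_quartic_nonneg (S2 S3 mu lam : R) :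
  0 <= S2 -> Rabs S3 <= S2 * sqrt S2 ->
  0 <= mu ^ 4 + 6 * mu ^ 2 * lam ^ 2 * S2 + 9 * lam ^ 4 * S2 ^ 2 + 16 * mu * lam ^ 3 * S3.
Proof.
  intros H2 H3. set (s := sqrt S2) in *.
  assert (Hs : 0 <= s) by apply sqrt_pos.
  assert (Es : S2 = s ^ 2) by (unfold s; rewrite pow2_sqrt; auto). clearbody s. subst S2.
  assert (Hm := Rabs_pos mu). assert (Hl := Rabs_pos lam).
  assert (Hk : - (16 * Rabs mu * Rabs lam ^ 3 * (s ^ 2 * s)) <= 16 * mu * lam ^ 3 * S3).
  { apply Rle_trans with (- Rabs (16 * mu * lam ^ 3 * S3));
      [| generalize (Rle_abs (- (16 * mu * lam ^ 3 * S3))); rewrite Rabs_Ropp; lra].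
    apply Ropp_le_contravar. rewrite !Rabs_mult, <- RPow_abs, (Rabs_pos_eq 16) by lra.
    apply Rmult_le_compat_l; [|exact H3].
    apply Rmult_le_pos; [lra | apply pow_le; exact Hl]. }
  replace (mu ^ 4) with ((Rabs mu ^ 2) ^ 2) by (rewrite pow2_abs; ring).
  rewrite <- (pow2_abs mu).
  replace (lam ^ 4) with ((Rabs lam ^ 2) ^ 2) by (rewrite pow2_abs; ring).
  rewrite <- (pow2_abs lam).
  set (m := Rabs mu) in *. set (L := Rabs lam) in *.
  assert (Hp : 0 <= (m - L * s) ^ 2 * (m ^ 2 + 2 * m * (L * s) + 9 * (L * s) ^ 2)).
  { assert (0 <= L * s) by now apply Rmult_le_pos.
    apply Rmult_le_pos; [apply pow2_ge_0|].
    assert (0 <= m * (L * s)) by now apply Rmult_le_pos.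
    generalize (pow2_ge_0 m) (pow2_ge_0 (L * s)). lra. }
  lra.
Qed.

Lemma minimum_of_coercive (P : R -> R) (M : R) :
  (forall x, continuity_pt P x) -> 0 <= M -> (forall x, M <= Rabs x -> P 0 <= P x) ->
  exists m, is_minimum P m.
Proof.
  intros HP HM Hfar.
  destruct (continuity_ab_min P (- M) M) as [x0 [Hmin Hx0]]; [lra | auto |].
  exists (P x0). split; [now exists x0|]. intros x.
  destruct (Rle_lt_dec M (Rabs x)) as [H|H].
  - apply Rle_trans with (P 0); [apply Hmin; lra | auto].
  - apply Hmin. apply Rabs_lt_between in H. lra.
Qed.

(** Nonnegativity forces the leading coefficient to be positive and of even
    degree, unless the polynomial is constant; a polynomial of this kind grows
    at infinity and attains its minimum. *)
Lemma quartic_minimum (c0 c1 c2 c3 c4 : R) (P : R -> R) :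
  (forall x, P x = c4 * x ^ 4 + c3 * x ^ 3 + c2 * x ^ 2 + c1 * x + c0) ->
  (forall x, 0 <= P x) -> exists m, is_minimum P m.
Proof.
  intros EP Hpos.
  assert (Hcont : forall x, continuity_pt P x).
  { intros x. apply (continuity_pt_ext (fun x => c4 * x ^ 4 + c3 * x ^ 3 + c2 * x ^ 2 + c1 * x + c0)).
    - intros t. symmetry. apply EP.
    - apply continuity_pt_filterlim.
      apply (ex_derive_continuous (K := R_AbsRing) (V := R_NormedModule)
        (fun x : R => c4 * x ^ 4 + c3 * x ^ 3 + c2 * x ^ 2 + c1 * x + c0) x). auto_derive. auto. }
  assert (P0 : P 0 = c0) by (rewrite EP; ring).
  assert (A0 := Rabs_pos c0). assert (A1 := Rabs_pos c1). assert (A2 := Rabs_pos c2).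
  assert (A3 := Rabs_pos c3).
  assert (B : forall c y, - (Rabs c * Rabs y) <= c * y <= Rabs c * Rabs y).
  { intros c y. rewrite <- Rabs_mult. apply Rabs_le_between. lra. }
  assert (Hpow : forall x, 1 <= Rabs x -> Rabs x <= Rabs x ^ 2 <= Rabs x ^ 3).
  { intros x Hx. nra. }
  assert (HT : forall s k, 0 <= s -> 0 < k -> s < k * (1 + s / k)).
  { intros s k Hs Hk. replace (k * (1 + s / k)) with (k + s) by (field; lra). lra. }
  assert (HT1 : forall s k, 0 <= s -> 0 < k -> 1 <= 1 + s / k).
  { intros s k Hs Hk. assert (0 <= s / k) by (apply Rdiv_le_0_compat; lra). lra. }
  assert (Hcub : forall x, 1 <= Rabs x ->
     Rabs (c3 * x ^ 3 + c2 * x ^ 2 + c1 * x) <= (Rabs c3 + Rabs c2 + Rabs c1) * Rabs x ^ 3).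
  { intros x Hx. specialize (Hpow x Hx).
    eapply Rle_trans; [apply Rabs_triang|].
    eapply Rle_trans; [apply Rplus_le_compat_r, Rabs_triang|].
    rewrite !Rabs_mult, <- !RPow_abs. nra. }
  assert (Hquad : forall x, 1 <= Rabs x ->
     Rabs (c2 * x ^ 2 + c1 * x) <= (Rabs c2 + Rabs c1) * Rabs x ^ 2).
  { intros x Hx. specialize (Hpow x Hx).
    eapply Rle_trans; [apply Rabs_triang|].
    rewrite !Rabs_mult, <- !RPow_abs. nra. }
  destruct (Rtotal_order c4 0) as [H4|[H4|H4]].
  - exfalso.
    set (s := Rabs c3 + Rabs c2 + Rabs c1 + Rabs c0) in *.
    set (T := 1 + s / - c4).
    assert (T1 := HT1 s (- c4) ltac:(unfold s; lra) ltac:(lra)). fold T in T1.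
    assert (T2 := HT s (- c4) ltac:(unfold s; lra) ltac:(lra)). fold T in T2.
    assert (AT : Rabs T = T) by (apply Rabs_pos_eq; lra).
    specialize (Hpow T ltac:(lra)). specialize (Hcub T ltac:(lra)).
    rewrite AT in Hpow, Hcub. apply Rabs_le_between in Hcub.
    specialize (Hpos T). rewrite EP in Hpos.
    assert (Hc0 := Rle_abs c0).
    assert (c0 <= Rabs c0 * T ^ 3) by nra.
    assert (0 < T ^ 3) by lra.
    assert (c4 * T ^ 4 = - (- c4 * T) * T ^ 3) by ring.
    unfold s in T2. nra.
  - destruct (Req_dec c3 0) as [H3|H3].
    + destruct (Rtotal_order c2 0) as [H2|[H2|H2]].
      * exfalso.
        set (s := Rabs c1 + Rabs c0) in *. set (T := 1 + s / - c2).
        assert (T1 := HT1 s (- c2) ltac:(unfold s; lra) ltac:(lra)). fold T in T1.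
        assert (T2 := HT s (- c2) ltac:(unfold s; lra) ltac:(lra)). fold T in T2.
        specialize (Hpos T). rewrite EP, H4, H3 in Hpos.
        assert (Hc0 := Rle_abs c0). assert (Hc1 := Rle_abs c1).
        assert (c0 <= Rabs c0 * T) by nra. assert (c1 * T <= Rabs c1 * T) by nra.
        assert (c2 * T ^ 2 = - (- c2 * T) * T) by ring.
        unfold s in T2. nra.
      * destruct (Req_dec c1 0) as [H1|H1].
        { exists c0. split; [now exists 0|]. intros x. rewrite EP, H4, H3, H2, H1. lra. }
        exfalso. specialize (Hpos (- (c0 + 1) / c1)). rewrite EP, H4, H3, H2 in Hpos.
        replace (c1 * (- (c0 + 1) / c1)) with (- (c0 + 1)) in Hpos by (field; exact H1). lra.
      * set (T := 1 + Rabs c1 / c2).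
        assert (T1 := HT1 (Rabs c1) c2 ltac:(lra) H2). fold T in T1.
        assert (T2 := HT (Rabs c1) c2 ltac:(lra) H2). fold T in T2.
        apply (minimum_of_coercive P T Hcont); [lra|].
        intros x Hx. rewrite P0, EP, H4, H3. specialize (B c1 x).
        rewrite <- (pow2_abs x). assert (Rabs c1 <= c2 * Rabs x) by nra. nra.
    + exfalso.
      set (s := Rabs c2 + Rabs c1 + Rabs c0) in *. set (k := Rabs c3) in *.
      assert (Hk : 0 < k) by now apply Rabs_pos_lt.
      set (T := 1 + s / k).
      assert (T1 := HT1 s k ltac:(unfold s; lra) Hk). fold T in T1.
      assert (T2 := HT s k ltac:(unfold s; lra) Hk). fold T in T2.
      assert (Hx : exists x, Rabs x = T /\ c3 * x ^ 3 = - k * T ^ 3).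
      { unfold k. destruct (Rle_lt_dec 0 c3) as [H|H].
        - exists (- T). rewrite Rabs_Ropp, !Rabs_pos_eq by lra. split; [reflexivity | ring].
        - exists T. rewrite (Rabs_pos_eq T), (Rabs_left c3) by lra. split; [reflexivity | ring]. }
      destruct Hx as (x & Ax & Ex).
      specialize (Hquad x ltac:(lra)). specialize (Hpow x ltac:(lra)).
      rewrite Ax in Hquad, Hpow. apply Rabs_le_between in Hquad.
      specialize (Hpos x). rewrite EP, H4, Ex in Hpos.
      assert (Hc0 := Rle_abs c0).
      assert (c0 <= Rabs c0 * T ^ 2) by nra.
      assert (k * T ^ 3 = k * T * T ^ 2) by ring.
      assert (0 < T ^ 2) by lra.
      unfold s in T2. nra.
  - set (s := Rabs c3 + Rabs c2 + Rabs c1) in *. set (T := 1 + s / c4).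
    assert (T1 := HT1 s c4 ltac:(unfold s; lra) H4). fold T in T1.
    assert (T2 := HT s c4 ltac:(unfold s; lra) H4). fold T in T2.
    apply (minimum_of_coercive P T Hcont); [lra|].
    intros x Hx. rewrite P0, EP. specialize (Hcub x ltac:(lra)).
    apply Rabs_le_between in Hcub.
    replace (x ^ 4) with (Rabs x * Rabs x ^ 3)
      by (transitivity ((Rabs x ^ 2) ^ 2); [ring | rewrite pow2_abs; ring]).
    assert (H : s <= c4 * Rabs x) by nra.
    assert (H3 : 0 <= Rabs x ^ 3) by (apply pow_le, Rabs_pos). nra.
Qed.

(** * The differential equation at a zero *)

(** The right-hand side of [d2 = 2 a d1 - b d0], differentiated. *)
Lemma ode_derivative (d0 d1 d2 a b : R -> R) (x d3 a1 b1 : R) :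
  locally x (fun t => d2 t = 2 * a t * d1 t - b t * d0 t) ->
  is_derive d0 x (d1 x) -> is_derive d1 x (d2 x) -> is_derive d2 x d3 ->
  is_derive a x a1 -> is_derive b x b1 ->
  d3 = 2 * a1 * d1 x + 2 * a x * d2 x - b1 * d0 x - b x * d1 x.
Proof.
  intros Hode D0 D1 D2 Ha Hb.
  rewrite <- (is_derive_unique _ _ _ D2). apply is_derive_unique.
  apply (is_derive_ext_loc (fun t => 2 * a t * d1 t - b t * d0 t)).
  { eapply filter_imp; [|exact Hode]. intros t Ht. symmetry. exact Ht. }
  evar_last.
  - apply (is_derive_minus (V := R_NormedModule) (fun t => 2 * a t * d1 t) (fun t => b t * d0 t)).
    + apply (is_derive_mult (K := R_AbsRing) (fun t => 2 * a t) d1);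
        [| exact D1 | intros; apply Rmult_comm].
      apply (is_derive_scal a x 2 a1 Ha).
    + apply (is_derive_mult (K := R_AbsRing) b d0); [exact Hb | exact D0 | intros; apply Rmult_comm].
  - unfold minus, plus, opp, mult; simpl. ring.
Qed.

(** The derivative of the right-hand side of the preceding formula at a zero
    of [d0], where the second derivative of [b] drops out. *)
Lemma ode_second_derivative (d0 d1 d2 d3 a b a' b' : R -> R) (x d4 a2 b2 : R) :
  locally x (fun t => d3 t = 2 * a' t * d1 t + 2 * a t * d2 t - b' t * d0 t - b t * d1 t) ->
  is_derive d0 x (d1 x) -> is_derive d1 x (d2 x) -> is_derive d2 x (d3 x) ->
  is_derive d3 x d4 ->
  is_derive a x (a' x) -> is_derive b x (b' x) -> is_derive a' x a2 -> is_derive b' x b2 ->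
  d0 x = 0 ->
  d4 = 2 * a2 * d1 x + 4 * a' x * d2 x + 2 * a x * d3 x - 2 * b' x * d1 x - b x * d2 x.
Proof.
  intros Hode D0 D1 D2 D3 Ha Hb Ha' Hb' H0.
  rewrite <- (is_derive_unique _ _ _ D3). apply is_derive_unique.
  apply (is_derive_ext_loc
    (fun t => 2 * a' t * d1 t + 2 * a t * d2 t - b' t * d0 t - b t * d1 t)).
  { eapply filter_imp; [|exact Hode]. intros t Ht. symmetry. exact Ht. }
  assert (M : forall (p q : R -> R) (u v : R), is_derive p x u -> is_derive q x v ->
            is_derive (fun s => p s * q s) x (u * q x + p x * v)).
  { intros p q u v Hp Hq. apply (is_derive_mult (K := R_AbsRing) p q x u v Hp Hq).
    intros n m; apply Rmult_comm. }
  evar_last.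
  - apply (is_derive_minus (V := R_NormedModule)
      (fun t => 2 * a' t * d1 t + 2 * a t * d2 t - b' t * d0 t) (fun t => b t * d1 t)).
    + apply (is_derive_minus (V := R_NormedModule)
        (fun t => 2 * a' t * d1 t + 2 * a t * d2 t) (fun t => b' t * d0 t)).
      * apply (is_derive_plus (V := R_NormedModule)
          (fun t => 2 * a' t * d1 t) (fun t => 2 * a t * d2 t)).
        -- apply (M (fun t => 2 * a' t) d1); [apply (is_derive_scal a' x 2 a2 Ha') | exact D1].
        -- apply (M (fun t => 2 * a t) d2); [apply (is_derive_scal a x 2 _ Ha) | exact D2].
      * apply (M b' d0); [exact Hb' | exact D0].
    + apply (M b d1); [exact Hb | exact D1].
  - unfold minus, plus, opp; simpl. rewrite H0. ring.
Qed.

Theorem theorem3 :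
  forall (f : C -> C) (Da Db : R -> Prop) (a b : R -> R),
    real_entire f ->
    (exists z : C, f z <> RtoC 0) ->
    Rbar_lt (growth_order f) (Finite 2) ->
    only_real_simple_zeros f ->
    satisfies_ode (restr_R f) Da a Db b ->
    forall xi : R, f (RtoC xi) = RtoC 0 ->
      (differentiable_near Da a xi -> differentiable_near Db b xi ->
         0 <= Delta_fn a b xi - 2 * Derive a xi)
      /\
      (twice_differentiable_near Da a xi ->
       twice_differentiable_near Db b xi ->
         exists m : R, is_minimum (quartic a b xi) m /\ 0 <= m).
Proof.
  intros f Da Db a b [Ef Hreal] _ Hord Hzeros Hode xi Hxi.
  destruct (entire_derivative f Ef) as [f1 [F1 E1]].
  destruct (entire_derivative f1 E1) as [f2 [F2 E2]].
  destruct (entire_derivative f2 E2) as [f3 [F3 E3]].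
  destruct (entire_derivative f3 E3) as [f4 [F4 E4]].
  destruct (power_sum_inequalities f f1 f2 f3 f4 xi F1
              (conj F2 (conj F3 (conj F4 E4))) Hreal
              (growth_minimal_type_2 f Hord) Hzeros Hxi) as (Hy1 & HS2 & HS3).
  set (d0 := restr_R f) in *. set (d1 := restr_R f1) in *. set (d2 := restr_R f2) in *.
  set (d3 := restr_R f3) in *. set (d4 := restr_R f4) in *.
  assert (D0 : forall x, is_derive d0 x (d1 x)) by (intros x; now apply restr_R_derive).
  assert (D1 : forall x, is_derive d1 x (d2 x)) by (intros x; now apply restr_R_derive).
  assert (D2 : forall x, is_derive d2 x (d3 x)) by (intros x; now apply restr_R_derive).
  assert (D3 : forall x, is_derive d3 x (d4 x)) by (intros x; now apply restr_R_derive).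
  assert (Hd0 : d0 xi = 0) by (unfold d0, restr_R; now rewrite Hxi).
  assert (Hder1 : forall x, Derive d0 x = d1 x) by (intros x; now apply is_derive_unique).
  assert (Hder2 : forall x, Derive_n d0 2 x = d2 x).
  { intros x. simpl. rewrite (Derive_ext _ d1) by apply Hder1. now apply is_derive_unique. }
  assert (Hode' : forall x, Da x -> Db x -> d2 x = 2 * a x * d1 x - b x * d0 x).
  { intros x Hax Hbx. assert (H := Hode x Hax Hbx). rewrite Hder2, Hder1 in H. lra. }
  assert (Hfirst : differentiable_near Da a xi -> differentiable_near Db b xi ->
    d2 xi = 2 * a xi * d1 xi /\
    d3 xi = (2 * Derive a xi + 4 * a xi ^ 2 - b xi) * d1 xi /\
    locally xi (fun x => d3 x =
      2 * Derive a x * d1 x + 2 * a x * d2 x - Derive b x * d0 x - b x * d1 x)).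
  { intros Ha Hb. assert (Hab := filter_and _ _ Ha Hb).
    assert (H2 : d2 xi = 2 * a xi * d1 xi).
    { destruct (locally_singleton _ _ Hab) as [[Hax _] [Hbx _]].
      rewrite Hode' by assumption. rewrite Hd0. ring. }
    assert (H3 : locally xi (fun x => d3 x =
      2 * Derive a x * d1 x + 2 * a x * d2 x - Derive b x * d0 x - b x * d1 x)).
    { apply locally_locally in Hab. eapply filter_imp; [|exact Hab]. intros x Hx.
      destruct (locally_singleton _ _ Hx) as [[_ Hax] [_ Hbx]].
      apply (ode_derivative d0 d1 d2 a b x); auto; try now apply Derive_correct.
      eapply filter_imp; [|exact Hx]. intros t [[Hat _] [Hbt _]]. auto. }
    split; [exact H2|]. split; [|exact H3].
    rewrite (locally_singleton _ _ H3), H2, Hd0. ring. }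
  assert (HS2eq : differentiable_near Da a xi -> differentiable_near Db b xi ->
    power_sum2 (d1 xi) (d2 xi) (d3 xi) = (Delta_fn a b xi - 2 * Derive a xi) / 3).
  { intros Ha Hb. destruct (Hfirst Ha Hb) as (H2 & H3 & _).
    unfold power_sum2, Delta_fn. rewrite H3, H2. field. exact Hy1. }
  split.
  - intros Ha Hb. rewrite HS2eq in HS2 by assumption. lra.
  - intros Ha2 Hb2.
    assert (Ha : differentiable_near Da a xi)
      by (unfold differentiable_near; eapply filter_imp; [|exact Ha2]; intros t (? & ? & _); auto).
    assert (Hb : differentiable_near Db b xi)
      by (unfold differentiable_near; eapply filter_imp; [|exact Hb2]; intros t (? & ? & _); auto).
    destruct (Hfirst Ha Hb) as (H2 & H3 & Hloc3).
    destruct (locally_singleton _ _ Ha2) as (_ & Dax & Daax).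
    destruct (locally_singleton _ _ Hb2) as (_ & Dbx & Dbbx).
    assert (H4 := ode_second_derivative d0 d1 d2 d3 a b (Derive a) (Derive b) xi (d4 xi)
      (Derive_n a 2 xi) (Derive_n b 2 xi) Hloc3 (D0 xi) (D1 xi) (D2 xi) (D3 xi)
      (Derive_correct a xi Dax) (Derive_correct b xi Dbx)
      (Derive_correct (Derive a) xi Daax) (Derive_correct (Derive b) xi Dbbx) Hd0).
    (* the quartic depends on [a], [b] only through [a xi] and the two power
       sums, which makes it a sum of controlled terms *)
    assert (Hquartic : forall lam, quartic a b xi lam =
      (1 - a xi * lam) ^ 4
      + 6 * (1 - a xi * lam) ^ 2 * lam ^ 2 * power_sum2 (d1 xi) (d2 xi) (d3 xi)
      + 9 * lam ^ 4 * power_sum2 (d1 xi) (d2 xi) (d3 xi) ^ 2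
      + 16 * (1 - a xi * lam) * lam ^ 3 * power_sum3 (d1 xi) (d2 xi) (d3 xi) (d4 xi)).
    { intros lam. unfold quartic, power_sum2, power_sum3.
      rewrite H4, H3, H2. field. exact Hy1. }
    assert (Hpos : forall lam, 0 <= quartic a b xi lam)
      by (intros lam; rewrite Hquartic; now apply power_sum_quartic_nonneg).
    destruct (quartic_minimum 1 (- 4 * a xi)
      (2 * (2 * a xi ^ 2 + b xi - 2 * Derive a xi))
      (- 4 * (a xi * b xi - 4 * a xi * Derive a xi + Derive b xi - Derive_n a 2 xi))
      (b xi ^ 2 - 8 * a xi ^ 2 * Derive a xi - 4 * b xi * Derive a xi + 4 * Derive a xi ^ 2
        + 4 * a xi * Derive b xi - 4 * a xi * Derive_n a 2 xi)
      (quartic a b xi)) as [m Hm]; [intros x; unfold quartic; ring | exact Hpos |].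
    exists m. split; [exact Hm|].
    destruct Hm as [[l <-] _]. apply Hpos.
Qed.
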